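(* Let $T>0$, let $r\ge3$ be an integer, and let $\eta_0,u_0$ be real constants with $1+\eta_0>0$ and $u_0^2<1+\eta_0$; put $\delta_0=\sqrt{1+\eta_0}$. Let $\eta^0,u^0$ be given functions on $[0,1]$ and let $(\eta,u)$ be a sufficiently smooth solution on $[0,1]\times[0,T]$, with $1+\eta>0$, of the initial-boundary-value problem $$\eta_t+u_x+(\eta u)_x=0,\qquad u_t+\eta_x+uu_x=0,\qquad 0\le x\le1,\ 0\le t\le T,$$ $$\eta(x,0)=\eta^0(x),\quad u(x,0)=u^0(x),\quad 0\le x\le 1,$$ $$u(0,t)+2\sqrt{1+\eta(0,t)}=u_0+2\sqrt{1+\eta_0},\qquad u(1,t)-2\sqrt{1+\eta(1,t)}=u_0-2\sqrt{1+\eta_0},\qquad 0\le t\le T.$$ Assume that for some constant $c_0>0$ $$u_0+\sqrt{1+\eta_0}\ge c_0,\qquad u_0-\sqrt{1+\eta_0}\le -c_0,$$ and, for all $(x,t)\in[0,1]\times[0,T]$, $$u+\sqrt{1+\eta}\ge c_0,\qquad u-\sqrt{1+\eta}\le -c_0.$$ Let $v=\tfrac12[u-u_0+2(\sqrt{1+\eta}-\delta_0)]$, $w=\tfrac12[u-u_0-2(\sqrt{1+\eta}-\delta_0)]$, so that $(v,w)$ is the solution of the diagonal form of the problem, $$v_t+\bigl(u_0+\delta_0+\tfrac{3v+w}{2}\bigr)v_x=0,\qquad w_t+\bigl(u_0-\delta_0+\tfrac{v+3w}{2}\bigr)w_x=0,\qquad 0\le x\le1,\ 0\le t\le T,$$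 $$v(x,0)=v^0(x),\quad w(x,0)=w^0(x),\quad 0\le x\le1;\qquad v(0,t)=0,\quad w(1,t)=0,\quad 0\le t\le T,$$ where $v^0=\tfrac12[u^0-u_0+2(\sqrt{1+\eta^0}-\delta_0)]$ and $w^0=\tfrac12[u^0-u_0-2(\sqrt{1+\eta^0}-\delta_0)]$. Fix $\kappa\ge1$. Then there exist $h_0>0$ and $C>0$ (independent of the partition and of $h$) such that for every partition $0=x_1<x_2<\dots<x_{N+1}=1$ with $h:=\max_i(x_{i+1}-x_i)\le h_0$ and $h\le\kappa\min_i(x_{i+1}-x_i)$, the following holds. With $\mathring{S}_h,\mathring{\mathcal{S}}_h$ the finite element spaces defined in the context and $P,\mathcal{P}$ the $L^2(0,1)$-orthogonal projections onto $\mathring{S}_h$ and $\mathring{\mathcal{S}}_h$ respectively, the semidiscrete initial-value problem of finding $v_h:[0,T]\to\mathring{S}_h$, $w_h:[0,T]\to\mathring{\mathcal{S}}_h$ such that for $0\le t\le T$ $$(v_{ht},\phi)+((u_0+\delta_0)v_{hx},\phi)+\tfrac32(v_hv_{hx},\phi)+\tfrac12(w_hv_{hx},\phi)=0\quad\forall\phi\in\mathring{S}_h,$$ $$(w_{ht},\chi)+((u_0-\delta_0)w_{hx},\chi)+\tfrac32(w_hw_{hx},\chi)+\tfrac12(v_hw_{hx},\chi)=0\quad\forall\chi\in\mathring{\mathcal{S}}_h,$$ $$v_h(0)=P(v^0),\qquad w_h(0)=\mathcal{P}(w^0),$$ has a unique solution $(v_h,w_h)$ on $[0,T]$, and it satisfies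 $$\max_{0\le t\le T}\bigl(\|v-v_h\|+\|w-w_h\|\bigr)\le Ch^{r-1}.$$ Moreover, if $$\eta_h=\bigl[\tfrac12(v_h-w_h)+\delta_0\bigr]^2-1,\qquad u_h=v_h+w_h+u_0,$$ then $$\max_{0\le t\le T}\bigl(\|\eta-\eta_h\|+\|u-u_h\|\bigr)\le Ch^{r-1}.$$
   Context: $(\cdot,\cdot)$ and $\|\cdot\|$ denote the inner product and norm of $L^2(0,1)$; subscripts $x,t$ denote partial derivatives. $\mathbb{P}_{r-1}$ is the set of polynomials of degree $\le r-1$. For a partition $0=x_1<\dots<x_{N+1}=1$ of $[0,1]$, $$\mathring{S}_h=\{\phi\in C^{r-2}[0,1]:\ \phi(0)=0,\ \phi|_{[x_j,x_{j+1}]}\in\mathbb{P}_{r-1},\ 1\le j\le N\},$$ $$\mathring{\mathcal{S}}_h=\{\phi\in C^{r-2}[0,1]:\ \phi(1)=0,\ \phi|_{[x_j,x_{j+1}]}\in\mathbb{P}_{r-1},\ 1\le j\le N\}.$$ The partitions are quasiuniform, i.e. $\max_i(x_{i+1}-x_i)\le\kappa\min_i(x_{i+1}-x_i)$ with a fixed constant $\kappa$. ''Sufficiently smooth'' means: there is an integer $m$ depending only on $r$ such that the result holds whenever $\eta,u\in C^m([0,1]\times[0,T])$ (equivalently $v,w\in C^m([0,1]\times[0,T])$, since $1+\eta>0$). The constants $h_0$ and $C$ may depend on $\eta,u,T,r,\kappa,c_0,\eta_0,u_0$, but not on $h$ or on the particular partition. A solution of the semidiscrete problem is understood to be a pair of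 continuously differentiable functions of $t$ with values in the finite-dimensional spaces $\mathring{S}_h$, $\mathring{\mathcal{S}}_h$. *)

(* Defs.v *)
From Stdlib Require Import Reals List.
From Stdlib Require Import RList.
From Coquelicot Require Import Coquelicot.
Open Scope R_scope.

Definition Icc (a b x : R) : Prop := a <= x <= b.

(** The derivative is relative to [[a,b]], hence one-sided at the end points. *)
Definition is_derive_on (a b : R) (f : R -> R) (x l : R) : Prop :=
  filterdiff f (within (Icc a b) (locally x)) (fun y : R => scal y l).

Definition Derive_on (a b : R) (f : R -> R) (x : R) : R :=
  iota (fun l : R => is_derive_on a b f x l).

(** [f] belongs to [C^k[a,b]]; [D i] is the [i]-th derivative of [f]. *)
Definition Ck_on (a b : R) (k : nat) (f : R -> R) : Prop :=
  exists D : nat -> R -> R,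
    (forall x, Icc a b x -> D 0%nat x = f x) /\
    (forall i x, (i < k)%nat -> Icc a b x ->
       is_derive_on a b (D i) x (D (S i) x)) /\
    (forall i, (i <= k)%nat -> continuous_on (Icc a b) (D i)).

(** [f] belongs to [C^m([0,1] x [0,T])]; [D i j] is [d^(i+j) f / dx^i dt^j]. *)
Definition Cm_rect (T : R) (m : nat) (f : R -> R -> R) : Prop :=
  exists D : nat -> nat -> R -> R -> R,
    (forall x t, Icc 0 1 x -> Icc 0 T t -> D 0%nat 0%nat x t = f x t) /\
    (forall i j x t, (i + j < m)%nat -> Icc 0 1 x -> Icc 0 T t ->
       is_derive_on 0 1 (fun y => D i j y t) x (D (S i) j x t) /\
       is_derive_on 0 T (fun s => D i j x s) t (D i (S j) x t)) /\
    (forall i j, (i + j <= m)%nat ->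
       continuous_on (fun p : R * R => Icc 0 1 (fst p) /\ Icc 0 T (snd p))
         (fun p : R * R => D i j (fst p) (snd p))).

Definition Dx (f : R -> R -> R) (x t : R) : R :=
  Derive_on 0 1 (fun y => f y t) x.

Definition Dt (T : R) (f : R -> R -> R) (x t : R) : R :=
  Derive_on 0 T (fun s => f x s) t.

(** The inner product of [L^2(0,1)], only ever applied to functions that are
    continuous on [[0,1]], where the Riemann and Lebesgue integrals coincide. *)

Definition inner (f g : R -> R) : R := RInt (fun x => f x * g x) 0 1.

Definition L2norm (f : R -> R) : R := sqrt (inner f f).

(** The nodes are [x 1, ..., x (N+1)]; the other values of [x] are irrelevant.
    [N >= 1] is forced by [x 1 = 0] and [x (N+1) = 1]. *)
Definition is_partition (N : nat) (x : nat -> R) : Prop :=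
  x 1%nat = 0 /\ x (N + 1)%nat = 1 /\
  forall j, (1 <= j <= N)%nat -> x j < x (j + 1)%nat.

Definition mesh_lengths (N : nat) (x : nat -> R) : list R :=
  map (fun j => x (j + 1)%nat - x j) (seq 1 N).

Definition mesh_max (N : nat) (x : nat -> R) : R := MaxRlist (mesh_lengths N x).
Definition mesh_min (N : nat) (x : nat -> R) : R := MinRlist (mesh_lengths N x).

(** Coincidence on [[a,b]] with a polynomial of degree at most [d]. *)
Definition poly_on (d : nat) (a b : R) (f : R -> R) : Prop :=
  exists c : nat -> R,
    forall x, Icc a b x -> f x = sum_n (fun k => c k * x ^ k) d.

Definition spline (r N : nat) (x : nat -> R) (phi : R -> R) : Prop :=
  Ck_on 0 1 (r - 2) phi /\
  forall j, (1 <= j <= N)%nat ->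
    poly_on (r - 1) (x j) (x (j + 1)%nat) phi.

Definition S_left (r N : nat) (x : nat -> R) (phi : R -> R) : Prop :=
  spline r N x phi /\ phi 0 = 0.

Definition S_right (r N : nat) (x : nat -> R) (phi : R -> R) : Prop :=
  spline r N x phi /\ phi 1 = 0.

(** [p] is the [L^2(0,1)]-orthogonal projection of [f] onto the space [V]. *)
Definition is_L2_proj (V : (R -> R) -> Prop) (f p : R -> R) : Prop :=
  V p /\ forall phi, V phi -> inner p phi = inner f phi.

(** [z] is a continuously differentiable map from [[0,T]] to [V], normed by the
    [L^2] norm (any other norm gives the same notion when [V] is
    finite-dimensional), and [zt] is its derivative. *)
Definition is_C1_map (T : R) (V : (R -> R) -> Prop) (z zt : R -> R -> R) : Prop :=
  forall t, Icc 0 T t ->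
    V (z t) /\ V (zt t) /\
    filterlim (fun s => L2norm (fun x => (z s x - z t x) / (s - t) - zt t x))
      (within (Icc 0 T) (locally' t)) (locally 0) /\
    filterlim (fun s => L2norm (fun x => zt s x - zt t x))
      (within (Icc 0 T) (locally t)) (locally 0).

Record swe_solution (T eta0 u0 : R) (etai ui : R -> R) (eta u : R -> R -> R)
    : Prop := {
  swe_mass : forall x t, Icc 0 1 x -> Icc 0 T t ->
    Dt T eta x t + Dx u x t + Dx (fun y s => eta y s * u y s) x t = 0;
  swe_momentum : forall x t, Icc 0 1 x -> Icc 0 T t ->
    Dt T u x t + Dx eta x t + u x t * Dx u x t = 0;
  swe_init : forall x, Icc 0 1 x -> eta x 0 = etai x /\ u x 0 = ui x;
  swe_left : forall t, Icc 0 T t ->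
    u 0 t + 2 * sqrt (1 + eta 0 t) = u0 + 2 * sqrt (1 + eta0);
  swe_right : forall t, Icc 0 T t ->
    u 1 t - 2 * sqrt (1 + eta 1 t) = u0 - 2 * sqrt (1 + eta0)
}.

(** The values of [v] and [w] at a point where [eta] and [u] have the values
    [e] and [q]. *)
Definition riemann_v (eta0 u0 e q : R) : R :=
  1 / 2 * (q - u0 + 2 * (sqrt (1 + e) - sqrt (1 + eta0))).
Definition riemann_w (eta0 u0 e q : R) : R :=
  1 / 2 * (q - u0 - 2 * (sqrt (1 + e) - sqrt (1 + eta0))).

Record diag_solution (T delta0 u0 : R) (vi wi : R -> R) (v w : R -> R -> R)
    : Prop := {
  diag_v : forall x t, Icc 0 1 x -> Icc 0 T t ->
    Dt T v x t + (u0 + delta0 + (3 * v x t + w x t) / 2) * Dx v x t = 0;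
  diag_w : forall x t, Icc 0 1 x -> Icc 0 T t ->
    Dt T w x t + (u0 - delta0 + (v x t + 3 * w x t) / 2) * Dx w x t = 0;
  diag_init : forall x, Icc 0 1 x -> v x 0 = vi x /\ w x 0 = wi x;
  diag_bdry : forall t, Icc 0 T t -> v 0 t = 0 /\ w 1 t = 0
}.

(** Semidiscrete functions take the time first: [vh t] is an element of the
    finite element space. *)

Definition semidiscrete_solution (r N : nat) (x : nat -> R) (T delta0 u0 : R)
    (vi wi : R -> R) (vh wh : R -> R -> R) : Prop :=
  exists vht wht : R -> R -> R,
    is_C1_map T (S_left r N x) vh vht /\
    is_C1_map T (S_right r N x) wh wht /\
    (forall t, Icc 0 T t ->
       let vhx := Derive_on 0 1 (vh t) in
       let whx := Derive_on 0 1 (wh t) in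
       (forall phi, S_left r N x phi ->
          inner (vht t) phi
          + inner (fun y => (u0 + delta0) * vhx y) phi
          + 3 / 2 * inner (fun y => vh t y * vhx y) phi
          + 1 / 2 * inner (fun y => wh t y * vhx y) phi = 0) /\
       (forall chi, S_right r N x chi ->
          inner (wht t) chi
          + inner (fun y => (u0 - delta0) * whx y) chi
          + 3 / 2 * inner (fun y => wh t y * whx y) chi
          + 1 / 2 * inner (fun y => vh t y * whx y) chi = 0)) /\
    is_L2_proj (S_left r N x) vi (vh 0) /\
    is_L2_proj (S_right r N x) wi (wh 0).

(* Main.v *)
Require Import Defs.
From Stdlib Require Import Reals List RList Compare_dec Lra Lia Classical ClassicalEpsilon.
From Coquelicot Require Import Coquelicot.
Open Scope R_scope.

(** Let [V(t)], [W(t)] be spline approximations of the Riemann invariants [v], [w] which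
    vanish at the inflow ends, depend linearly on point values of [x]-derivatives (so that they
    commute with the time derivative) and are accurate to [O(h^(r-1))] together with their
    first derivatives.  The errors [theta = V - v_h] and [xi = W - w_h] solve a quadratic
    system with an [O(h^(r-1))] residual.  In the energy identity the transport terms are total
    derivatives up to [O(|theta|^2 + |xi|^2)]; the boundary contributions at the outflow ends
    have a favourable sign because [u + sqrt (1 + eta) >= c_0] and
    [u - sqrt (1 + eta) <= - c_0] there, provided that [theta], [xi] and their derivatives are
    small.  Multiplying the quadratic terms by a cut-off factor makes the system globally
    Lipschitz and enforces this smallness (by the inverse inequalities, on a ball of radius of
    order [h^(3/2)]), so Gronwall's lemma gives the bound [O(h^(r-1))] on the whole of [[0,T]].
    As [r - 1 > 3/2], for small [h] the cut-off is never active, and the solution of the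
    modified system is the solution of the original one. *)

(** * Calculus relative to a compact interval *)

(** The obstacle is circular: after integration by parts the energy still contains [xi_x theta^2]
    and cubic boundary terms, which are harmless only if the error is already small in the maximum
    norm together with its derivative, and this is not known before the solution exists. The cut-off
    is one scalar for each time, not a function of [x], so it passes through every integration by
    parts; existence on [[0,T]], smallness and the error bound then come out of a single Gronwall
    estimate, with no continuation argument. The power [h^(3/2)] is dictated by the inverse
    inequality [max |f'|^2 <= K h^(-3) |f|^2], which has to bring the derivative of the error below
    1. [V] and [W] arise by integrating a quasi-interpolant of the [x]-derivative from the inflow
    end: the boundary condition is then exact, and the derivative, a spline of degree [r - 2], is
    accurate to [h^(r-1)], which is the order claimed. Their coefficients are point values, so
    differentiation in time acts on the coefficients alone and the approximations of [v_t], [w_t]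
    are of the same kind. *)

Definition clamp (a b x : R) : R := Rmax a (Rmin b x).

Lemma clamp_in (a b x : R) : a <= b -> Icc a b (clamp a b x).
Proof.
  intros H; unfold Icc, clamp, Rmax, Rmin.
  repeat destruct Rle_dec; lra.
Qed.

Lemma clamp_id (a b x : R) : Icc a b x -> clamp a b x = x.
Proof.
  unfold Icc, clamp, Rmax, Rmin; intros H.
  repeat destruct Rle_dec; lra.
Qed.

Lemma clamp_lip (a b x y : R) : Rabs (clamp a b y - clamp a b x) <= Rabs (y - x).
Proof.
  unfold clamp, Rmax, Rmin.
  repeat destruct Rle_dec; unfold Rabs; repeat destruct Rcase_abs; lra.
Qed.

Lemma continuous_clamp (a b x : R) : continuous (clamp a b) x.
Proof.
  apply filterlim_locally; intros eps.
  exists eps; intros y Hy.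
  apply Rle_lt_trans with (1 := clamp_lip a b x y); exact Hy.
Qed.

(** Composition with the 1-Lipschitz retraction [clamp] extends a function from [[a,b]] to the line
    without loss of continuity; this is how theorems about functions continuous everywhere are
    brought to bear on [continuous_on]. *)
Lemma continuous_on_clamp_comp (a b : R) (f : R -> R) :
  a <= b -> continuous_on (Icc a b) f ->
  forall x, continuous (fun y => f (clamp a b y)) x.
Proof.
  intros Hab Hf x.
  apply filterlim_locally; intros eps.
  destruct (proj1 (filterlim_locally _ _) (Hf _ (clamp_in a b x Hab)) eps) as [d Hd].
  exists d; intros y Hy.
  apply Hd; [|now apply clamp_in].
  apply Rle_lt_trans with (1 := clamp_lip a b x y); exact Hy.
Qed.

Lemma continuous_clamp_comp_on (a b : R) (f : R -> R) :
  (forall x, Icc a b x -> continuous (fun y => f (clamp a b y)) x) ->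
  continuous_on (Icc a b) f.
Proof.
  intros Hf x Hx.
  apply filterlim_locally; intros eps.
  destruct (proj1 (filterlim_locally _ _) (Hf x Hx) eps) as [d Hd].
  exists d; intros y Hy Hy'.
  generalize (Hd y Hy); now rewrite !clamp_id.
Qed.

Lemma continuous_on_continuous (a b : R) (f : R -> R) :
  (forall x, Icc a b x -> continuous f x) -> continuous_on (Icc a b) f.
Proof. intros; now apply continuous_on_forall. Qed.

Lemma continuous_on_eq (a b : R) (f g : R -> R) :
  (forall x, Icc a b x -> f x = g x) ->
  continuous_on (Icc a b) f -> continuous_on (Icc a b) g.
Proof.
  intros Hfg Hf x Hx; rewrite <- Hfg by easy.
  apply filterlim_within_ext with f; [easy|now apply Hf].
Qed.

Lemma continuous_on_const (a b c : R) : continuous_on (Icc a b) (fun _ : R => c).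
Proof. apply continuous_on_continuous; intros; apply continuous_const. Qed.

Lemma continuous_on_plus (a b : R) (f g : R -> R) :
  continuous_on (Icc a b) f -> continuous_on (Icc a b) g ->
  continuous_on (Icc a b) (fun x => f x + g x).
Proof.
  intros Hf Hg; apply continuous_clamp_comp_on; intros x Hx.
  assert (a <= b) by (destruct Hx; lra).
  apply (continuous_plus (fun y => f (clamp a b y)) (fun y => g (clamp a b y)));
    now apply continuous_on_clamp_comp.
Qed.

Lemma continuous_on_mult (a b : R) (f g : R -> R) :
  continuous_on (Icc a b) f -> continuous_on (Icc a b) g ->
  continuous_on (Icc a b) (fun x => f x * g x).
Proof.
  intros Hf Hg; apply continuous_clamp_comp_on; intros x Hx.
  assert (a <= b) by (destruct Hx; lra).
  apply (continuous_mult (fun y => f (clamp a b y)) (fun y => g (clamp a b y)));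
    now apply continuous_on_clamp_comp.
Qed.

Lemma continuous_on_opp (a b : R) (f : R -> R) :
  continuous_on (Icc a b) f -> continuous_on (Icc a b) (fun x => - f x).
Proof.
  intros Hf; apply (continuous_on_eq a b (fun x => (-1) * f x)); [intros; ring|].
  apply continuous_on_mult; [apply continuous_on_const|easy].
Qed.

Lemma continuous_on_minus (a b : R) (f g : R -> R) :
  continuous_on (Icc a b) f -> continuous_on (Icc a b) g ->
  continuous_on (Icc a b) (fun x => f x - g x).
Proof.
  intros Hf Hg; apply continuous_on_plus; [easy|now apply continuous_on_opp].
Qed.

Lemma continuous_on_bounded (a b : R) (f : R -> R) :
  a <= b -> continuous_on (Icc a b) f ->
  exists M, 0 <= M /\ forall x, Icc a b x -> Rabs (f x) <= M.
Proof.
  intros Hab Hf.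
  destruct (continuity_ab_maj (fun y => Rabs (f (clamp a b y))) a b Hab) as [m [Hm _]].
  - intros c _; apply continuity_pt_filterlim.
    apply (continuous_comp (fun y => f (clamp a b y)) Rabs).
    + now apply continuous_on_clamp_comp.
    + apply continuous_Rabs.
  - exists (Rabs (f (clamp a b m))); split; [apply Rabs_pos|].
    intros x Hx; generalize (Hm x Hx); now rewrite (clamp_id a b x).
Qed.

Ltac cont_on :=
  first
    [ assumption
    | match goal with
      | |- continuous_on (Icc ?a ?b) (fun _ => ?c) => apply (continuous_on_const a b c)
      | |- continuous_on (Icc ?a ?b) (fun x => @?f x + @?g x) =>
          apply (continuous_on_plus a b f g); cont_on
      | |- continuous_on (Icc ?a ?b) (fun x => @?f x - @?g x) =>
          apply (continuous_on_minus a b f g); cont_on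
      | |- continuous_on (Icc ?a ?b) (fun x => @?f x * @?g x) =>
          apply (continuous_on_mult a b f g); cont_on
      end ].

(** * Derivatives relative to an interval *)

Lemma is_filter_lim_within (a b x y : R) :
  Icc a b x -> is_filter_lim (within (Icc a b) (locally x)) y -> y = x.
Proof.
  intros Hx Hy.
  assert (HP : ProperFilter (within (Icc a b) (locally x))).
  { constructor; [|apply within_filter, locally_filter].
    intros P [d Hd]; exists x; apply Hd; [apply ball_center|exact Hx]. }
  apply Req_lt_aux; intros eps.
  assert (He : 0 < eps / 2) by (destruct eps; simpl; lra).
  assert (H1 : within (Icc a b) (locally x) (ball y (eps / 2))).
  { apply Hy; exists (mkposreal _ He); intros z Hz; exact Hz. }
  assert (H2 : within (Icc a b) (locally x) (ball x (eps / 2))).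
  { exists (mkposreal _ He); intros z Hz _; exact Hz. }
  destruct (filter_ex _ (filter_and _ _ H1 H2)) as [z [Hz1 Hz2]].
  change (Rabs (z - y) < eps / 2) in Hz1.
  change (Rabs (z - x) < eps / 2) in Hz2.
  revert Hz1 Hz2; unfold Rabs; repeat destruct Rcase_abs; lra.
Qed.

Lemma is_derive_on_eps (a b : R) (f : R -> R) (x l : R) :
  Icc a b x ->
  is_derive_on a b f x l <->
  forall eps, 0 < eps -> exists d, 0 < d /\ forall y, Icc a b y -> Rabs (y - x) < d ->
    Rabs (f y - f x - l * (y - x)) <= eps * Rabs (y - x).
Proof.
  intros Hx; split.
  - intros [_ H] eps Heps.
    destruct (H x (fun P HP => filter_le_within _ P HP) (mkposreal eps Heps)) as [d Hd].
    exists d; split; [apply cond_pos|].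
    intros y Hy Hyx; specialize (Hd y Hyx Hy); simpl in Hd.
    unfold norm, minus, plus, opp, scal in Hd; simpl in Hd.
    unfold abs, mult in Hd; simpl in Hd.
    replace (f y - f x - l * (y - x)) with (f y + - f x + - ((y + - x) * l)) by ring.
    exact Hd.
  - intros H; split; [exact (is_linear_scal_l (K := R_AbsRing) (V := R_NormedModule) l)|].
    (* [filterdiff] quantifies over every limit point of the filter; [x] is the only one. *)
    intros z Hz; apply is_filter_lim_within in Hz; [subst z|exact Hx].
    intros eps; destruct (H eps (cond_pos eps)) as [d [Hd H']].
    exists (mkposreal d Hd); intros y Hyx Hy; specialize (H' y Hy Hyx).
    unfold norm, minus, plus, opp, scal; simpl; unfold abs, mult; simpl.
    replace (f y + - f x + - ((y + - x) * l)) with (f y - f x - l * (y - x)) by ring.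
    exact H'.
Qed.

(** Caratheodory's form of differentiability: the slope, completed by [l] at [x], is continuous
    there. The sum, product and chain rules become algebra with limits of slopes, without
    division. *)
Lemma is_derive_on_slope (a b : R) (f : R -> R) (x l : R) :
  Icc a b x ->
  is_derive_on a b f x l <->
  exists q : R -> R, q x = l /\ (forall y, Icc a b y -> f y = f x + q y * (y - x)) /\
    filterlim q (within (Icc a b) (locally x)) (locally l).
Proof.
  intros Hx; rewrite is_derive_on_eps by exact Hx; split.
  - intros H; exists (fun y => if Req_EM_T y x then l else (f y - f x) / (y - x)).
    split; [destruct (Req_EM_T x x); easy|]; split.
    + intros y _; destruct (Req_EM_T y x) as [->|Hyx]; [ring|field; lra].
    + apply filterlim_locally; intros eps.
      assert (He : 0 < eps / 2) by (destruct eps; simpl; lra).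
      destruct (H _ He) as [d [Hd H']].
      exists (mkposreal d Hd); intros y Hyx Hy; specialize (H' y Hy Hyx).
      change (Rabs ((if Req_EM_T y x then l else (f y - f x) / (y - x)) - l) < eps).
      destruct (Req_EM_T y x) as [e|Hne].
      * replace (l - l) with 0 by ring; rewrite Rabs_R0; apply cond_pos.
      * replace ((f y - f x) / (y - x) - l) with ((f y - f x - l * (y - x)) / (y - x))
          by (field; lra).
        assert (0 < Rabs (y - x)) by (apply Rabs_pos_lt; lra).
        unfold Rdiv; rewrite Rabs_mult, Rabs_inv.
        apply Rle_lt_trans with (eps / 2); [|destruct eps; simpl; lra].
        apply Rmult_le_reg_r with (Rabs (y - x)); [easy|].
        rewrite Rmult_assoc, Rinv_l by lra; lra.
  - intros [q [Hq [Hf Hlim]]] eps Heps.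
    destruct (proj1 (filterlim_locally _ _) Hlim (mkposreal eps Heps)) as [d Hd].
    exists d; split; [apply cond_pos|].
    intros y Hy Hyx; specialize (Hd y Hyx Hy).
    change (Rabs (q y - l) < eps) in Hd.
    rewrite (Hf y Hy).
    replace (f x + q y * (y - x) - f x - l * (y - x)) with ((q y - l) * (y - x)) by ring.
    rewrite Rabs_mult; apply Rmult_le_compat_r; [apply Rabs_pos|lra].
Qed.

Lemma is_derive_on_eq (a b : R) (f g : R -> R) (x l l' : R) :
  Icc a b x -> (forall y, Icc a b y -> f y = g y) -> l = l' ->
  is_derive_on a b f x l -> is_derive_on a b g x l'.
Proof.
  intros Hx Hfg <- H; apply is_derive_on_eps; [exact Hx|].
  intros eps Heps; destruct (proj1 (is_derive_on_eps _ _ _ _ _ Hx) H eps Heps) as [d [Hd H']].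
  exists d; split; [exact Hd|]; intros y Hy Hyx.
  rewrite <- !Hfg by easy; now apply H'.
Qed.

Lemma is_derive_on_is_derive (a b : R) (f : R -> R) (x l : R) :
  Icc a b x -> is_derive f x l -> is_derive_on a b f x l.
Proof.
  intros Hx [_ H]; apply is_derive_on_eps; [exact Hx|]; intros eps Heps.
  destruct (H x (fun P HP => HP) (mkposreal eps Heps)) as [d Hd].
  exists d; split; [apply cond_pos|].
  intros y Hy Hyx; specialize (Hd y Hyx); simpl in Hd.
  unfold norm, minus, plus, opp, scal in Hd; simpl in Hd.
  unfold abs, mult in Hd; simpl in Hd.
  replace (f y - f x - l * (y - x)) with (f y + - f x + - ((y + - x) * l)) by ring.
  exact Hd.
Qed.

Lemma is_derive_of_on (a b : R) (f : R -> R) (x l : R) :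
  a < x < b -> is_derive_on a b f x l -> is_derive f x l.
Proof.
  intros Hx H; assert (Hx' : Icc a b x) by (unfold Icc; lra).
  split; [exact (is_linear_scal_l (K := R_AbsRing) (V := R_NormedModule) l)|].
  intros z Hz.
  apply (is_filter_lim_locally_unique (K := R_AbsRing) (V := R_NormedModule) x z) in Hz; subst z.
  intros eps.
  destruct (proj1 (is_derive_on_eps _ _ _ _ _ Hx') H eps (cond_pos eps)) as [d [Hd H']].
  assert (Hd' : 0 < Rmin d (Rmin (x - a) (b - x))).
  { repeat apply Rmin_pos; lra. }
  exists (mkposreal _ Hd'); intros y Hyx.
  change (Rabs (y - x) < Rmin d (Rmin (x - a) (b - x))) in Hyx.
  assert (Hy : Icc a b y /\ Rabs (y - x) < d).
  { revert Hyx; unfold Icc, Rmin, Rabs; repeat destruct Rle_dec;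
      repeat destruct Rcase_abs; lra. }
  specialize (H' y (proj1 Hy) (proj2 Hy)).
  unfold norm, minus, plus, opp, scal; simpl; unfold abs, mult; simpl.
  replace (f y + - f x + - ((y + - x) * l)) with (f y - f x - l * (y - x)) by ring.
  exact H'.
Qed.

Lemma is_derive_on_sub (a b c d : R) (f : R -> R) (x l : R) :
  a <= c -> d <= b -> Icc c d x -> is_derive_on a b f x l -> is_derive_on c d f x l.
Proof.
  intros Hac Hdb Hx H; apply is_derive_on_eps; [exact Hx|]; intros eps Heps.
  assert (Hx' : Icc a b x) by (unfold Icc in *; lra).
  destruct (proj1 (is_derive_on_eps _ _ _ _ _ Hx') H eps Heps) as [e [He H']].
  exists e; split; [exact He|]; intros y Hy; apply H'; unfold Icc in *; lra.
Qed.

Lemma is_derive_on_cont (a b : R) (f : R -> R) (x l : R) :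
  Icc a b x -> is_derive_on a b f x l ->
  filterlim f (within (Icc a b) (locally x)) (locally (f x)).
Proof.
  intros Hx H; apply filterlim_locally; intros eps.
  destruct (proj1 (is_derive_on_eps _ _ _ _ _ Hx) H 1 Rlt_0_1) as [d [Hd H']].
  assert (Hl : 0 < 1 + Rabs l) by (generalize (Rabs_pos l); lra).
  assert (Hd' : 0 < Rmin d (eps / (1 + Rabs l))).
  { apply Rmin_pos; [easy|apply Rdiv_lt_0_compat; [apply cond_pos|easy]]. }
  exists (mkposreal _ Hd'); intros y Hyx Hy.
  change (Rabs (y - x) < Rmin d (eps / (1 + Rabs l))) in Hyx.
  specialize (H' y Hy (Rlt_le_trans _ _ _ Hyx (Rmin_l _ _))).
  change (Rabs (f y - f x) < eps).
  replace (f y - f x) with ((f y - f x - l * (y - x)) + l * (y - x)) by ring.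
  apply Rle_lt_trans with (1 := Rabs_triang _ _).
  rewrite (Rabs_mult l).
  apply Rle_lt_trans with ((1 + Rabs l) * Rabs (y - x)); [lra|].
  assert (Hy' := Rlt_le_trans _ _ _ Hyx (Rmin_r _ _)).
  apply Rmult_lt_reg_l with (/ (1 + Rabs l)); [now apply Rinv_0_lt_compat|].
  rewrite <- Rmult_assoc, Rinv_l by lra; unfold Rdiv in Hy'; lra.
Qed.

Lemma filterlim_Rplus {S : Type} (F : (S -> Prop) -> Prop) (FF : Filter F) (f g : S -> R) (l m : R) :
  filterlim f F (locally l) -> filterlim g F (locally m) ->
  filterlim (fun x => f x + g x) F (locally (l + m)).
Proof.
  intros Hf Hg; eapply filterlim_comp_2; [exact Hf|exact Hg|].
  exact (filterlim_plus (K := R_AbsRing) (V := R_NormedModule) l m).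
Qed.

Lemma filterlim_Rmult {S : Type} (F : (S -> Prop) -> Prop) (FF : Filter F) (f g : S -> R) (l m : R) :
  filterlim f F (locally l) -> filterlim g F (locally m) ->
  filterlim (fun x => f x * g x) F (locally (l * m)).
Proof.
  intros Hf Hg; eapply filterlim_comp_2; [exact Hf|exact Hg|].
  exact (filterlim_mult (K := R_AbsRing) l m).
Qed.

Lemma continuous_on_derive (a b : R) (f f' : R -> R) :
  (forall x, Icc a b x -> is_derive_on a b f x (f' x)) -> continuous_on (Icc a b) f.
Proof. intros H x Hx; exact (is_derive_on_cont a b f x _ Hx (H x Hx)). Qed.

Lemma is_derive_on_const (a b c x : R) : Icc a b x -> is_derive_on a b (fun _ => c) x 0.
Proof. intros Hx; apply is_derive_on_is_derive; [easy|]; apply (is_derive_const c). Qed.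

Lemma is_derive_on_plus (a b : R) (f g : R -> R) (x l m : R) :
  Icc a b x -> is_derive_on a b f x l -> is_derive_on a b g x m ->
  is_derive_on a b (fun y => f y + g y) x (l + m).
Proof.
  intros Hx Hf Hg.
  apply is_derive_on_slope in Hf; [|easy]; apply is_derive_on_slope in Hg; [|easy].
  destruct Hf as [p [Hp [Hf Hpl]]], Hg as [q [Hq [Hg Hql]]].
  apply is_derive_on_slope; [easy|]; exists (fun y => p y + q y); split; [lra|split].
  - intros y Hy; rewrite (Hf y Hy), (Hg y Hy); ring.
  - now apply filterlim_Rplus; [apply within_filter, locally_filter| |].
Qed.

Lemma is_derive_on_mult (a b : R) (f g : R -> R) (x l m : R) :
  Icc a b x -> is_derive_on a b f x l -> is_derive_on a b g x m ->
  is_derive_on a b (fun y => f y * g y) x (l * g x + f x * m).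
Proof.
  intros Hx Hf Hg.
  assert (Hgc := is_derive_on_cont _ _ _ _ _ Hx Hg).
  apply is_derive_on_slope in Hf; [|easy]; apply is_derive_on_slope in Hg; [|easy].
  destruct Hf as [p [Hp [Hf Hpl]]], Hg as [q [Hq [Hg Hql]]].
  apply is_derive_on_slope; [easy|]; exists (fun y => p y * g y + f x * q y).
  split; [rewrite Hp, Hq; ring|split].
  - intros y Hy; rewrite (Hf y Hy), (Hg y Hy); ring.
  - assert (FF : Filter (within (Icc a b) (locally x))) by apply within_filter, locally_filter.
    apply filterlim_Rplus; [easy|now apply filterlim_Rmult|].
    apply filterlim_Rmult; [easy|apply filterlim_const|easy].
Qed.

Lemma is_derive_on_scal (a b c : R) (f : R -> R) (x l : R) :
  Icc a b x -> is_derive_on a b f x l -> is_derive_on a b (fun y => c * f y) x (c * l).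
Proof.
  intros Hx Hf; apply is_derive_on_eq with (f := fun y => c * f y) (l := 0 * f x + c * l);
    [easy|easy|ring|].
  now apply (is_derive_on_mult a b (fun _ => c)); [|apply is_derive_on_const|].
Qed.

Lemma is_derive_on_minus (a b : R) (f g : R -> R) (x l m : R) :
  Icc a b x -> is_derive_on a b f x l -> is_derive_on a b g x m ->
  is_derive_on a b (fun y => f y - g y) x (l - m).
Proof.
  intros Hx Hf Hg.
  apply is_derive_on_eq with (f := fun y => f y + (-1) * g y) (l := l + (-1) * m);
    [easy|intros; ring|ring|].
  apply is_derive_on_plus; [easy|easy|now apply is_derive_on_scal].
Qed.

Lemma is_derive_on_comp (a b : R) (f g : R -> R) (x l m : R) :
  Icc a b x -> is_derive_on a b f x l -> is_derive g (f x) m ->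
  is_derive_on a b (fun y => g (f y)) x (m * l).
Proof.
  intros Hx Hf Hg.
  assert (Hfc := is_derive_on_cont _ _ _ _ _ Hx Hf).
  apply is_derive_on_slope in Hf; [|easy].
  destruct Hf as [p [Hp [Hf Hpl]]].
  assert (Hz : Icc (f x - 1) (f x + 1) (f x)) by (unfold Icc; lra).
  (* The value [m] at [f x] keeps the factorisation of [g (f y) - g (f x)] valid at points [y] with
     [f y = f x]. *)
  set (q := fun z => if Req_EM_T z (f x) then m else (g z - g (f x)) / (z - f x)).
  assert (Hq : filterlim q (locally (f x)) (locally m)).
  { apply filterlim_locally; intros eps.
    assert (He : 0 < eps / 2) by (destruct eps; simpl; lra).
    destruct Hg as [_ Hg].
    destruct (Hg (f x) (fun P HP => HP) (mkposreal _ He)) as [d Hd].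
    exists d; intros y Hyx; specialize (Hd y Hyx); simpl in Hd.
    unfold norm, minus, plus, opp, scal in Hd; simpl in Hd.
    unfold abs, mult in Hd; simpl in Hd.
    change (Rabs (q y - m) < eps); unfold q.
    destruct (Req_EM_T y (f x)) as [e|Hne].
    - replace (m - m) with 0 by ring; rewrite Rabs_R0; apply cond_pos.
    - replace ((g y - g (f x)) / (y - f x) - m)
        with ((g y + - g (f x) + - ((y + - f x) * m)) / (y - f x)) by (field; lra).
      assert (0 < Rabs (y - f x)) by (apply Rabs_pos_lt; lra).
      unfold Rdiv at 1; rewrite Rabs_mult, Rabs_inv.
      apply Rle_lt_trans with (eps / 2); [|destruct eps; simpl; lra].
      apply Rmult_le_reg_r with (Rabs (y - f x)); [easy|].
      rewrite Rmult_assoc, Rinv_l by lra; unfold Rminus in *; lra. }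
  apply is_derive_on_slope; [easy|]; exists (fun y => q (f y) * p y); split; [|split].
  - unfold q; destruct (Req_EM_T (f x) (f x)) as [_|n]; [now rewrite Hp|now elim n].
  - intros y Hy.
    replace (q (f y) * p y * (y - x)) with (q (f y) * (f y - f x))
      by (rewrite (Hf y Hy); ring).
    unfold q; destruct (Req_EM_T (f y) (f x)) as [->|n]; [ring|field; lra].
  - apply filterlim_Rmult; [apply within_filter, locally_filter| |easy].
    now apply filterlim_comp with (2 := Hq).
Qed.

Lemma is_derive_on_unique (a b : R) (f : R -> R) (x l m : R) :
  a < b -> Icc a b x -> is_derive_on a b f x l -> is_derive_on a b f x m -> l = m.
Proof.
  intros Hab Hx Hl Hm.
  destruct (Req_EM_T l m) as [e|Hne]; [easy|exfalso].
  set (eps := Rabs (l - m) / 4).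
  assert (Hlm : 0 < Rabs (l - m)) by (apply Rabs_pos_lt; lra).
  assert (Heps : 0 < eps) by (unfold eps; lra).
  destruct (proj1 (is_derive_on_eps _ _ _ _ _ Hx) Hl eps Heps) as [d [Hd H]].
  destruct (proj1 (is_derive_on_eps _ _ _ _ _ Hx) Hm eps Heps) as [e [He H']].
  assert (exists y, Icc a b y /\ 0 < Rabs (y - x) /\ Rabs (y - x) < d /\ Rabs (y - x) < e)
    as [y [Hy [Hyx [Hyd Hye]]]].
  { set (s := Rmin (Rmin d e) (b - a) / 2).
    assert (Hs : 0 < s) by (unfold s; apply Rdiv_lt_0_compat; [repeat apply Rmin_pos|]; lra).
    assert (Hs' : s < d /\ s < e /\ 2 * s <= b - a).
    { unfold s, Rmin in *; repeat destruct Rle_dec; lra. }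
    unfold Icc in *.
    (* A step of length [s <= (b - a) / 2] to the right from the left half, or to the left from the
       right half, stays inside the interval. *)
    destruct (Rle_dec x ((a + b) / 2)).
    - exists (x + s); replace (x + s - x) with s by ring; rewrite Rabs_pos_eq; lra.
    - exists (x - s); replace (x - s - x) with (- s) by ring.
      rewrite Rabs_Ropp, Rabs_pos_eq; lra. }
  specialize (H y Hy Hyd); specialize (H' y Hy Hye).
  assert (Habs : Rabs ((l - m) * (y - x)) <= 2 * eps * Rabs (y - x)).
  { replace ((l - m) * (y - x))
      with ((f y - f x - m * (y - x)) - (f y - f x - l * (y - x))) by ring.
    apply Rle_trans with (1 := Rabs_triang _ _); rewrite Rabs_Ropp; lra. }
  rewrite Rabs_mult in Habs.
  apply Rmult_le_reg_r in Habs; [unfold eps in Habs; lra|easy].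
Qed.

Lemma Derive_on_eq (a b : R) (f : R -> R) (x l : R) :
  a < b -> Icc a b x -> is_derive_on a b f x l -> Derive_on a b f x = l.
Proof.
  intros Hab Hx H; apply (iota_unique (V := R_CompleteNormedModule)); [|easy].
  intros y Hy; exact (is_derive_on_unique a b f x y l Hab Hx Hy H).
Qed.

(** * Mean values and integrals on a compact interval *)

Lemma mvt_on (a b : R) (f f' : R -> R) (x y : R) :
  (forall z, Icc a b z -> is_derive_on a b f z (f' z)) ->
  Icc a b x -> Icc a b y ->
  exists c, Icc a b c /\ Rmin x y <= c <= Rmax x y /\ f y - f x = f' c * (y - x).
Proof.
  intros Hf Hx Hy.
  assert (Hab : a <= b) by (unfold Icc in *; lra).
  assert (Hc := continuous_on_clamp_comp a b f Hab (continuous_on_derive _ _ _ _ Hf)).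
  (* The clamped function is continuous on the whole line, and derivatives are asked for only inside
     [(a,b)], where relative and ordinary ones agree. *)
  destruct (MVT_gen (fun z => f (clamp a b z)) x y f') as [c [Hcxy Hcf]].
  - intros z Hz.
    assert (Hz' : a < z < b).
    { unfold Icc, Rmin, Rmax in *; destruct Rle_dec; lra. }
    apply is_derive_of_on with a b; [easy|].
    apply is_derive_on_eq with f (f' z); [unfold Icc; lra| |easy|apply Hf; unfold Icc; lra].
    intros; now rewrite clamp_id.
  - intros z _; apply continuity_pt_filterlim; apply Hc.
  - exists c; split; [|split; [easy|]].
    + unfold Icc, Rmin, Rmax in *; destruct Rle_dec; lra.
    + now rewrite !clamp_id in Hcf.
Qed.

Lemma lipschitz_on (a b M : R) (f f' : R -> R) (x y : R) :
  (forall z, Icc a b z -> is_derive_on a b f z (f' z)) ->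
  (forall z, Icc a b z -> Rabs (f' z) <= M) ->
  Icc a b x -> Icc a b y -> Rabs (f y - f x) <= M * Rabs (y - x).
Proof.
  intros Hf HM Hx Hy; destruct (mvt_on a b f f' x y Hf Hx Hy) as [c [Hc [_ ->]]].
  rewrite Rabs_mult; apply Rmult_le_compat_r; [apply Rabs_pos|now apply HM].
Qed.

Lemma ex_RInt_on (a b : R) (f : R -> R) :
  a <= b -> continuous_on (Icc a b) f -> ex_RInt f a b.
Proof.
  intros Hab Hf.
  apply ex_RInt_ext with (fun x => f (clamp a b x)).
  - intros x Hx; rewrite Rmin_left, Rmax_right in Hx by easy.
    now rewrite clamp_id; [|unfold Icc; lra].
  - apply (ex_RInt_continuous (V := R_CompleteNormedModule)); intros z _.
    now apply continuous_on_clamp_comp.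
Qed.

Lemma is_derive_RInt_cont (a : R) (f : R -> R) (x : R) :
  (forall y, continuous f y) -> is_derive (fun y => RInt f a y) x (f x).
Proof.
  intros Hf.
  apply (is_derive_RInt f (fun y => RInt f a y) a); [|apply Hf].
  exists (mkposreal 1 Rlt_0_1); intros y _.
  apply (RInt_correct (V := R_CompleteNormedModule)).
  apply (ex_RInt_continuous (V := R_CompleteNormedModule)); intros z _; apply Hf.
Qed.

(** At the end points [f] has only one-sided derivatives. The difference of [f] and the primitive of
    the clamped [f'] has derivative zero relative to [[a,b]], so the mean value theorem shows that
    it is constant. *)
Lemma RInt_derive_on (a b : R) (f f' : R -> R) :
  a <= b -> (forall x, Icc a b x -> is_derive_on a b f x (f' x)) ->
  continuous_on (Icc a b) f' -> RInt f' a b = f b - f a.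
Proof.
  intros Hab Hf Hf'.
  set (g := fun y => f' (clamp a b y)).
  assert (Hg : forall y, continuous g y) by now apply continuous_on_clamp_comp.
  rewrite (RInt_ext f' g).
  2: { intros x; rewrite Rmin_left, Rmax_right by easy; intros Hx.
       unfold g; rewrite clamp_id; [easy|unfold Icc; lra]. }
  destruct (mvt_on a b (fun x => f x - RInt g a x) (fun x => f' x - g x) a b)
    as [c [Hc [_ H]]]; try (unfold Icc; lra).
  - intros z Hz; apply is_derive_on_minus; [easy|now apply Hf|].
    now apply is_derive_on_is_derive; [|apply is_derive_RInt_cont].
  - rewrite RInt_point in H; unfold zero in H; simpl in H.
    unfold g at 2 in H; rewrite (clamp_id _ _ c Hc) in H; lra.
Qed.

(** * Finite sums *)

Fixpoint vsum (n : nat) (f : nat -> R) : R :=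
  match n with
  | O => 0
  | S m => vsum m f + f m
  end.

Lemma vsum_ext (n : nat) (f g : nat -> R) :
  (forall i, (i < n)%nat -> f i = g i) -> vsum n f = vsum n g.
Proof.
  induction n as [|n IH]; intros H; simpl; [easy|].
  rewrite IH, (H n); [easy|lia|intros; apply H; lia].
Qed.

Lemma vsum_zero (n : nat) (f : nat -> R) :
  (forall i, (i < n)%nat -> f i = 0) -> vsum n f = 0.
Proof.
  induction n as [|n IH]; intros H; simpl; [easy|].
  rewrite IH, (H n); [ring|lia|intros; apply H; lia].
Qed.

Lemma vsum_plus (n : nat) (f g : nat -> R) :
  vsum n (fun i => f i + g i) = vsum n f + vsum n g.
Proof. induction n as [|n IH]; simpl; [ring|rewrite IH; ring]. Qed.

Lemma vsum_minus (n : nat) (f g : nat -> R) :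
  vsum n (fun i => f i - g i) = vsum n f - vsum n g.
Proof. induction n as [|n IH]; simpl; [ring|rewrite IH; ring]. Qed.

Lemma vsum_scal (n : nat) (c : R) (f : nat -> R) :
  vsum n (fun i => c * f i) = c * vsum n f.
Proof. induction n as [|n IH]; simpl; [ring|rewrite IH; ring]. Qed.

Lemma vsum_scal_r (n : nat) (c : R) (f : nat -> R) :
  vsum n (fun i => f i * c) = vsum n f * c.
Proof. induction n as [|n IH]; simpl; [ring|rewrite IH; ring]. Qed.

Lemma vsum_const (n : nat) (c : R) : vsum n (fun _ => c) = INR n * c.
Proof. induction n as [|n IH]; [simpl; ring|]; simpl vsum; rewrite IH, S_INR; ring. Qed.

Lemma vsum_le (n : nat) (f g : nat -> R) :
  (forall i, (i < n)%nat -> f i <= g i) -> vsum n f <= vsum n g.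
Proof.
  induction n as [|n IH]; intros H; simpl; [lra|].
  apply Rplus_le_compat; [apply IH; intros; apply H; lia|apply H; lia].
Qed.

Lemma vsum_nonneg (n : nat) (f : nat -> R) :
  (forall i, (i < n)%nat -> 0 <= f i) -> 0 <= vsum n f.
Proof.
  intros H; rewrite <- (vsum_zero n (fun _ => 0)) by easy; now apply vsum_le.
Qed.

Lemma vsum_term_le (n : nat) (f : nat -> R) (i : nat) :
  (forall j, (j < n)%nat -> 0 <= f j) -> (i < n)%nat -> f i <= vsum n f.
Proof.
  induction n as [|n IH]; intros H Hi; [lia|simpl].
  destruct (Nat.eq_dec i n) as [->|Hne].
  - assert (0 <= vsum n f) by (apply vsum_nonneg; intros; apply H; lia); lra.
  - assert (f i <= vsum n f) by (apply IH; [intros; apply H|]; lia).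
    assert (0 <= f n) by (apply H; lia); lra.
Qed.

Lemma vsum_abs (n : nat) (f : nat -> R) : Rabs (vsum n f) <= vsum n (fun i => Rabs (f i)).
Proof.
  induction n as [|n IH]; simpl; [rewrite Rabs_R0; lra|].
  apply Rle_trans with (1 := Rabs_triang _ _); lra.
Qed.

Lemma vsum_split (a b : nat) (f : nat -> R) :
  vsum (a + b) f = vsum a f + vsum b (fun i => f (a + i)%nat).
Proof.
  induction b as [|b IH]; simpl; [rewrite Nat.add_0_r; ring|].
  rewrite Nat.add_succ_r; simpl; rewrite IH; ring.
Qed.

Lemma vsum_telescope (n : nat) (f : nat -> R) :
  vsum n (fun i => f (S i) - f i) = f n - f 0%nat.
Proof. induction n as [|n IH]; simpl; [ring|rewrite IH; ring]. Qed.

Definition kron (i j : nat) : R := if Nat.eqb i j then 1 else 0.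

Lemma vsum_kron (n i : nat) (f : nat -> R) :
  (i < n)%nat -> vsum n (fun j => f j * kron i j) = f i.
Proof.
  unfold kron; induction n as [|n IH]; intros Hi; [lia|simpl].
  destruct (Nat.eq_dec i n) as [->|Hne].
  - rewrite Nat.eqb_refl, vsum_zero; [ring|].
    intros j Hj; replace (Nat.eqb n j) with false; [ring|].
    symmetry; apply Nat.eqb_neq; lia.
  - rewrite IH by lia; replace (Nat.eqb i n) with false; [ring|].
    symmetry; apply Nat.eqb_neq; lia.
Qed.

(** A nonnegative quadratic polynomial has nonpositive discriminant. Both Cauchy-Schwarz
    inequalities, for finite sums and for [inner], are instances. *)
Lemma square_le_of_quadratic (A B C : R) :
  0 <= C -> (forall s, 0 <= A + 2 * s * B + s ^ 2 * C) -> B ^ 2 <= A * C.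
Proof.
  intros HC H.
  destruct (Req_EM_T C 0) as [->|HC0].
  - destruct (Req_EM_T B 0) as [->|HB]; [lra|exfalso].
    (* For [C = 0] the polynomial is affine in [s], and this [s] gives it the value -1. *)
    specialize (H (- (A + 1) / (2 * B))).
    replace (A + 2 * (- (A + 1) / (2 * B)) * B + (- (A + 1) / (2 * B)) ^ 2 * 0)
      with (-1) in H by (field; easy); lra.
  - specialize (H (- B / C)).
    replace (A + 2 * (- B / C) * B + (- B / C) ^ 2 * C) with ((A * C - B ^ 2) / C) in H
      by (field; easy).
    assert (0 < C) by lra.
    apply Rmult_le_compat_r with (r := C) in H; [|lra].
    unfold Rdiv in H; rewrite Rmult_assoc, Rinv_l in H by easy; lra.
Qed.

Lemma vsum_CS (n : nat) (f g : nat -> R) :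
  (vsum n (fun i => f i * g i)) ^ 2 <= vsum n (fun i => f i ^ 2) * vsum n (fun i => g i ^ 2).
Proof.
  apply square_le_of_quadratic.
  - apply vsum_nonneg; intros; apply pow2_ge_0.
  - intros s; rewrite <- !vsum_scal, <- !vsum_plus.
    apply vsum_nonneg; intros i _.
    replace (_ + _) with ((f i + s * g i) ^ 2) by ring; apply pow2_ge_0.
Qed.

Lemma continuous_vsum (n : nat) (f : nat -> R -> R) (x : R) :
  (forall i, (i < n)%nat -> continuous (f i) x) -> continuous (fun y => vsum n (fun i => f i y)) x.
Proof.
  induction n as [|n IH]; intros H; simpl; [apply continuous_const|].
  apply (continuous_plus (fun y => vsum n (fun i => f i y)) (f n)).
  - apply IH; intros; apply H; lia.
  - apply H; lia.
Qed.

Lemma continuous_on_vsum (a b : R) (n : nat) (f : nat -> R -> R) :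
  (forall i, (i < n)%nat -> continuous_on (Icc a b) (f i)) ->
  continuous_on (Icc a b) (fun y => vsum n (fun i => f i y)).
Proof.
  induction n as [|n IH]; intros H; simpl; [apply continuous_on_const|].
  apply continuous_on_plus; [apply IH; intros; apply H; lia|apply H; lia].
Qed.

Lemma is_derive_on_vsum (a b : R) (n : nat) (f : nat -> R -> R) (f' : nat -> R) (x : R) :
  Icc a b x -> (forall i, (i < n)%nat -> is_derive_on a b (f i) x (f' i)) ->
  is_derive_on a b (fun y => vsum n (fun i => f i y)) x (vsum n f').
Proof.
  intros Hx; induction n as [|n IH]; intros H; simpl; [now apply is_derive_on_const|].
  apply is_derive_on_plus; [easy|apply IH; intros; apply H; lia|apply H; lia].
Qed.

(** * Ordinary differential equations *)

Lemma exp_le (x y : R) : x <= y -> exp x <= exp y.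
Proof. intros [H| ->]; [left; now apply exp_increasing|lra]. Qed.

(** The function [exp (- K t) E t - c t] has a nonpositive derivative because [exp (- K t) <= 1]. *)
Lemma gronwall (T K c : R) (E E' : R -> R) :
  0 <= K -> 0 <= c ->
  (forall t, Icc 0 T t -> is_derive_on 0 T E t (E' t)) ->
  (forall t, Icc 0 T t -> E' t <= K * E t + c) ->
  forall t, Icc 0 T t -> E t <= exp (K * t) * (E 0 + c * t).
Proof.
  intros HK Hc HE HE' t Ht.
  assert (Hexp : forall s, Icc 0 T s ->
    is_derive_on 0 T (fun s => exp (- K * s)) s (exp (- K * s) * (- K))).
  { intros s Hs; apply is_derive_on_is_derive; [easy|].
    auto_derive; [easy|ring]. }
  destruct (mvt_on 0 T (fun s => exp (- K * s) * E s - c * s)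
    (fun s => (exp (- K * s) * (- K)) * E s + exp (- K * s) * E' s - c * 1) 0 t)
    as [s [Hs [Hst H]]]; [|unfold Icc in *; lra|easy|].
  - intros s Hs; apply is_derive_on_minus; [easy| |].
    + apply (is_derive_on_mult 0 T (fun s => exp (- K * s)) E); [easy|now apply Hexp|now apply HE].
    + apply (is_derive_on_scal 0 T c (fun s => s)); [easy|].
      apply is_derive_on_is_derive; [easy|apply (is_derive_id (K := R_AbsRing))].
  - assert (Ht0 : 0 <= t) by (destruct Ht; lra).
    rewrite Rmin_left in Hst by easy.
    replace (- K * 0) with 0 in H by ring; rewrite exp_0 in H.
    assert (H1 : exp (- K * s) <= 1).
    { rewrite <- exp_0; apply exp_le; nra. }
    assert (H0 := exp_pos (- K * s)).
    assert (Hneg : exp (- K * s) * - K * E s + exp (- K * s) * E' s - c * 1 <= 0).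
    { generalize (HE' s Hs); intros; nra. }
    assert (Hle : exp (- K * t) * E t <= E 0 + c * t) by nra.
    replace (E t) with (exp (K * t) * (exp (- K * t) * E t)).
    + apply Rmult_le_compat_l; [left; apply exp_pos|easy].
    + rewrite <- Rmult_assoc, <- exp_plus.
      replace (K * t + - K * t) with 0 by ring; rewrite exp_0; ring.
Qed.

(** The clamp feeds the field only with values of the iterate on [[0,T]], where the iterates
    converge uniformly, while the integrand stays continuous on the whole line. *)
Fixpoint picard_iter (T : R) (F : R -> (nat -> R) -> nat -> R) (z0 : nat -> R) (k : nat)
    (i : nat) (t : R) : R :=
  match k with
  | O => z0 i
  | S m => z0 i + RInt (fun s => F s (fun j => picard_iter T F z0 m j (clamp 0 T s)) i) 0 t
  end.

Lemma continuous_RInt_fct (f : R -> R) (c t : R) :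
  (forall s, continuous f s) -> continuous (fun t => c + RInt f 0 t) t.
Proof.
  intros Hf.
  apply (continuous_plus (fun _ => c) (fun t => RInt f 0 t)); [apply continuous_const|].
  apply (ex_derive_continuous (fun t => RInt f 0 t)).
  exists (f t); now apply is_derive_RInt_cont.
Qed.

Lemma RInt_minus_bound (f g h : R -> R) (t : R) :
  0 <= t -> (forall s, continuous f s) -> (forall s, continuous g s) ->
  (forall s, continuous h s) ->
  (forall s, 0 <= s <= t -> Rabs (f s - g s) <= h s) ->
  Rabs (RInt f 0 t - RInt g 0 t) <= RInt h 0 t.
Proof.
  intros Ht Hf Hg Hh H.
  assert (I : forall k : R -> R, (forall s, continuous k s) -> is_RInt k 0 t (RInt k 0 t)).
  { intros k Hk; apply (RInt_correct (V := R_CompleteNormedModule)).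
    apply (ex_RInt_continuous (V := R_CompleteNormedModule)); intros; apply Hk. }
  refine (norm_RInt_le (V := R_NormedModule) (fun s => f s - g s) h 0 t
    (RInt f 0 t - RInt g 0 t) (RInt h 0 t) Ht H _ (I h Hh)).
  apply (is_RInt_minus (V := R_NormedModule)); now apply I.
Qed.

(** In the supremum norm with weight [exp (- c t)] the Picard map contracts by the factor 1/2 on all
    of [[0,T]] at once, so a long interval needs no subdivision. The Lipschitz bound sums over
    [j < n] only, hence it also says that these are the only components which the relevant part of
    [F] sees. *)
Lemma picard (T L : R) (n : nat) (F : R -> (nat -> R) -> nat -> R) (z0 : nat -> R) :
  0 < T -> 0 < L ->
  (forall z : nat -> R -> R, (forall j t, continuous (z j) t) ->
     forall i t, continuous (fun s => F s (fun j => z j s) i) t) ->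
  (forall t x y i, (i < n)%nat ->
     Rabs (F t x i - F t y i) <= L * vsum n (fun j => Rabs (x j - y j))) ->
  exists z : nat -> R -> R,
    (forall i, z i 0 = z0 i) /\
    (forall i t, continuous (z i) t) /\
    (forall i t, (i < n)%nat -> Icc 0 T t ->
       is_derive (z i) t (F t (fun j => z j t) i)).
Proof.
  intros HT HL Hcont Hlip.
  set (p := picard_iter T F z0).
  assert (Hp : forall k j t, continuous (p k j) t).
  { induction k as [|k IH]; intros j t; [apply continuous_const|].
    apply continuous_RInt_fct; intros s.
    apply (Hcont (fun j s => p k j (clamp 0 T s))); intros j' s'.
    apply (continuous_comp (clamp 0 T) (p k j')); [apply continuous_clamp|apply IH]. }
  assert (Hpc : forall k i t, continuous (fun s => F s (fun j => p k j (clamp 0 T s)) i) t).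
  { intros k; apply (Hcont (fun j s => p k j (clamp 0 T s))); intros j' s'.
    apply (continuous_comp (clamp 0 T) (p k j')); [apply continuous_clamp|apply Hp]. }
  destruct (continuous_on_bounded 0 T (fun t => vsum n (fun i => Rabs (p 1%nat i t - p 0%nat i t))))
    as [M [HM0 HM]]; [lra| |].
  { apply continuous_on_vsum; intros i Hi; apply continuous_on_continuous; intros t _.
    apply (continuous_comp (fun t => p 1%nat i t - p 0%nat i t) Rabs); [|apply continuous_Rabs].
    apply (continuous_minus (p 1%nat i) (p 0%nat i)); apply Hp. }
  (* Integrating [n L exp (c s)] produces the factor [n L / c], which is below 1/2. *)
  set (c := 2 * L * INR (S n)).
  assert (Hn : 0 <= INR n) by apply pos_INR.
  assert (Hc : 0 < c) by (unfold c; rewrite S_INR; nra).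
  assert (Hexp : forall t, continuous (fun s => exp (c * s)) t).
  { intros t; apply (ex_derive_continuous (fun s => exp (c * s))); auto_derive; easy. }
  assert (Hstep : forall k i t, (i < n)%nat -> Icc 0 T t ->
    Rabs (p (S k) i t - p k i t) <= M * (/ 2) ^ k * exp (c * t)).
  { induction k as [|k IH]; intros i t Hi Ht.
    - apply Rle_trans with M.
      + apply Rle_trans with (2 := HM t Ht), Rle_trans with (2 := Rle_abs _).
        apply (vsum_term_le n (fun i => Rabs (p 1%nat i t - p 0%nat i t))); [|easy].
        intros; apply Rabs_pos.
      + assert (1 <= exp (c * t)) by (rewrite <- exp_0; apply exp_le; destruct Ht; nra).
        simpl pow; nra.
    - change (Rabs ((z0 i + RInt (fun s => F s (fun j => p (S k) j (clamp 0 T s)) i) 0 t)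
        - (z0 i + RInt (fun s => F s (fun j => p k j (clamp 0 T s)) i) 0 t))
        <= M * (/ 2) ^ S k * exp (c * t)).
      set (Q := M * (/ 2) ^ k).
      assert (HQ : 0 <= Q) by (apply Rmult_le_pos; [easy|apply pow_le; lra]).
      match goal with |- Rabs (?a + ?b - (?a + ?d)) <= _ =>
        replace (a + b - (a + d)) with (b - d) by ring end.
      apply Rle_trans with (RInt (fun s => (c / 2 * Q) * exp (c * s)) 0 t).
      + apply RInt_minus_bound; [apply Ht|apply Hpc|apply Hpc| |].
        * intros s; apply (continuous_mult (fun _ => c / 2 * Q) (fun s => exp (c * s)));
            [apply continuous_const|apply Hexp].
        * intros s Hs.
          assert (Hs' : Icc 0 T s) by (unfold Icc in *; lra).
          apply Rle_trans with (1 := Hlip s _ _ i Hi).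
          rewrite (clamp_id 0 T s Hs').
          apply Rle_trans with (L * vsum n (fun _ => Q * exp (c * s))).
          -- apply Rmult_le_compat_l; [lra|]; apply vsum_le; intros; now apply IH.
          -- rewrite vsum_const; unfold c at 2; rewrite S_INR.
             assert (0 < exp (c * s)) by apply exp_pos.
             assert (0 <= Q * exp (c * s)) by nra.
             replace (2 * L * (INR n + 1) / 2 * Q * exp (c * s))
               with (L * (INR n + 1) * (Q * exp (c * s))) by field.
             nra.
      + assert (HI : is_RInt (fun s => c / 2 * Q * exp (c * s)) 0 t
          (Q / 2 * exp (c * t) - Q / 2 * exp (c * 0))).
        { apply (is_RInt_derive (V := R_CompleteNormedModule) (fun s => Q / 2 * exp (c * s))).
          - intros s _; auto_derive; [easy|field].
          - intros s _; apply (continuous_mult (fun _ => c / 2 * Q) (fun s => exp (c * s)));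
              [apply continuous_const|apply Hexp]. }
        rewrite (is_RInt_unique (V := R_CompleteNormedModule) _ _ _ _ HI).
        rewrite Rmult_0_r, exp_0; simpl pow.
        replace (M * (/ 2 * (/ 2) ^ k) * exp (c * t)) with (Q / 2 * exp (c * t))
          by (unfold Q; field); lra. }
  set (Q := M * exp (c * T)).
  assert (HQ : 0 <= Q) by (apply Rmult_le_pos; [easy|left; apply exp_pos]).
  assert (Hstep' : forall k i t, (i < n)%nat -> Icc 0 T t ->
    Rabs (p (S k) i t - p k i t) <= Q * (/ 2) ^ k).
  { intros k i t Hi Ht; apply Rle_trans with (1 := Hstep k i t Hi Ht).
    unfold Q; replace (M * exp (c * T) * (/ 2) ^ k) with (M * (/ 2) ^ k * exp (c * T)) by ring.
    apply Rmult_le_compat_l; [apply Rmult_le_pos; [easy|apply pow_le; lra]|].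
    apply exp_le; destruct Ht; nra. }
  assert (Hcauchy : forall k m i t, (i < n)%nat -> Icc 0 T t ->
    Rabs (p (k + m)%nat i t - p k i t) <= 2 * Q * ((/ 2) ^ k - (/ 2) ^ (k + m))).
  { intros k m i t Hi Ht; induction m as [|m IH].
    - rewrite Nat.add_0_r; replace (p k i t - p k i t) with 0 by ring; rewrite Rabs_R0; lra.
    - rewrite Nat.add_succ_r.
      replace (p (S (k + m)) i t - p k i t)
        with ((p (S (k + m)) i t - p (k + m)%nat i t) + (p (k + m)%nat i t - p k i t)) by ring.
      apply Rle_trans with (1 := Rabs_triang _ _).
      generalize (Hstep' (k + m)%nat i t Hi Ht); simpl pow; lra. }
  assert (Hpow : forall k, 0 < (/ 2) ^ k) by (intros; apply pow_lt; lra).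
  assert (Hpow0 : forall A, 0 <= A -> forall e, 0 < e -> exists k, A * (/ 2) ^ k < e).
  { intros A HA e He.
    destruct (pow_lt_1_zero (/ 2)) with (y := e / (A + 1)) as [k Hk].
    - rewrite Rabs_pos_eq; lra.
    - apply Rdiv_lt_0_compat; lra.
    - exists k; specialize (Hk k (Nat.le_refl k)); rewrite Rabs_pos_eq in Hk by (left; apply Hpow).
      apply Rle_lt_trans with ((A + 1) * (/ 2) ^ k); [generalize (Hpow k); nra|].
      apply Rmult_lt_reg_l with (/ (A + 1)); [apply Rinv_0_lt_compat; lra|].
      rewrite <- Rmult_assoc, Rinv_l by lra; unfold Rdiv in Hk; lra. }
  set (z := fun i t => real (Lim_seq (fun k => p k i (clamp 0 T t)))).
  assert (Hz : forall k i t, (i < n)%nat -> Rabs (z i t - p k i (clamp 0 T t)) <= 2 * Q * (/ 2) ^ k).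
  { intros k i t Hi.
    set (t' := clamp 0 T t); assert (Ht' : Icc 0 T t') by (apply clamp_in; lra).
    assert (Hlim : is_lim_seq (fun k => p k i t') (z i t)).
    { apply Lim_seq_correct', ex_lim_seq_cauchy_corr; intros e.
      destruct (Hpow0 (4 * Q) ltac:(lra) e (cond_pos e)) as [k0 Hk0]; exists k0.
      intros a b Ha Hb.
      generalize (Hcauchy k0 (a - k0)%nat i t' Hi Ht') (Hcauchy k0 (b - k0)%nat i t' Hi Ht').
      replace (k0 + (a - k0))%nat with a by lia; replace (k0 + (b - k0))%nat with b by lia.
      intros H1 H2.
      replace (p a i t' - p b i t') with ((p a i t' - p k0 i t') - (p b i t' - p k0 i t')) by ring.
      apply Rle_lt_trans with (1 := Rabs_triang _ _); rewrite Rabs_Ropp.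
      generalize (Hpow a) (Hpow b); intros; nra. }
    apply is_lim_seq_spec in Hlim.
    apply Rnot_lt_le; intros Hlt.
    destruct (Hlim (mkposreal _ (Rlt_Rminus _ _ Hlt))) as [N HN]; simpl in HN.
    specialize (HN (k + N)%nat ltac:(lia)).
    generalize (Hcauchy k N i t' Hi Ht'); intros H1.
    assert (Htr : Rabs (z i t - p k i t') <=
      Rabs (p (k + N)%nat i t' - p k i t') + Rabs (p (k + N)%nat i t' - z i t)).
    { replace (z i t - p k i t')
        with ((p (k + N)%nat i t' - p k i t') - (p (k + N)%nat i t' - z i t)) by ring.
      apply Rle_trans with (1 := Rabs_triang _ _); rewrite Rabs_Ropp; lra. }
    generalize (Hpow (k + N)%nat); intros; nra. }
  assert (Hzc : forall i t, (i < n)%nat -> continuous (z i) t).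
  { intros i t Hi; apply filterlim_locally; intros e.
    destruct (Hpow0 (2 * Q) ltac:(lra) (e / 3) ltac:(destruct e; simpl; lra)) as [k Hk].
    assert (Hc' : continuous (fun t => p k i (clamp 0 T t)) t).
    { apply (continuous_comp (clamp 0 T) (p k i)); [apply continuous_clamp|apply Hp]. }
    assert (He : 0 < e / 3) by (destruct e; simpl; lra).
    destruct (proj1 (filterlim_locally _ _) Hc' (mkposreal _ He)) as [d Hd].
    exists d; intros y Hy; specialize (Hd y Hy).
    change (Rabs (p k i (clamp 0 T y) - p k i (clamp 0 T t)) < e / 3) in Hd.
    change (Rabs (z i y - z i t) < e).
    generalize (Hz k i y Hi) (Hz k i t Hi); intros H1 H2.
    replace (z i y - z i t) with ((z i y - p k i (clamp 0 T y))
      + (p k i (clamp 0 T y) - p k i (clamp 0 T t)) - (z i t - p k i (clamp 0 T t))) by ring.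
    apply Rle_lt_trans with (1 := Rabs_triang _ _); rewrite Rabs_Ropp.
    assert (H3 := Rabs_triang (z i y - p k i (clamp 0 T y))
      (p k i (clamp 0 T y) - p k i (clamp 0 T t))); lra. }
  (* Convergence is known for components below [n]; the others are given the value 0 so that all
     components are continuous, as [Hcont] demands. *)
  set (z' := fun j t => if lt_dec j n then z j t else 0).
  assert (Hz'c : forall j t, continuous (z' j) t).
  { intros j t; unfold z'; destruct (lt_dec j n); [now apply Hzc|apply continuous_const]. }
  assert (HFz : forall i t, continuous (fun s => F s (fun j => z' j s) i) t) by now apply Hcont.
  exists (fun i t => z0 i + RInt (fun s => F s (fun j => z' j s) i) 0 t).
  split; [|split].
  - intros i; rewrite RInt_point; unfold zero; simpl; ring.
  - intros i t; apply continuous_RInt_fct, HFz.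
  - assert (Heq : forall i t, (i < n)%nat -> Icc 0 T t ->
      z' i t = z0 i + RInt (fun s => F s (fun j => z' j s) i) 0 t).
    { intros i t Hi Ht; apply Req_lt_aux; intros e.
      set (A := 2 * Q + L * (INR n * (2 * Q)) * T).
      assert (HA : 0 <= A).
      { unfold A; apply Rplus_le_le_0_compat; [lra|].
        assert (0 <= INR n * (2 * Q)) by (apply Rmult_le_pos; lra).
        apply Rmult_le_pos; [apply Rmult_le_pos; lra|lra]. }
      destruct (Hpow0 A HA e (cond_pos e))
        as [k Hk].
      apply Rle_lt_trans with (2 := Hk).
      replace (z' i t - (z0 i + RInt (fun s => F s (fun j => z' j s) i) 0 t))
        with ((z' i t - p (S k) i t)
          + (RInt (fun s => F s (fun j => p k j (clamp 0 T s)) i) 0 t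
             - RInt (fun s => F s (fun j => z' j s) i) 0 t)).
      2: { change (p (S k) i t)
             with (z0 i + RInt (fun s => F s (fun j => p k j (clamp 0 T s)) i) 0 t); ring. }
      apply Rle_trans with (1 := Rabs_triang _ _); unfold A; rewrite Rmult_plus_distr_r.
      apply Rplus_le_compat.
      - generalize (Hz (S k) i t Hi); rewrite (clamp_id _ _ t Ht); unfold z'.
        destruct (lt_dec i n); [|lia]; simpl pow; generalize (Hpow k); intros; nra.
      - apply Rle_trans with (RInt (fun _ => L * (INR n * (2 * Q * (/ 2) ^ k))) 0 t).
        + apply RInt_minus_bound; [apply Ht|apply Hpc|apply HFz|intros; apply continuous_const|].
          intros s Hs; apply Rle_trans with (1 := Hlip s _ _ i Hi).
          rewrite <- vsum_const; apply Rmult_le_compat_l; [lra|].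
          apply vsum_le; intros j Hj; unfold z'; destruct (lt_dec j n); [|lia].
          rewrite Rabs_minus_sym; now apply Hz.
        + rewrite RInt_const; unfold scal; simpl; unfold mult; simpl.
          assert (0 <= L * (INR n * (2 * Q * (/ 2) ^ k))).
          { assert (0 <= 2 * Q * (/ 2) ^ k) by (generalize (Hpow k); intros; nra).
            apply Rmult_le_pos; [lra|]; apply Rmult_le_pos; lra. }
          destruct Ht; nra. }
    intros i t Hi Ht.
    (* By [Heq] the two arguments of [F] agree in the components below [n]; the Lipschitz bound then
       has right-hand side zero. *)
    assert (HF : F t (fun j => z0 j + RInt (fun s => F s (fun j => z' j s) j) 0 t) i
      = F t (fun j => z' j t) i).
    { apply Rminus_diag_uniq.
      assert (H := Hlip t (fun j => z0 j + RInt (fun s => F s (fun j => z' j s) j) 0 t)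
        (fun j => z' j t) i Hi); simpl in H.
      rewrite vsum_zero, Rmult_0_r in H.
      - generalize (Rabs_pos_eq 0 (Rle_refl 0)); intros _.
        destruct (Req_EM_T (F t (fun j => z0 j + RInt (fun s => F s (fun j => z' j s) j) 0 t) i
          - F t (fun j => z' j t) i) 0) as [e|ne]; [easy|].
        apply Rabs_pos_lt in ne; lra.
      - intros j Hj; rewrite (Heq j t Hj Ht), Rminus_diag, Rabs_R0; easy. }
    rewrite HF.
    assert (H := is_derive_RInt_cont 0 (fun s => F s (fun j => z' j s) i) t (HFz i)).
    evar_last; [apply (is_derive_plus (fun _ => z0 i)); [apply is_derive_const|exact H]|].
    unfold plus, zero; simpl; ring.
Qed.

(** * Linear and quadratic vector fields and their truncation to a ball *)

Definition lin (n : nat) (A : nat -> nat -> R) (z : nat -> R) (i : nat) : R :=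
  vsum n (fun k => A i k * z k).

Definition bil (n : nat) (B : nat -> nat -> nat -> R) (y z : nat -> R) (i : nat) : R :=
  vsum n (fun j => vsum n (fun k => B i j k * (y j * z k))).

Definition nsq (n : nat) (z : nat -> R) : R := vsum n (fun i => z i ^ 2).

Lemma nsq_nonneg (n : nat) (z : nat -> R) : 0 <= nsq n z.
Proof. apply vsum_nonneg; intros; apply pow2_ge_0. Qed.

Lemma lin_minus (n : nat) A (y z : nat -> R) (i : nat) :
  lin n A (fun j => y j - z j) i = lin n A y i - lin n A z i.
Proof. unfold lin; rewrite <- vsum_minus; apply vsum_ext; intros; ring. Qed.

Lemma bil_minus_l (n : nat) B (x y z : nat -> R) (i : nat) :
  bil n B (fun j => x j - y j) z i = bil n B x z i - bil n B y z i.
Proof.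
  unfold bil; rewrite <- vsum_minus; apply vsum_ext; intros.
  rewrite <- vsum_minus; apply vsum_ext; intros; ring.
Qed.

Lemma bil_minus_r (n : nat) B (x y z : nat -> R) (i : nat) :
  bil n B x (fun j => y j - z j) i = bil n B x y i - bil n B x z i.
Proof.
  unfold bil; rewrite <- vsum_minus; apply vsum_ext; intros.
  rewrite <- vsum_minus; apply vsum_ext; intros; ring.
Qed.

Lemma bil_scal (n : nat) B (a b : R) (y z : nat -> R) (i : nat) :
  bil n B (fun j => a * y j) (fun j => b * z j) i = a * b * bil n B y z i.
Proof.
  unfold bil; rewrite <- vsum_scal; apply vsum_ext; intros.
  rewrite <- vsum_scal; apply vsum_ext; intros; ring.
Qed.

Definition sum_abs2 (n : nat) (A : nat -> nat -> R) : R :=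
  vsum n (fun i => vsum n (fun k => Rabs (A i k))).

Definition sum_abs3 (n : nat) (B : nat -> nat -> nat -> R) : R :=
  vsum n (fun i => vsum n (fun j => vsum n (fun k => Rabs (B i j k)))).

Lemma sum_abs2_nonneg (n : nat) A : 0 <= sum_abs2 n A.
Proof. repeat (apply vsum_nonneg; intros); apply Rabs_pos. Qed.

Lemma sum_abs3_nonneg (n : nat) B : 0 <= sum_abs3 n B.
Proof. repeat (apply vsum_nonneg; intros); apply Rabs_pos. Qed.

Lemma lin_bound (n : nat) A (z : nat -> R) (S : R) (i : nat) :
  (i < n)%nat -> (forall k, (k < n)%nat -> Rabs (z k) <= S) ->
  Rabs (lin n A z i) <= sum_abs2 n A * S.
Proof.
  intros Hi H; assert (0 <= S) by (apply Rle_trans with (2 := H i Hi); apply Rabs_pos).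
  apply Rle_trans with (1 := vsum_abs _ _).
  apply Rle_trans with (vsum n (fun k => Rabs (A i k)) * S).
  - rewrite <- vsum_scal_r; apply vsum_le; intros k Hk; rewrite Rabs_mult.
    apply Rmult_le_compat_l; [apply Rabs_pos|now apply H].
  - apply Rmult_le_compat_r; [easy|].
    apply (vsum_term_le n (fun i => vsum n (fun k => Rabs (A i k)))); [|easy].
    intros; apply vsum_nonneg; intros; apply Rabs_pos.
Qed.

Lemma bil_bound (n : nat) B (y z : nat -> R) (S U : R) (i : nat) :
  (i < n)%nat -> (forall k, (k < n)%nat -> Rabs (y k) <= S) ->
  (forall k, (k < n)%nat -> Rabs (z k) <= U) ->
  Rabs (bil n B y z i) <= sum_abs3 n B * (S * U).
Proof.
  intros Hi H H'; assert (0 <= S) by (apply Rle_trans with (2 := H i Hi); apply Rabs_pos).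
  assert (0 <= U) by (apply Rle_trans with (2 := H' i Hi); apply Rabs_pos).
  apply Rle_trans with (1 := vsum_abs _ _).
  apply Rle_trans with (vsum n (fun j => vsum n (fun k => Rabs (B i j k))) * (S * U)).
  - rewrite <- vsum_scal_r; apply vsum_le; intros j Hj.
    apply Rle_trans with (1 := vsum_abs _ _).
    rewrite <- vsum_scal_r; apply vsum_le; intros k Hk; rewrite Rabs_mult.
    apply Rmult_le_compat_l; [apply Rabs_pos|rewrite Rabs_mult].
    apply Rmult_le_compat; [apply Rabs_pos|apply Rabs_pos|now apply H|now apply H'].
  - apply Rmult_le_compat_r; [now apply Rmult_le_pos|].
    apply (vsum_term_le n (fun i => vsum n (fun j => vsum n (fun k => Rabs (B i j k))))); [|easy].
    intros; apply vsum_nonneg; intros; apply vsum_nonneg; intros; apply Rabs_pos.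
Qed.

Lemma sqrt_nsq_triang (n : nat) (x y : nat -> R) :
  sqrt (nsq n x) <= sqrt (nsq n y) + sqrt (nsq n (fun i => x i - y i)).
Proof.
  set (d := fun i => x i - y i).
  assert (Hy := nsq_nonneg n y); assert (Hd := nsq_nonneg n d).
  assert (H0 := sqrt_pos (nsq n y)); assert (H1 := sqrt_pos (nsq n d)).
  rewrite <- (sqrt_Rsqr (sqrt (nsq n y) + sqrt (nsq n d))) by lra.
  apply sqrt_le_1_alt; unfold Rsqr.
  assert (Hxx : nsq n x = nsq n y + 2 * vsum n (fun i => y i * d i) + nsq n d).
  { unfold nsq, d; rewrite <- vsum_scal, <- !vsum_plus; apply vsum_ext; intros; ring. }
  assert (HCS := vsum_CS n y d); fold (nsq n y) (nsq n d) in HCS.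
  assert (Hle : vsum n (fun i => y i * d i) <= sqrt (nsq n y) * sqrt (nsq n d)).
  { rewrite <- sqrt_mult by easy; apply Rle_trans with (1 := Rle_abs _).
    rewrite <- sqrt_Rsqr_abs; apply sqrt_le_1_alt.
    apply Rle_trans with (2 := HCS); right; unfold Rsqr; ring. }
  assert (Ey := sqrt_sqrt _ Hy); assert (Ed := sqrt_sqrt _ Hd); nra.
Qed.

Lemma sqrt_nsq_le_abs (n : nat) (x : nat -> R) : sqrt (nsq n x) <= vsum n (fun i => Rabs (x i)).
Proof.
  induction n as [|n IH]; [unfold nsq; simpl; rewrite sqrt_0; lra|].
  unfold nsq in *; cbn [vsum].
  set (s := vsum n (fun i => x i ^ 2)) in *.
  assert (Hs : 0 <= s) by apply nsq_nonneg.
  assert (H0 := sqrt_pos s); assert (Hx := Rabs_pos (x n)).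
  apply Rle_trans with (sqrt s + Rabs (x n)); [|lra].
  rewrite <- (sqrt_Rsqr (sqrt s + Rabs (x n))) by lra.
  apply sqrt_le_1_alt; unfold Rsqr.
  assert (Es := sqrt_sqrt _ Hs); assert (Ex := pow2_abs (x n)).
  assert (H1 := Rmult_le_pos _ _ H0 Hx).
  apply Rle_trans with (sqrt s * sqrt s + 2 * (sqrt s * Rabs (x n)) + Rabs (x n) ^ 2);
    [rewrite Es, Ex; lra|right; ring].
Qed.

Lemma abs_le_sqrt_nsq (n : nat) (x : nat -> R) (j : nat) :
  (j < n)%nat -> Rabs (x j) <= sqrt (nsq n x).
Proof.
  intros Hj; rewrite <- sqrt_Rsqr_abs; apply sqrt_le_1_alt.
  replace (Rsqr (x j)) with (x j ^ 2) by (unfold Rsqr; ring).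
  apply (vsum_term_le n (fun i => x i ^ 2)); [intros; apply pow2_ge_0|easy].
Qed.

(** The radial retraction onto the ball of radius [rho] is [z |-> cutoff n rho z * z]. *)
Definition cutoff (n : nat) (rho : R) (z : nat -> R) : R := rho / Rmax rho (sqrt (nsq n z)).

Lemma cutoff_range (n : nat) (rho : R) (z : nat -> R) : 0 < rho -> 0 <= cutoff n rho z <= 1.
Proof.
  intros Hr; assert (H := Rmax_l rho (sqrt (nsq n z))); unfold cutoff; split.
  - left; apply Rdiv_lt_0_compat; lra.
  - apply Rmult_le_reg_r with (Rmax rho (sqrt (nsq n z))); [lra|].
    unfold Rdiv; rewrite Rmult_assoc, Rinv_l; lra.
Qed.

Lemma cutoff_mult_le (n : nat) (rho : R) (z : nat -> R) :
  0 < rho -> cutoff n rho z * sqrt (nsq n z) <= rho.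
Proof.
  intros Hr; assert (H := Rmax_l rho (sqrt (nsq n z))).
  assert (H' := Rmax_r rho (sqrt (nsq n z))); unfold cutoff.
  apply Rmult_le_reg_r with (Rmax rho (sqrt (nsq n z))); [lra|].
  replace (rho / Rmax rho (sqrt (nsq n z)) * sqrt (nsq n z) * Rmax rho (sqrt (nsq n z)))
    with (rho * sqrt (nsq n z)) by (field; lra).
  now apply Rmult_le_compat_l; [lra|].
Qed.

Lemma cutoff_one (n : nat) (rho : R) (z : nat -> R) :
  0 < rho -> nsq n z <= rho ^ 2 -> cutoff n rho z = 1.
Proof.
  intros Hr H; unfold cutoff; rewrite Rmax_left; [field; lra|].
  rewrite <- (sqrt_Rsqr rho) by lra; apply sqrt_le_1_alt; unfold Rsqr; lra.
Qed.

(** The difference is [c(x) (x - y) + (c(x) - c(y)) y] with [c] the cut-off. With [a], [b] the two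
    denominators, [c(x) - c(y) = (rho / a) (b - a) / b]; here [rho <= a], [|y j| <= b], and [b - a]
    is bounded by the difference of the norms, so each summand costs one copy of the sum. *)
Lemma retract_lip (n : nat) (rho : R) (x y : nat -> R) (j : nat) :
  0 < rho -> (j < n)%nat ->
  Rabs (cutoff n rho x * x j - cutoff n rho y * y j) <= 2 * vsum n (fun i => Rabs (x i - y i)).
Proof.
  intros Hr Hj; set (S := vsum n (fun i => Rabs (x i - y i))).
  assert (Hxy : Rabs (x j - y j) <= S).
  { apply (vsum_term_le n (fun i => Rabs (x i - y i))); [intros; apply Rabs_pos|easy]. }
  assert (Hn : Rabs (sqrt (nsq n x) - sqrt (nsq n y)) <= S).
  { assert (H1 := sqrt_nsq_triang n x y); assert (H2 := sqrt_nsq_triang n y x).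
    assert (H3 := sqrt_nsq_le_abs n (fun i => x i - y i)); cbv beta in H3; fold S in H3.
    replace (nsq n (fun i => y i - x i)) with (nsq n (fun i => x i - y i)) in H2
      by (apply vsum_ext; intros; ring).
    apply Rabs_le; lra. }
  replace (cutoff n rho x * x j - cutoff n rho y * y j)
    with (cutoff n rho x * (x j - y j) + (cutoff n rho x - cutoff n rho y) * y j) by ring.
  apply Rle_trans with (1 := Rabs_triang _ _); rewrite !Rabs_mult.
  replace (2 * S) with (S + S) by ring; apply Rplus_le_compat.
  - destruct (cutoff_range n rho x Hr) as [H0 H1]; rewrite (Rabs_pos_eq _ H0).
    generalize (Rabs_pos (x j - y j)); intros; nra.
  - assert (Hyj := abs_le_sqrt_nsq n y j Hj).
    unfold cutoff; set (a := Rmax rho (sqrt (nsq n x))); set (b := Rmax rho (sqrt (nsq n y))).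
    assert (Ha : rho <= a) by apply Rmax_l; assert (Hb : rho <= b) by apply Rmax_l.
    assert (Hb' : sqrt (nsq n y) <= b) by apply Rmax_r.
    assert (Hab : Rabs (b - a) <= S).
    { apply Rle_trans with (2 := Hn); unfold a, b, Rmax; repeat destruct Rle_dec;
        unfold Rabs; repeat destruct Rcase_abs; lra. }
    replace (rho / a - rho / b) with ((rho / a) * ((b - a) / b)) by (field; lra).
    rewrite Rabs_mult; unfold Rdiv at 2; rewrite Rabs_mult, Rabs_inv.
    rewrite (Rabs_pos_eq b) by lra.
    rewrite (Rabs_pos_eq (rho / a)) by (left; apply Rdiv_lt_0_compat; lra).
    assert (H1 : rho / a <= 1).
    { apply Rmult_le_reg_r with a; [lra|]; unfold Rdiv; rewrite Rmult_assoc, Rinv_l; lra. }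
    assert (H2 : / b * Rabs (y j) <= 1).
    { apply Rmult_le_reg_l with b; [lra|]; rewrite <- Rmult_assoc, Rinv_r; lra. }
    assert (H3 : 0 <= / b * Rabs (y j)).
    { apply Rmult_le_pos; [left; apply Rinv_0_lt_compat; lra|apply Rabs_pos]. }
    assert (H4 : 0 < rho / a) by (apply Rdiv_lt_0_compat; lra).
    assert (H5 := Rabs_pos (b - a)).
    replace (rho / a * (Rabs (b - a) * / b) * Rabs (y j))
      with (rho / a * (Rabs (b - a) * (/ b * Rabs (y j)))) by ring.
    assert (Rabs (b - a) * (/ b * Rabs (y j)) <= S) by nra.
    assert (0 <= Rabs (b - a) * (/ b * Rabs (y j))) by nra.
    nra.
Qed.

Lemma continuous_lin (n : nat) A (z : nat -> R -> R) (i : nat) (t : R) :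
  (forall j, (j < n)%nat -> continuous (z j) t) ->
  continuous (fun s => lin n A (fun j => z j s) i) t.
Proof.
  intros H; apply (continuous_vsum n (fun k s => A i k * z k s)); intros k Hk.
  apply (continuous_mult (fun _ => A i k) (z k)); [apply continuous_const|now apply H].
Qed.

Lemma continuous_bil (n : nat) B (y z : nat -> R -> R) (i : nat) (t : R) :
  (forall j, (j < n)%nat -> continuous (y j) t) ->
  (forall j, (j < n)%nat -> continuous (z j) t) ->
  continuous (fun s => bil n B (fun j => y j s) (fun j => z j s) i) t.
Proof.
  intros H H'; apply (continuous_vsum n (fun j s => vsum n (fun k => B i j k * (y j s * z k s)))).
  intros j Hj; apply (continuous_vsum n (fun k s => B i j k * (y j s * z k s))); intros k Hk.
  apply (continuous_mult (fun _ => B i j k) (fun s => y j s * z k s)); [apply continuous_const|].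
  apply (continuous_mult (y j) (z k)); [now apply H|now apply H'].
Qed.

Lemma continuous_cutoff (n : nat) (rho : R) (z : nat -> R -> R) (t : R) :
  0 < rho -> (forall j, (j < n)%nat -> continuous (z j) t) ->
  continuous (fun s => cutoff n rho (fun j => z j s)) t.
Proof.
  intros Hr H; unfold cutoff.
  apply (continuous_mult (fun _ => rho) (fun s => / Rmax rho (sqrt (nsq n (fun j => z j s)))));
    [apply continuous_const|].
  apply (continuous_comp (fun s => Rmax rho (sqrt (nsq n (fun j => z j s)))) Rinv).
  2: { apply continuous_Rinv; generalize (Rmax_l rho (sqrt (nsq n (fun j => z j t)))); lra. }
  apply (continuous_comp (fun s => sqrt (nsq n (fun j => z j s))) (Rmax rho)).
  - apply (continuous_comp (fun s => nsq n (fun j => z j s)) sqrt); [|apply continuous_sqrt].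
    apply (continuous_vsum n (fun j s => z j s ^ 2)); intros j Hj; simpl.
    apply (continuous_mult (z j) (fun s => z j s * 1)); [now apply H|].
    apply (continuous_mult (z j) (fun _ => 1)); [now apply H|apply continuous_const].
  - apply filterlim_locally; intros e; exists e; intros y Hy.
    change (Rabs (Rmax rho y - Rmax rho (sqrt (nsq n (fun j => z j t)))) < e).
    change (Rabs (y - sqrt (nsq n (fun j => z j t))) < e) in Hy.
    revert Hy; unfold Rmax; repeat destruct Rle_dec; unfold Rabs; repeat destruct Rcase_abs; lra.
Qed.

(* The quadratic part of the equation for [zeta = Z - z] is truncated outside the ball
   of radius [rho]; since the energy inequality survives the truncation, the truncated
   solution never leaves that ball and solves the original equation. *)
Lemma quadratic_ode_exists (T rho K e : R) (n : nat) (A : nat -> nat -> R)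
    (B : nat -> nat -> nat -> R) (Z Zt : nat -> R -> R) (z0 : nat -> R) :
  0 < T -> 0 < rho -> 0 <= K -> 0 <= e ->
  (forall i t, (i < n)%nat -> Icc 0 T t -> is_derive_on 0 T (Z i) t (Zt i t)) ->
  (forall i, (i < n)%nat -> continuous_on (Icc 0 T) (Zt i)) ->
  (forall t (zeta : nat -> R) mu, Icc 0 T t -> 0 <= mu <= 1 -> mu ^ 2 * nsq n zeta <= rho ^ 2 ->
     vsum n (fun i => zeta i * (Zt i t + lin n A (fun j => Z j t) i
       + bil n B (fun j => Z j t) (fun j => Z j t) i - lin n A zeta i
       - bil n B (fun j => Z j t) zeta i - bil n B zeta (fun j => Z j t) i
       + mu * bil n B zeta zeta i)) <= K * nsq n zeta + e) ->
  nsq n (fun i => Z i 0 - z0 i) <= e ->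
  exp (2 * K * T) * (1 + 2 * T) * e <= rho ^ 2 ->
  exists z zt : nat -> R -> R,
    (forall i, (i < n)%nat -> z i 0 = z0 i) /\
    (forall i, (i < n)%nat -> continuous_on (Icc 0 T) (zt i)) /\
    (forall t, Icc 0 T t ->
       (forall i, (i < n)%nat -> is_derive_on 0 T (z i) t (zt i t) /\
         zt i t + lin n A (fun j => z j t) i
           + bil n B (fun j => z j t) (fun j => z j t) i = 0) /\
       nsq n (fun i => Z i t - z i t) <= exp (2 * K * T) * (1 + 2 * T) * e).
Proof.
  intros HT Hrho HK He HZ HZtc Henergy H0 Hsmall.
  assert (H0T : Icc 0 T 0) by (unfold Icc; lra).
  assert (HZc : forall i, (i < n)%nat -> continuous_on (Icc 0 T) (Z i)).
  { intros i Hi; apply continuous_on_derive with (Zt i); intros; now apply HZ. }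
  set (Zc := fun i t => Z i (clamp 0 T t)).
  assert (HZcc : forall i t, (i < n)%nat -> continuous (Zc i) t).
  { intros i t Hi; apply continuous_on_clamp_comp; [lra|now apply HZc]. }
  set (Rc := fun i t => Zt i (clamp 0 T t) + lin n A (fun j => Zc j t) i
    + bil n B (fun j => Zc j t) (fun j => Zc j t) i).
  assert (HRc : forall i t, (i < n)%nat -> continuous (Rc i) t).
  { intros i t Hi; unfold Rc.
    apply (continuous_plus (fun t => Zt i (clamp 0 T t) + lin n A (fun j => Zc j t) i)
      (fun t => bil n B (fun j => Zc j t) (fun j => Zc j t) i)).
    - apply (continuous_plus (fun t => Zt i (clamp 0 T t)) (fun t => lin n A (fun j => Zc j t) i)).
      + apply continuous_on_clamp_comp; [lra|now apply HZtc].
      + apply continuous_lin; intros; now apply HZcc.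
    - apply continuous_bil; intros; now apply HZcc. }
  destruct (continuous_on_bounded 0 T (fun t => vsum n (fun i => Rabs (Z i t)))) as [M [HM0 HM]];
    [lra| |].
  { apply continuous_on_vsum; intros i Hi; apply continuous_clamp_comp_on; intros t Ht.
    apply (continuous_comp (Zc i) Rabs); [now apply HZcc|apply continuous_Rabs]. }
  assert (HZM : forall i t, (i < n)%nat -> Rabs (Zc i t) <= M).
  { intros i t Hi; assert (Ht : Icc 0 T (clamp 0 T t)) by (apply clamp_in; lra).
    apply Rle_trans with (2 := HM _ Ht), Rle_trans with (2 := Rle_abs _).
    apply (vsum_term_le n (fun i => Rabs (Z i (clamp 0 T t)))); [intros; apply Rabs_pos|easy]. }
  (* The equation of [Z - z]. The cut-off is squared because the last term is homogeneous of degree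
     two: the product is [bil] evaluated at the retracted point, which is bounded and globally
     Lipschitz. *)
  set (F := fun t (x : nat -> R) i => if lt_dec i n then
    Rc i t - lin n A x i - bil n B (fun j => Zc j t) x i - bil n B x (fun j => Zc j t) i
    + cutoff n rho x ^ 2 * bil n B x x i else 0).
  set (a := sum_abs2 n A); set (b := sum_abs3 n B).
  assert (Ha : 0 <= a) by apply sum_abs2_nonneg.
  assert (Hb : 0 <= b) by apply sum_abs3_nonneg.
  (* [2 b M] belongs to the two mixed terms, [4 b rho] to the two slots of the truncated term, each
     with the Lipschitz constant 2 of the retraction; the 1 ensures positivity. *)
  destruct (picard T (a + 2 * (b * M) + 4 * (b * rho) + 1) n F (fun i => Z i 0 - z0 i))
    as [zeta [Hz0 [_ Hz]]].
  - easy.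
  - assert (0 <= b * M) by nra; assert (0 <= b * rho) by nra; lra.
  - intros z Hzc i t; unfold F; destruct (lt_dec i n) as [Hi|_]; [|apply continuous_const].
    apply (continuous_plus (fun t => Rc i t - lin n A (fun j => z j t) i
      - bil n B (fun j => Zc j t) (fun j => z j t) i - bil n B (fun j => z j t) (fun j => Zc j t) i)
      (fun t => cutoff n rho (fun j => z j t) ^ 2 * bil n B (fun j => z j t) (fun j => z j t) i)).
    + apply (continuous_minus (fun t => Rc i t - lin n A (fun j => z j t) i
        - bil n B (fun j => Zc j t) (fun j => z j t) i)
        (fun t => bil n B (fun j => z j t) (fun j => Zc j t) i)).
      2: apply continuous_bil; intros; [apply Hzc|now apply HZcc].
      apply (continuous_minus (fun t => Rc i t - lin n A (fun j => z j t) i)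
        (fun t => bil n B (fun j => Zc j t) (fun j => z j t) i)).
      2: apply continuous_bil; intros; [now apply HZcc|apply Hzc].
      apply (continuous_minus (Rc i) (fun t => lin n A (fun j => z j t) i)); [now apply HRc|].
      apply continuous_lin; intros; apply Hzc.
    + assert (Hcut : continuous (fun t => cutoff n rho (fun j => z j t)) t)
        by (apply continuous_cutoff; intros; [easy|apply Hzc]).
      simpl pow.
      apply (continuous_mult
        (fun t => cutoff n rho (fun j => z j t) * (cutoff n rho (fun j => z j t) * 1))
        (fun t => bil n B (fun j => z j t) (fun j => z j t) i)).
      * apply (continuous_mult (fun t => cutoff n rho (fun j => z j t))
          (fun t => cutoff n rho (fun j => z j t) * 1)); [easy|].
        apply (continuous_mult (fun t => cutoff n rho (fun j => z j t)) (fun _ => 1)); [easy|].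
        apply continuous_const.
      * apply continuous_bil; intros; apply Hzc.
  - intros t x y i Hi; unfold F; destruct (lt_dec i n) as [_|]; [|easy].
    set (S := vsum n (fun j => Rabs (x j - y j))).
    assert (HS : forall k, (k < n)%nat -> Rabs (x k - y k) <= S).
    { intros k Hk; apply (vsum_term_le n (fun i => Rabs (x i - y i))); [intros; apply Rabs_pos|easy]. }
    set (px := fun j => cutoff n rho x * x j); set (py := fun j => cutoff n rho y * y j).
    assert (Hpx : forall w k, (k < n)%nat -> Rabs (cutoff n rho w * w k) <= rho).
    { intros w k Hk; rewrite Rabs_mult.
      destruct (cutoff_range n rho w Hrho) as [Hc0 _]; rewrite (Rabs_pos_eq _ Hc0).
      apply Rle_trans with (2 := cutoff_mult_le n rho w Hrho).
      apply Rmult_le_compat_l; [easy|now apply abs_le_sqrt_nsq]. }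
    assert (Hpd : forall k, (k < n)%nat -> Rabs (px k - py k) <= 2 * S).
    { intros k Hk; now apply retract_lip. }
    (* The difference of the quadratic terms is split so that each summand is linear in the
       difference of the retracted points. *)
    assert (Ebb : cutoff n rho x ^ 2 * bil n B x x i - cutoff n rho y ^ 2 * bil n B y y i
      = bil n B px (fun j => px j - py j) i + bil n B (fun j => px j - py j) py i).
    { rewrite bil_minus_l, bil_minus_r; unfold px, py; rewrite !bil_scal; ring. }
    match goal with |- Rabs ?g <= _ => replace g with
      ((bil n B px (fun j => px j - py j) i + bil n B (fun j => px j - py j) py i)
       - lin n A (fun j => x j - y j) i - bil n B (fun j => Zc j t) (fun j => x j - y j) i
       - bil n B (fun j => x j - y j) (fun j => Zc j t) i) end.
    2: { rewrite <- Ebb, lin_minus, !bil_minus_l, !bil_minus_r; ring. }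
    assert (B1 := bil_bound n B px (fun j => px j - py j) rho (2 * S) i Hi (Hpx x) Hpd).
    assert (B2 := bil_bound n B (fun j => px j - py j) py (2 * S) rho i Hi Hpd (Hpx y)).
    assert (B3 := lin_bound n A (fun j => x j - y j) S i Hi HS).
    assert (B4 := bil_bound n B (fun j => Zc j t) (fun j => x j - y j) M S i Hi
      (fun k Hk => HZM k t Hk) HS).
    assert (B5 := bil_bound n B (fun j => x j - y j) (fun j => Zc j t) S M i Hi HS
      (fun k Hk => HZM k t Hk)).
    fold a in B3; fold b in B1, B2, B4, B5.
    assert (HS0 : 0 <= S) by (apply vsum_nonneg; intros; apply Rabs_pos).
    apply Rabs_le_between in B1, B2, B3, B4, B5; apply Rabs_le; split; nra.
  - set (E := fun t => nsq n (fun i => zeta i t)).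
    set (E' := fun t => vsum n (fun i => 2 * (zeta i t * F t (fun j => zeta j t) i))).
    assert (HE : forall t, Icc 0 T t -> is_derive_on 0 T E t (E' t)).
    { intros t Ht; apply (is_derive_on_vsum 0 T n (fun i t => zeta i t ^ 2)); [easy|].
      intros i Hi; apply is_derive_on_is_derive; [easy|].
      evar_last; [apply is_derive_pow, Hz; [easy|easy]|simpl; ring]. }
    assert (HE' : forall t, Icc 0 T t -> E' t <= 2 * K * E t + 2 * e).
    { intros t Ht; unfold E'; rewrite vsum_scal.
      destruct (cutoff_range n rho (fun j => zeta j t) Hrho) as [Hc0 Hc1].
      assert (Hc := cutoff_mult_le n rho (fun j => zeta j t) Hrho).
      set (c := cutoff n rho (fun j => zeta j t)) in *.
      assert (Hn := nsq_nonneg n (fun j => zeta j t)).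
      assert (Hs := sqrt_pos (nsq n (fun j => zeta j t))).
      assert (Es := sqrt_sqrt _ Hn).
      (* With [mu = c^2] and [c <= 1], [mu |zeta| <= c |zeta| <= rho]: the truncation makes the
         smallness condition of [Henergy] hold wherever the solution may be. *)
      assert (H := Henergy t (fun j => zeta j t) (c ^ 2) Ht).
      apply Rle_trans with (2 * (K * E t + e)); [|lra].
      apply Rmult_le_compat_l; [lra|].
      eapply Rle_trans; [|apply H].
      - right; apply vsum_ext; intros i Hi; unfold F; destruct (lt_dec i n) as [_|]; [|easy].
        unfold Rc, Zc; rewrite (clamp_id 0 T t Ht); fold c; ring.
      - nra.
      - assert (Hc2 : c ^ 2 <= 1) by nra; assert (0 <= c ^ 2) by nra.
        assert ((c ^ 2) ^ 2 <= c ^ 2) by nra.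
        apply Rle_trans with (c ^ 2 * nsq n (fun j => zeta j t)).
        + now apply Rmult_le_compat_r.
        + rewrite <- Es.
          replace (c ^ 2 * (sqrt (nsq n (fun j => zeta j t)) * sqrt (nsq n (fun j => zeta j t))))
            with ((c * sqrt (nsq n (fun j => zeta j t))) ^ 2) by ring.
          apply pow_incr; split; [now apply Rmult_le_pos|easy]. }
    (* In [1 + 2 T] the 1 stands for the initial error [e] and [2 T] for the forcing [2 e]. *)
    assert (HEb : forall t, Icc 0 T t -> E t <= exp (2 * K * T) * (1 + 2 * T) * e).
    { intros t Ht.
      apply Rle_trans with (1 := gronwall T (2 * K) (2 * e) E E' ltac:(lra) ltac:(lra) HE HE' t Ht).
      assert (HE0 : E 0 <= e).
      { eapply Rle_trans; [|exact H0]; right; apply vsum_ext; intros; now rewrite Hz0. }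
      assert (0 <= E 0) by apply nsq_nonneg.
      destruct Ht as [Ht0 HtT].
      assert (H1 : exp (2 * K * t) <= exp (2 * K * T)) by (apply exp_le, Rmult_le_compat_l; lra).
      assert (H2 := exp_pos (2 * K * t)).
      assert (H3 : 0 <= e * t) by now apply Rmult_le_pos.
      assert (H4 : e * t <= e * T) by now apply Rmult_le_compat_l.
      rewrite (Rmult_assoc (exp (2 * K * T))); apply Rmult_le_compat; lra. }
    exists (fun i t => Z i t - zeta i t), (fun i t => Zt i t - F t (fun j => zeta j t) i).
    assert (Hode : forall t, Icc 0 T t ->
      (forall i, (i < n)%nat -> is_derive_on 0 T (fun t => Z i t - zeta i t) t
           (Zt i t - F t (fun j => zeta j t) i) /\
         Zt i t - F t (fun j => zeta j t) i + lin n A (fun j => Z j t - zeta j t) i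
           + bil n B (fun j => Z j t - zeta j t) (fun j => Z j t - zeta j t) i = 0)).
    { intros t Ht i Hi; split.
      - apply is_derive_on_minus; [easy|now apply HZ|].
        apply is_derive_on_is_derive; [easy|now apply Hz].
      - unfold F; destruct (lt_dec i n) as [_|]; [|easy].
        rewrite cutoff_one; [|easy|apply Rle_trans with (2 := Hsmall); now apply HEb].
        unfold Rc, Zc; rewrite (clamp_id 0 T t Ht), lin_minus, bil_minus_l, !bil_minus_r; ring. }
    split; [|split].
    + intros i Hi; rewrite Hz0; ring.
    + intros i Hi.
      (* Continuity of the derivative is read off from the equation. *)
      apply continuous_on_eq with (fun t => - (lin n A (fun j => Z j t - zeta j t) i
        + bil n B (fun j => Z j t - zeta j t) (fun j => Z j t - zeta j t) i)).
      { intros t Ht; generalize (proj2 (Hode t Ht i Hi)); lra. }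
      assert (Hdc : forall j, (j < n)%nat -> forall t,
        continuous (fun t => Z j (clamp 0 T t) - zeta j (clamp 0 T t)) t).
      { intros j Hj; apply (continuous_on_clamp_comp 0 T (fun t => Z j t - zeta j t)); [lra|].
        apply (continuous_on_derive 0 T _ (fun t => Zt j t - F t (fun j => zeta j t) j)).
        intros s Hs; now apply Hode. }
      apply continuous_on_opp, continuous_clamp_comp_on; intros t Ht.
      apply (continuous_plus
        (fun t => lin n A (fun j => Z j (clamp 0 T t) - zeta j (clamp 0 T t)) i)
        (fun t => bil n B (fun j => Z j (clamp 0 T t) - zeta j (clamp 0 T t))
                    (fun j => Z j (clamp 0 T t) - zeta j (clamp 0 T t)) i)).
      * apply (continuous_lin n A (fun j t => Z j (clamp 0 T t) - zeta j (clamp 0 T t))).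
        intros; now apply Hdc.
      * apply (continuous_bil n B (fun j t => Z j (clamp 0 T t) - zeta j (clamp 0 T t))
          (fun j t => Z j (clamp 0 T t) - zeta j (clamp 0 T t))); intros; now apply Hdc.
    + intros t Ht; split; [now apply Hode|].
      apply Rle_trans with (2 := HEb t Ht); right; apply vsum_ext; intros; ring.
Qed.

(** Two given solutions are bounded on [[0,T]], and [B(y,y) - B(z,z) = B(y,y-z) + B(y-z,z)], so the
    field is Lipschitz along them and Gronwall's lemma applies to the squared distance with zero
    data. *)
Lemma quadratic_ode_unique (T : R) (n : nat) (A : nat -> nat -> R)
    (B : nat -> nat -> nat -> R) (y yt z zt : nat -> R -> R) :
  0 < T ->
  (forall i, (i < n)%nat -> y i 0 = z i 0) ->
  (forall i t, (i < n)%nat -> Icc 0 T t -> is_derive_on 0 T (y i) t (yt i t) /\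
     yt i t + lin n A (fun j => y j t) i + bil n B (fun j => y j t) (fun j => y j t) i = 0) ->
  (forall i t, (i < n)%nat -> Icc 0 T t -> is_derive_on 0 T (z i) t (zt i t) /\
     zt i t + lin n A (fun j => z j t) i + bil n B (fun j => z j t) (fun j => z j t) i = 0) ->
  forall i t, (i < n)%nat -> Icc 0 T t -> y i t = z i t.
Proof.
  intros HT H0 Hy Hz.
  assert (Hbd : forall (x xt : nat -> R -> R),
    (forall i t, (i < n)%nat -> Icc 0 T t -> is_derive_on 0 T (x i) t (xt i t)) ->
    exists M, 0 <= M /\ forall i t, (i < n)%nat -> Icc 0 T t -> Rabs (x i t) <= M).
  { intros x xt Hx.
    destruct (continuous_on_bounded 0 T (fun t => vsum n (fun i => Rabs (x i t)))) as [M [HM0 HM]];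
      [lra| |].
    - apply continuous_on_vsum; intros i Hi; apply continuous_clamp_comp_on; intros t Ht.
      apply (continuous_comp (fun t => x i (clamp 0 T t)) Rabs); [|apply continuous_Rabs].
      apply continuous_on_clamp_comp; [lra|].
      apply (continuous_on_derive 0 T _ (xt i)); intros; now apply Hx.
    - exists M; split; [easy|]; intros i t Hi Ht.
      apply Rle_trans with (2 := HM _ Ht), Rle_trans with (2 := Rle_abs _).
      apply (vsum_term_le n (fun i => Rabs (x i t))); [intros; apply Rabs_pos|easy]. }
  destruct (Hbd y yt) as [M [HM0 HM]]; [intros; now apply Hy|].
  destruct (Hbd z zt) as [M' [HM0' HM']]; [intros; now apply Hz|].
  set (d := fun i t => y i t - z i t).
  set (E := fun t => nsq n (fun i => d i t)).
  set (E' := fun t => vsum n (fun i => 2 * (d i t * (yt i t - zt i t)))).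
  assert (HE : forall t, Icc 0 T t -> is_derive_on 0 T E t (E' t)).
  { intros t Ht; apply (is_derive_on_vsum 0 T n (fun i t => d i t ^ 2)); [easy|].
    intros i Hi.
    assert (Hd : is_derive_on 0 T (d i) t (yt i t - zt i t)).
    { apply is_derive_on_minus; [easy|now apply Hy|now apply Hz]. }
    apply is_derive_on_eq with (f := fun t => d i t * d i t)
      (l := (yt i t - zt i t) * d i t + d i t * (yt i t - zt i t)); [easy|intros; ring|ring|].
    now apply is_derive_on_mult. }
  set (L := sum_abs2 n A + sum_abs3 n B * (M + M')).
  assert (HL : 0 <= L).
  { assert (0 <= sum_abs2 n A) by apply sum_abs2_nonneg.
    assert (0 <= sum_abs3 n B) by apply sum_abs3_nonneg; unfold L; nra. }
  assert (HE' : forall t, Icc 0 T t -> E' t <= 2 * (INR n * L) * E t + 0).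
  { intros t Ht; unfold E'; rewrite vsum_scal.
    set (s := sqrt (E t)).
    assert (Hs : 0 <= s) by apply sqrt_pos.
    assert (Es : s * s = E t) by apply sqrt_sqrt, nsq_nonneg.
    replace (2 * (INR n * L) * E t + 0) with (2 * (INR n * (L * E t))) by ring.
    apply Rmult_le_compat_l; [lra|]; rewrite <- vsum_const; apply vsum_le; intros i Hi.
    assert (Hdk : forall k, (k < n)%nat -> Rabs (d k t) <= s).
    { intros k Hk; now apply (abs_le_sqrt_nsq n (fun k => d k t)). }
    assert (E1 : yt i t - zt i t = - (lin n A (fun j => d j t) i
      + bil n B (fun j => y j t) (fun j => d j t) i + bil n B (fun j => d j t) (fun j => z j t) i)).
    { unfold d; rewrite lin_minus, bil_minus_l, bil_minus_r.
      generalize (proj2 (Hy i t Hi Ht)) (proj2 (Hz i t Hi Ht)); lra. }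
    assert (B1 := lin_bound n A (fun j => d j t) s i Hi Hdk).
    assert (B2 := bil_bound n B (fun j => y j t) (fun j => d j t) M s i Hi
      (fun k Hk => HM k t Hk Ht) Hdk).
    assert (B3 := bil_bound n B (fun j => d j t) (fun j => z j t) s M' i Hi Hdk
      (fun k Hk => HM' k t Hk Ht)).
    assert (B4 : Rabs (yt i t - zt i t) <= L * s).
    { rewrite E1, Rabs_Ropp; unfold L.
      apply Rle_trans with (1 := Rabs_triang _ _).
      apply Rle_trans with (1 := Rplus_le_compat_r _ _ _ (Rabs_triang _ _)).
      lra. }
    apply Rle_trans with (1 := Rle_abs _); rewrite Rabs_mult, <- Es.
    replace (L * (s * s)) with (s * (L * s)) by ring.
    apply Rmult_le_compat; [apply Rabs_pos|apply Rabs_pos|now apply Hdk|easy]. }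
  intros i t Hi Ht.
  assert (Hn : 0 <= INR n) by apply pos_INR.
  assert (HEt := gronwall T (2 * (INR n * L)) 0 E E' ltac:(nra) ltac:(lra) HE HE' t Ht).
  assert (HE0 : E 0 = 0).
  { apply vsum_zero; intros j Hj; unfold d; rewrite H0 by easy; ring. }
  rewrite HE0, Rmult_0_l, Rplus_0_r, Rmult_0_r in HEt.
  assert (Hdi : d i t ^ 2 <= E t).
  { apply (vsum_term_le n (fun i => d i t ^ 2)); [intros; apply pow2_ge_0|easy]. }
  assert (Hd0 : d i t = 0) by nra.
  unfold d in Hd0; lra.
Qed.

(** * The inner product *)

Definition cont01 (f : R -> R) : Prop := continuous_on (Icc 0 1) f.

Lemma cont01_ex (f : R -> R) : cont01 f -> ex_RInt f 0 1.
Proof. apply ex_RInt_on; lra. Qed.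

Lemma RInt01_ext (f g : R -> R) :
  (forall x, Icc 0 1 x -> f x = g x) -> RInt f 0 1 = RInt g 0 1.
Proof.
  intros H; apply RInt_ext; intros x; rewrite Rmin_left, Rmax_right by lra.
  intros Hx; apply H; unfold Icc; lra.
Qed.

Lemma RInt01_plus (f g : R -> R) : cont01 f -> cont01 g ->
  RInt (fun x => f x + g x) 0 1 = RInt f 0 1 + RInt g 0 1.
Proof. intros Hf Hg; apply (RInt_plus (V := R_CompleteNormedModule)); now apply cont01_ex. Qed.

Lemma RInt01_minus (f g : R -> R) : cont01 f -> cont01 g ->
  RInt (fun x => f x - g x) 0 1 = RInt f 0 1 - RInt g 0 1.
Proof. intros Hf Hg; apply (RInt_minus (V := R_CompleteNormedModule)); now apply cont01_ex. Qed.

Lemma RInt01_scal (c : R) (f : R -> R) : cont01 f ->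
  RInt (fun x => c * f x) 0 1 = c * RInt f 0 1.
Proof. intros Hf; apply (RInt_scal (V := R_CompleteNormedModule)); now apply cont01_ex. Qed.

Lemma RInt01_const (c : R) : RInt (fun _ => c) 0 1 = c.
Proof. rewrite RInt_const; unfold scal; simpl; unfold mult; simpl; ring. Qed.

Lemma RInt01_le (f g : R -> R) : cont01 f -> cont01 g ->
  (forall x, Icc 0 1 x -> f x <= g x) -> RInt f 0 1 <= RInt g 0 1.
Proof.
  intros Hf Hg H; apply RInt_le; [lra|now apply cont01_ex|now apply cont01_ex|].
  intros x Hx; apply H; unfold Icc; lra.
Qed.

Definition comb (n : nat) (z : nat -> R) (e : nat -> R -> R) (x : R) : R :=
  vsum n (fun i => z i * e i x).

Lemma cont_comb (n : nat) (z : nat -> R) (e : nat -> R -> R) :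
  (forall i, (i < n)%nat -> cont01 (e i)) -> cont01 (comb n z e).
Proof.
  intros H; apply (continuous_on_vsum 0 1 n (fun i x => z i * e i x)).
  intros i Hi; apply continuous_on_mult; [apply continuous_on_const|now apply H].
Qed.

Lemma RInt01_comb (n : nat) (z : nat -> R) (f : nat -> R -> R) :
  (forall i, (i < n)%nat -> cont01 (f i)) ->
  RInt (comb n z f) 0 1 = vsum n (fun i => z i * RInt (f i) 0 1).
Proof.
  induction n as [|n IH]; intros H; [apply RInt01_const|].
  assert (Hf : cont01 (fun x => z n * f n x)).
  { apply continuous_on_mult; [apply continuous_on_const|apply H; lia]. }
  assert (Hc : cont01 (comb n z f)) by (apply cont_comb; intros; apply H; lia).
  change (comb (S n) z f) with (fun x => comb n z f x + z n * f n x).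
  rewrite RInt01_plus, IH, RInt01_scal; try easy; [apply H; lia|intros; apply H; lia].
Qed.

Lemma inner_ext (f g f' g' : R -> R) :
  (forall x, Icc 0 1 x -> f x = f' x) -> (forall x, Icc 0 1 x -> g x = g' x) ->
  inner f g = inner f' g'.
Proof. intros H H'; apply RInt01_ext; intros; now rewrite H, H'. Qed.

Lemma inner_sym (f g : R -> R) : inner f g = inner g f.
Proof. apply RInt01_ext; intros; ring. Qed.

Lemma inner_plus_l (f g k : R -> R) : cont01 f -> cont01 g -> cont01 k ->
  inner (fun x => f x + g x) k = inner f k + inner g k.
Proof.
  intros Hf Hg Hk; unfold inner; rewrite <- RInt01_plus; [|now apply continuous_on_mult..].
  apply RInt01_ext; intros; ring.
Qed.

Lemma inner_minus_l (f g k : R -> R) : cont01 f -> cont01 g -> cont01 k ->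
  inner (fun x => f x - g x) k = inner f k - inner g k.
Proof.
  intros Hf Hg Hk; unfold inner; rewrite <- RInt01_minus; [|now apply continuous_on_mult..].
  apply RInt01_ext; intros; ring.
Qed.

Lemma inner_scal_l (c : R) (f k : R -> R) : cont01 f -> cont01 k ->
  inner (fun x => c * f x) k = c * inner f k.
Proof.
  intros Hf Hk; unfold inner; rewrite <- RInt01_scal; [|now apply continuous_on_mult].
  apply RInt01_ext; intros; ring.
Qed.

Lemma inner_zero_l (f k : R -> R) : (forall x, Icc 0 1 x -> f x = 0) -> inner f k = 0.
Proof.
  intros H; transitivity (RInt (fun _ => 0) 0 1); [|apply RInt01_const].
  apply RInt01_ext; intros x Hx; rewrite (H x Hx); ring.
Qed.

Lemma inner_comb_l (n : nat) (z : nat -> R) (f : nat -> R -> R) (k : R -> R) :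
  (forall i, (i < n)%nat -> cont01 (f i)) -> cont01 k ->
  inner (comb n z f) k = vsum n (fun i => z i * inner (f i) k).
Proof.
  intros H Hk; unfold inner.
  rewrite <- (RInt01_comb n z (fun i x => f i x * k x)).
  - apply RInt01_ext; intros x Hx; unfold comb; rewrite <- vsum_scal_r; apply vsum_ext; intros; ring.
  - intros i Hi; apply continuous_on_mult; [now apply H|easy].
Qed.

Lemma inner_comb_r (n : nat) (z : nat -> R) (f : nat -> R -> R) (k : R -> R) :
  (forall i, (i < n)%nat -> cont01 (f i)) -> cont01 k ->
  inner k (comb n z f) = vsum n (fun i => z i * inner k (f i)).
Proof.
  intros H Hk; rewrite inner_sym, inner_comb_l by easy.
  apply vsum_ext; intros; now rewrite inner_sym.
Qed.

Lemma inner_nonneg (f : R -> R) : cont01 f -> 0 <= inner f f.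
Proof.
  intros Hf; apply Rle_trans with (RInt (fun _ => 0) 0 1); [right; symmetry; apply RInt01_const|].
  apply RInt01_le; [apply continuous_on_const| |].
  - now apply continuous_on_mult.
  - intros; nra.
Qed.

Lemma inner_self_le (f : R -> R) (M : R) : cont01 f ->
  (forall x, Icc 0 1 x -> Rabs (f x) <= M) -> inner f f <= M ^ 2.
Proof.
  intros Hf H; rewrite <- (RInt01_const (M ^ 2)); apply RInt01_le; [|apply continuous_on_const|].
  - now apply continuous_on_mult.
  - intros x Hx; specialize (H x Hx); assert (H0 := Rabs_pos (f x)).
    replace (f x * f x) with (Rabs (f x) ^ 2) by (rewrite pow2_abs; ring).
    now apply pow_incr.
Qed.

Lemma inner_self_mult_le (f g : R -> R) (M : R) : cont01 f -> cont01 g ->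
  (forall x, Icc 0 1 x -> Rabs (g x) <= M * Rabs (f x)) -> inner g g <= M ^ 2 * inner f f.
Proof.
  intros Hf Hg H; unfold inner; rewrite <- RInt01_scal by now apply continuous_on_mult.
  apply RInt01_le; [now apply continuous_on_mult| |].
  - apply continuous_on_mult; [apply continuous_on_const|now apply continuous_on_mult].
  - intros x Hx; specialize (H x Hx); assert (H0 := Rabs_pos (g x)).
    replace (g x * g x) with (Rabs (g x) ^ 2) by (rewrite pow2_abs; ring).
    replace (M ^ 2 * (f x * f x)) with ((M * Rabs (f x)) ^ 2)
      by (rewrite Rpow_mult_distr, pow2_abs; ring).
    now apply pow_incr.
Qed.

Lemma inner_CS (f g : R -> R) : cont01 f -> cont01 g ->
  (inner f g) ^ 2 <= inner f f * inner g g.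
Proof.
  intros Hf Hg; apply square_le_of_quadratic; [now apply inner_nonneg|].
  intros s.
  assert (Hsg : cont01 (fun x => s * g x)).
  { apply continuous_on_mult; [apply continuous_on_const|easy]. }
  assert (Hfg : cont01 (fun x => f x + s * g x)) by now apply continuous_on_plus.
  assert (H := inner_nonneg _ Hfg).
  rewrite inner_plus_l, inner_scal_l in H by easy.
  rewrite (inner_sym f), (inner_sym g), !inner_plus_l, !inner_scal_l in H by easy.
  rewrite (inner_sym g f) in H; lra.
Qed.

Lemma L2norm_nonneg (f : R -> R) : 0 <= L2norm f.
Proof. apply sqrt_pos. Qed.

Lemma L2norm_sqr (f : R -> R) : cont01 f -> L2norm f ^ 2 = inner f f.
Proof.
  intros Hf; unfold L2norm; rewrite <- (sqrt_sqrt (inner f f)) at 2 by now apply inner_nonneg.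
  ring.
Qed.

Lemma L2norm_ext (f g : R -> R) : (forall x, Icc 0 1 x -> f x = g x) -> L2norm f = L2norm g.
Proof. intros H; unfold L2norm; f_equal; now apply inner_ext. Qed.

Lemma L2norm_le_sqr (f : R -> R) (M : R) : 0 <= M -> inner f f <= M ^ 2 -> L2norm f <= M.
Proof.
  intros HM H; unfold L2norm; rewrite <- (sqrt_Rsqr M HM); apply sqrt_le_1_alt.
  unfold Rsqr; lra.
Qed.

Lemma L2norm_le_sup (f : R -> R) (M : R) : cont01 f -> 0 <= M ->
  (forall x, Icc 0 1 x -> Rabs (f x) <= M) -> L2norm f <= M.
Proof. intros Hf HM H; apply L2norm_le_sqr; [easy|now apply inner_self_le]. Qed.

Lemma inner_abs_le (f g : R -> R) : cont01 f -> cont01 g ->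
  Rabs (inner f g) <= L2norm f * L2norm g.
Proof.
  intros Hf Hg; assert (H := inner_CS f g Hf Hg).
  rewrite <- (L2norm_sqr f Hf), <- (L2norm_sqr g Hg), <- Rpow_mult_distr, <- pow2_abs in H.
  apply Rsqr_incr_0_var; [unfold Rsqr; simpl in H; lra|].
  apply Rmult_le_pos; apply L2norm_nonneg.
Qed.

Lemma L2norm_triang (f g : R -> R) : cont01 f -> cont01 g ->
  L2norm (fun x => f x + g x) <= L2norm f + L2norm g.
Proof.
  intros Hf Hg; apply L2norm_le_sqr.
  - generalize (L2norm_nonneg f) (L2norm_nonneg g); lra.
  - assert (Hfg : cont01 (fun x => f x + g x)) by now apply continuous_on_plus.
    rewrite inner_plus_l by easy.
    rewrite (inner_sym f), (inner_sym g), !inner_plus_l by easy.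
    rewrite (inner_sym g f), <- (L2norm_sqr f Hf), <- (L2norm_sqr g Hg).
    generalize (inner_abs_le f g Hf Hg) (Rle_abs (inner f g)); intros; nra.
Qed.

(** * Orthonormal bases of spaces of pairs *)

(** The two unknowns are treated as one element of a product space. An orthonormal basis of pairs
    makes the mass matrix the identity, so the scheme is an explicit quadratic system, and the
    Euclidean norm of the coordinates is the energy. *)
Definition pair_inner (f g p q : R -> R) : R := inner f p + inner g q.

Record function_space (V : (R -> R) -> Prop) : Prop := {
  fs_cont : forall f, V f -> cont01 f;
  fs_zero : V (fun _ => 0);
  fs_plus : forall f g, V f -> V g -> V (fun x => f x + g x);
  fs_scal : forall c f, V f -> V (fun x => c * f x)
}.

Lemma fs_comb (V : (R -> R) -> Prop) (n : nat) (z : nat -> R) (f : nat -> R -> R) :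
  function_space V -> (forall i, (i < n)%nat -> V (f i)) ->
  V (comb n z f).
Proof.
  intros HV; induction n as [|n IH]; intros H; [exact (fs_zero V HV)|].
  apply (fs_plus V HV (comb n z f) (fun x => z n * f n x)).
  - apply IH; intros; apply H; lia.
  - apply (fs_scal V HV), H; lia.
Qed.

Definition orthonormal (V W : (R -> R) -> Prop) (n : nat) (e f : nat -> R -> R) : Prop :=
  (forall i, (i < n)%nat -> V (e i) /\ W (f i)) /\
  (forall i j, (i < n)%nat -> (j < n)%nat ->
     pair_inner (e i) (f i) (e j) (f j) = kron i j).

Lemma orthonormal_comb (V W : (R -> R) -> Prop) (n : nat) (e f : nat -> R -> R)
    (z : nat -> R) (j : nat) :
  function_space V -> function_space W -> orthonormal V W n e f -> (j < n)%nat ->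
  pair_inner (comb n z e) (comb n z f)
    (e j) (f j) = z j.
Proof.
  intros HV HW [Hm Ho] Hj; unfold pair_inner.
  rewrite !inner_comb_l, <- vsum_plus.
  - rewrite <- (vsum_kron n j z Hj); apply vsum_ext; intros i Hi.
    rewrite <- Rmult_plus_distr_l; f_equal.
    transitivity (kron i j); [now apply Ho|].
    unfold kron; now rewrite Nat.eqb_sym.
  - intros; now apply (fs_cont W HW), Hm.
  - now apply (fs_cont W HW), Hm.
  - intros; now apply (fs_cont V HV), Hm.
  - now apply (fs_cont V HV), Hm.
Qed.

Lemma orthonormal_norm (V W : (R -> R) -> Prop) (n : nat) (e f : nat -> R -> R) (z : nat -> R) :
  function_space V -> function_space W -> orthonormal V W n e f ->
  pair_inner (comb n z e) (comb n z f)
    (comb n z e) (comb n z f) = nsq n z.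
Proof.
  intros HV HW H.
  assert (Hm := proj1 H).
  unfold pair_inner.
  rewrite (inner_comb_r n z e), (inner_comb_r n z f), <- vsum_plus.
  - apply vsum_ext; intros j Hj.
    rewrite <- Rmult_plus_distr_l.
    transitivity (z j * z j); [|ring]; f_equal.
    now apply (orthonormal_comb V W).
  - intros; now apply (fs_cont W HW), Hm.
  - apply (fs_cont W HW), fs_comb; [easy|]; intros; now apply Hm.
  - intros; now apply (fs_cont V HV), Hm.
  - apply (fs_cont V HV), fs_comb; [easy|]; intros; now apply Hm.
Qed.

(** The squared distance to the orthogonal projection is nonnegative. Since [g] and [k] need only be
    continuous, this bounds the initial error: the coordinates of [V - P v] are those of [V - v],
    although [v] is not in the space. *)
Lemma bessel (V W : (R -> R) -> Prop) (n : nat) (e f : nat -> R -> R) (g k : R -> R) :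
  function_space V -> function_space W -> orthonormal V W n e f -> cont01 g -> cont01 k ->
  nsq n (fun i => pair_inner g k (e i) (f i)) <= inner g g + inner k k.
Proof.
  intros HV HW H Hg Hk; assert (Hm := proj1 H).
  set (z := fun i => pair_inner g k (e i) (f i)).
  set (p := comb n z e).
  set (q := comb n z f).
  assert (Hp : cont01 p).
  { apply (fs_cont V HV), fs_comb; [easy|]; intros; now apply Hm. }
  assert (Hq : cont01 q).
  { apply (fs_cont W HW), fs_comb; [easy|]; intros; now apply Hm. }
  assert (Hn : inner p p + inner q q = nsq n z) by now apply (orthonormal_norm V W).
  assert (Hi : inner g p + inner k q = nsq n z).
  { unfold p, q; rewrite !inner_comb_r, <- vsum_plus.
    - apply vsum_ext; intros i Hi'; unfold z, pair_inner; ring.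
    - intros; now apply (fs_cont W HW), Hm.
    - easy.
    - intros; now apply (fs_cont V HV), Hm.
    - easy. }
  assert (H1 := inner_nonneg _ (continuous_on_minus 0 1 g p Hg Hp)).
  assert (H2 := inner_nonneg _ (continuous_on_minus 0 1 k q Hk Hq)).
  assert (Hgp : cont01 (fun x => g x - p x)) by now apply continuous_on_minus.
  assert (Hkq : cont01 (fun x => k x - q x)) by now apply continuous_on_minus.
  rewrite inner_minus_l, (inner_sym g), (inner_sym p), !inner_minus_l in H1 by easy.
  rewrite inner_minus_l, (inner_sym k), (inner_sym q), !inner_minus_l in H2 by easy.
  rewrite (inner_sym p g) in H1; rewrite (inner_sym q k) in H2; lra.
Qed.

(** No finite dimension is assumed. Either some residual has positive norm and, once normalised,
    prolongs the family, up to length [d]; or all residuals have norm zero. Spanning is stated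
    through this zero distance because equality of values would need a bound on point
    evaluations. *)
Lemma gram_schmidt (V W : (R -> R) -> Prop) (d : nat) :
  function_space V -> function_space W ->
  exists n e f, orthonormal V W n e f /\
    (n = d \/
     forall g k, V g -> W k ->
       let z := fun i => pair_inner g k (e i) (f i) in
       inner (fun x => g x - comb n z e x)
         (fun x => g x - comb n z e x) = 0 /\
       inner (fun x => k x - comb n z f x)
         (fun x => k x - comb n z f x) = 0).
Proof.
  intros HV HW; induction d as [|d [n [e [f [Ho [Hn|Hsp]]]]]].
  - exists 0%nat, (fun _ _ => 0), (fun _ _ => 0); split; [split; intros; lia|now left].
  - subst n; assert (Hm := proj1 Ho).
    destruct (classic (forall g k, V g -> W k ->
       let z := fun i => pair_inner g k (e i) (f i) in
       inner (fun x => g x - comb d z e x)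
         (fun x => g x - comb d z e x) = 0 /\
       inner (fun x => k x - comb d z f x)
         (fun x => k x - comb d z f x) = 0)) as [Hsp|Hns].
    { exists d, e, f; split; [easy|now right]. }
    apply not_all_ex_not in Hns; destruct Hns as [g Hns].
    apply not_all_ex_not in Hns; destruct Hns as [k Hns].
    apply imply_to_and in Hns; destruct Hns as [Hg Hns].
    apply imply_to_and in Hns; destruct Hns as [Hk Hns].
    set (z := fun i => pair_inner g k (e i) (f i)).
    set (p := fun x => g x + (-1) * comb d z e x).
    set (q := fun x => k x + (-1) * comb d z f x).
    assert (Hp : V p).
    { apply (fs_plus V HV); [easy|]; apply (fs_scal V HV), fs_comb; [easy|].
      intros; now apply Hm. }
    assert (Hq : W q).
    { apply (fs_plus W HW); [easy|]; apply (fs_scal W HW), fs_comb; [easy|].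
      intros; now apply Hm. }
    assert (Hpc := fs_cont V HV p Hp); assert (Hqc := fs_cont W HW q Hq).
    set (s := inner p p + inner q q).
    assert (Hs : 0 < s).
    { assert (H1 := inner_nonneg p Hpc); assert (H2 := inner_nonneg q Hqc).
      destruct (Req_EM_T s 0) as [Hs0|]; [exfalso|unfold s in *; lra].
      apply Hns; split; [transitivity (inner p p)|transitivity (inner q q)];
        try (unfold s in Hs0; lra); apply inner_ext; intros; unfold p, q, z; ring. }
    assert (Hort : forall j, (j < d)%nat -> pair_inner p q (e j) (f j) = 0).
    { intros j Hj; unfold pair_inner, p, q.
      assert (Hej : cont01 (e j)) by now apply (fs_cont V HV), Hm.
      assert (Hfj : cont01 (f j)) by now apply (fs_cont W HW), Hm.
      assert (Hec : cont01 (comb d z e)).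
      { apply (fs_cont V HV), fs_comb; [easy|]; intros; now apply Hm. }
      assert (Hfc : cont01 (comb d z f)).
      { apply (fs_cont W HW), fs_comb; [easy|]; intros; now apply Hm. }
      rewrite !inner_plus_l, !inner_scal_l;
        try easy; try (apply (fs_cont V HV); now apply (fs_scal V HV));
        try (apply (fs_cont V HV); easy); try (apply (fs_cont W HW); easy);
        try (apply continuous_on_mult; [apply continuous_on_const|easy]).
      assert (Hc := orthonormal_comb V W d e f z j HV HW Ho Hj).
      unfold pair_inner in Hc; unfold z at 3, pair_inner in Hc; lra. }
    set (c := / sqrt s).
    assert (Hc : c * c * s = 1).
    { unfold c; rewrite <- (sqrt_sqrt s) at 3 by lra; field.
      apply Rgt_not_eq, sqrt_lt_R0; easy. }
    exists (S d), (fun i => if Nat.eqb i d then (fun x => c * p x) else e i),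
      (fun i => if Nat.eqb i d then (fun x => c * q x) else f i).
    split; [|now left]; split.
    + intros i Hi; destruct (Nat.eqb_spec i d) as [->|Hne].
      * split; [now apply (fs_scal V HV)|now apply (fs_scal W HW)].
      * apply Hm; lia.
    + assert (Hdj : forall j, (j < d)%nat ->
        pair_inner (fun x => c * p x) (fun x => c * q x) (e j) (f j) = 0).
      { intros j Hj; unfold pair_inner; rewrite !inner_scal_l; try easy.
        - rewrite <- Rmult_plus_distr_l.
          transitivity (c * pair_inner p q (e j) (f j)); [easy|rewrite Hort by easy; ring].
        - now apply (fs_cont W HW), Hm.
        - now apply (fs_cont V HV), Hm. }
      intros i j Hi Hj; destruct (Nat.eqb_spec i d) as [->|Hi']; destruct (Nat.eqb_spec j d) as [->|Hj'].
      * unfold kron; rewrite Nat.eqb_refl, <- Hc; unfold s, pair_inner.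
        assert (Hcp : cont01 (fun x => c * p x)) by (apply continuous_on_mult; [apply continuous_on_const|easy]).
        assert (Hcq : cont01 (fun x => c * q x)) by (apply continuous_on_mult; [apply continuous_on_const|easy]).
        rewrite !inner_scal_l, (inner_sym p), (inner_sym q), !inner_scal_l by easy; ring.
      * rewrite Hdj by lia; unfold kron; now replace (Nat.eqb d j) with false
          by (symmetry; apply Nat.eqb_neq; lia).
      * unfold pair_inner; rewrite (inner_sym (e i)), (inner_sym (f i)).
        transitivity 0; [apply Hdj; lia|]; unfold kron; now replace (Nat.eqb i d) with false
          by (symmetry; apply Nat.eqb_neq; lia).
      * apply Ho; lia.
  - exists n, e, f; split; [easy|now right].
Qed.

Lemma orthonormal_swap (V W : (R -> R) -> Prop) (n : nat) (e f : nat -> R -> R) :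
  orthonormal V W n e f -> orthonormal W V n f e.
Proof.
  intros [Hm Ho]; split; [intros; split; now apply Hm|].
  intros i j Hi Hj; rewrite <- Ho by easy; unfold pair_inner; ring.
Qed.

(** The evaluation bound is applied to the kernel [g = sum_i e_i(x) e_i]: its value at [x] is the
    sum [s] in question and its squared norm is at most [s], so [s^2 <= K s]. *)
Lemma orthonormal_sum_sqr_le (V W : (R -> R) -> Prop) (K : R) (n : nat) (e f : nat -> R -> R)
    (x : R) :
  0 <= K -> function_space V -> function_space W ->
  (forall g, V g -> g x ^ 2 <= K * inner g g) ->
  orthonormal V W n e f -> vsum n (fun i => e i x ^ 2) <= K.
Proof.
  intros HK HV HW HKV Ho; assert (Hm := proj1 Ho).
  set (z := fun i => e i x); change (nsq n z <= K).
  set (g := comb n z e).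
  set (k := comb n z f).
  assert (Hg : V g) by (apply fs_comb; [easy|]; intros; now apply Hm).
  assert (Hk : W k) by (apply fs_comb; [easy|]; intros; now apply Hm).
  assert (Hnorm : inner g g + inner k k = nsq n z) by now apply (orthonormal_norm V W).
  assert (Hgx : g x = nsq n z) by (apply vsum_ext; intros; unfold z; ring).
  assert (HH := HKV g Hg); rewrite Hgx in HH.
  assert (Hkk := inner_nonneg k (fs_cont W HW k Hk)).
  assert (Hn := nsq_nonneg n z).
  apply Rnot_lt_le; intros Hlt; nra.
Qed.

(* If point evaluation is bounded by the norm, an orthonormal family of size [n] has
   [n = sum of the squared norms <= 2 K], because [sum_i e_i(x)^2 <= K] for each [x]. *)
Lemma orthonormal_basis (V W : (R -> R) -> Prop) (K : R) :
  0 <= K -> function_space V -> function_space W ->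
  (forall g, V g -> forall x, Icc 0 1 x -> g x ^ 2 <= K * inner g g) ->
  (forall g, W g -> forall x, Icc 0 1 x -> g x ^ 2 <= K * inner g g) ->
  exists n e f, orthonormal V W n e f /\
    forall g k, V g -> W k -> forall x, Icc 0 1 x ->
      g x = vsum n (fun i => pair_inner g k (e i) (f i) * e i x) /\
      k x = vsum n (fun i => pair_inner g k (e i) (f i) * f i x).
Proof.
  intros HK HV HW HKV HKW.
  destruct (INR_unbounded (2 * K)) as [d Hd].
  destruct (gram_schmidt V W d HV HW) as [n [e [f [Ho Hsp]]]].
  exists n, e, f; split; [easy|]; assert (Hm := proj1 Ho).
  assert (Hec : forall i, (i < n)%nat -> cont01 (e i)) by (intros; now apply (fs_cont V HV), Hm).
  assert (Hfc : forall i, (i < n)%nat -> cont01 (f i)) by (intros; now apply (fs_cont W HW), Hm).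
  destruct Hsp as [->|Hsp]; [exfalso|].
  - assert (Hpt : forall x, Icc 0 1 x ->
      vsum d (fun i => e i x ^ 2) <= K /\ vsum d (fun i => f i x ^ 2) <= K).
    { intros x Hx; split.
      - apply (orthonormal_sum_sqr_le V W K d e f); auto.
      - apply (orthonormal_sum_sqr_le W V K d f e); auto.
        now apply orthonormal_swap. }
    set (q := fun i x => e i x * e i x + f i x * f i x).
    assert (Cq : forall i, (i < d)%nat -> cont01 (q i)).
    { intros i Hi; apply continuous_on_plus; apply continuous_on_mult;
        first [now apply Hec|now apply Hfc]. }
    assert (Hsum : INR d = RInt (comb d (fun _ => 1) q) 0 1).
    { rewrite RInt01_comb by easy.
      rewrite <- (Rmult_1_r (INR d)), <- vsum_const; apply vsum_ext; intros i Hi.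
      unfold q; rewrite RInt01_plus by (apply continuous_on_mult; first [now apply Hec|now apply Hfc]).
      transitivity (pair_inner (e i) (f i) (e i) (f i)); [|unfold pair_inner, inner; ring].
      rewrite (proj2 Ho) by easy; unfold kron; now rewrite Nat.eqb_refl. }
    assert (Hle : RInt (comb d (fun _ => 1) q) 0 1 <= 2 * K).
    { rewrite <- (RInt01_const (2 * K)); apply RInt01_le; [now apply cont_comb|apply continuous_on_const|].
      intros x Hx; destruct (Hpt x Hx) as [H1 H2].
      apply Rle_trans with (vsum d (fun i => e i x ^ 2) + vsum d (fun i => f i x ^ 2)); [|lra].
      right; rewrite <- vsum_plus; apply vsum_ext; intros; unfold q; ring. }
    lra.
  - intros g k Hg Hk x Hx; destruct (Hsp g k Hg Hk) as [H1 H2].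
    set (z := fun i => pair_inner g k (e i) (f i)).
    change (inner (fun x => g x - comb n z e x)
      (fun x => g x - comb n z e x) = 0) in H1.
    change (inner (fun x => k x - comb n z f x)
      (fun x => k x - comb n z f x) = 0) in H2.
    change (g x = comb n z e x /\ k x = comb n z f x).
    assert (Hp : V (fun x => g x + (-1) * comb n z e x)).
    { apply (fs_plus V HV); [easy|]; apply (fs_scal V HV), fs_comb; [easy|].
      intros; now apply Hm. }
    assert (Hq : W (fun x => k x + (-1) * comb n z f x)).
    { apply (fs_plus W HW); [easy|]; apply (fs_scal W HW), fs_comb; [easy|].
      intros; now apply Hm. }
    (* The bound on point evaluations turns residuals of norm zero into functions that vanish at
       [x]. *)
    assert (HH1 := HKV _ Hp x Hx); assert (HH2 := HKW _ Hq x Hx); cbv beta in HH1, HH2.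
    rewrite (inner_ext _ _ (fun x => g x - comb n z e x)
      (fun x => g x - comb n z e x)), H1 in HH1 by (intros; ring).
    rewrite (inner_ext _ _ (fun x => k x - comb n z f x)
      (fun x => k x - comb n z f x)), H2 in HH2 by (intros; ring).
    split; nra.
Qed.

(** * Inverse inequalities *)

Definition pol (c : nat -> R) (d : nat) (x : R) : R := sum_n (fun k => c k * x ^ k) d.

(** The convention [pred 0 = 0] does no harm, because the factor [INR 0] removes the constant
    term. *)
Definition dpol (c : nat -> R) (d : nat) (x : R) : R :=
  sum_n (fun k => c k * (INR k * x ^ pred k)) d.

Lemma pol_O (c : nat -> R) (x : R) : pol c 0 x = c 0%nat.
Proof. unfold pol; rewrite sum_O; simpl; ring. Qed.

Lemma pol_S (c : nat -> R) (d : nat) (x : R) : pol c (S d) x = pol c d x + c (S d) * x ^ S d.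
Proof. unfold pol; now rewrite sum_Sn. Qed.

Lemma is_derive_scal_pow (a : R) (n : nat) (x : R) :
  is_derive (fun x => a * x ^ n) x (a * (INR n * x ^ pred n)).
Proof. auto_derive; [easy|ring]. Qed.

Lemma is_derive_pol (c : nat -> R) (d : nat) (x : R) : is_derive (pol c d) x (dpol c d x).
Proof.
  apply (is_derive_sum_n (K := R_AbsRing) (V := R_NormedModule) (fun k x => c k * x ^ k)).
  intros k _; apply is_derive_scal_pow.
Qed.

Lemma continuous_pol (c : nat -> R) (d : nat) (x : R) : continuous (pol c d) x.
Proof. apply (ex_derive_continuous (pol c d)); eexists; apply is_derive_pol. Qed.

Lemma cont01_continuous (f : R -> R) : (forall x, continuous f x) -> cont01 f.
Proof. intros H; apply continuous_on_continuous; intros; apply H. Qed.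

Definition is_pol (d : nat) (f : R -> R) : Prop := exists c, forall x, f x = pol c d x.

Lemma is_pol_const (a : R) : is_pol 0 (fun _ => a).
Proof. exists (fun _ => a); intros x; now rewrite pol_O. Qed.

Lemma is_pol_S (d : nat) (f : R -> R) : is_pol d f -> is_pol (S d) f.
Proof.
  intros [c Hc]; exists (fun k => if Nat.leb k d then c k else 0); intros x.
  rewrite Hc, pol_S; replace (Nat.leb (S d) d) with false.
  - rewrite Rmult_0_l, Rplus_0_r; apply sum_n_ext_loc; intros k Hk.
    now replace (Nat.leb k d) with true by (symmetry; apply Nat.leb_le; easy).
  - symmetry; apply Nat.leb_gt; lia.
Qed.

Lemma is_pol_const_le (d : nat) (a : R) : is_pol d (fun _ => a).
Proof. induction d; [apply is_pol_const|now apply is_pol_S]. Qed.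

Lemma sum_n_Rplus (d : nat) (f g : nat -> R) :
  sum_n (fun k => f k + g k) d = sum_n f d + sum_n g d.
Proof. exact (sum_n_plus (G := R_AbelianMonoid) f g d). Qed.

Lemma sum_n_Rscal (d : nat) (a : R) (f : nat -> R) :
  sum_n (fun k => a * f k) d = a * sum_n f d.
Proof. exact (sum_n_mult_l (K := R_Ring) a f d). Qed.

Lemma is_pol_plus (d : nat) (f g : R -> R) :
  is_pol d f -> is_pol d g -> is_pol d (fun x => f x + g x).
Proof.
  intros [c Hc] [c' Hc']; exists (fun k => c k + c' k); intros x.
  rewrite Hc, Hc'; unfold pol; rewrite <- sum_n_Rplus.
  apply (sum_n_ext (G := R_AbelianMonoid)); intros k; simpl; ring.
Qed.

Lemma is_pol_scal (d : nat) (a : R) (f : R -> R) : is_pol d f -> is_pol d (fun x => a * f x).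
Proof.
  intros [c Hc]; exists (fun k => a * c k); intros x.
  rewrite Hc; unfold pol; rewrite <- sum_n_Rscal.
  apply (sum_n_ext (G := R_AbelianMonoid)); intros k; simpl; ring.
Qed.

Lemma pol_shift (c : nat -> R) (d : nat) (x : R) :
  pol c (S d) x = c 0%nat + x * pol (fun k => c (S k)) d x.
Proof.
  induction d as [|d IH]; [rewrite pol_S, !pol_O; simpl; ring|].
  rewrite pol_S, IH, (pol_S (fun k => c (S k)) d), <- (tech_pow_Rmult x (S d)); ring.
Qed.

Lemma is_pol_mult_id (d : nat) (f : R -> R) : is_pol d f -> is_pol (S d) (fun x => x * f x).
Proof.
  intros [c Hc]; exists (fun k => match k with O => 0 | S j => c j end); intros x.
  rewrite pol_shift; change (x * f x = 0 + x * pol c d x); rewrite Hc; ring.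
Qed.

Lemma is_pol_ext (d : nat) (f g : R -> R) : (forall x, f x = g x) -> is_pol d f -> is_pol d g.
Proof. intros H [c Hc]; exists c; intros x; now rewrite <- H. Qed.

(** Horner's form [c 0 + x q(x)] lowers the degree, and the substitution turns the factor [x] into
    [a + l y]. *)
Lemma is_pol_affine (d : nat) (a l : R) (f : R -> R) :
  is_pol d f -> is_pol d (fun y => f (a + l * y)).
Proof.
  induction d as [|d IH] in f |- *; intros [c Hc].
  - exists c; intros x; rewrite Hc, !pol_O; easy.
  - assert (H : is_pol d (fun y => pol (fun k => c (S k)) d (a + l * y))).
    { apply (IH (pol (fun k => c (S k)) d)); now exists (fun k => c (S k)). }
    apply is_pol_ext with (fun y => c 0%nat + (a * pol (fun k => c (S k)) d (a + l * y)
      + l * (y * pol (fun k => c (S k)) d (a + l * y)))).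
    { intros x; rewrite Hc, pol_shift; ring. }
    apply is_pol_plus; [apply is_pol_const_le|apply is_pol_plus].
    + now apply is_pol_S, is_pol_scal.
    + now apply is_pol_scal, is_pol_mult_id.
Qed.

Lemma L2norm_scal (a : R) (f : R -> R) : cont01 f -> L2norm (fun x => a * f x) = Rabs a * L2norm f.
Proof.
  intros Hf.
  assert (Haf : cont01 (fun x => a * f x)) by (apply continuous_on_mult; [apply continuous_on_const|easy]).
  unfold L2norm; rewrite inner_scal_l, inner_sym, inner_scal_l by easy.
  rewrite <- Rmult_assoc, sqrt_mult; [|nra|now apply inner_nonneg].
  now rewrite <- sqrt_Rsqr_abs.
Qed.

(** The substitution gives [2 int_0^(1/2) f^2] for the square, so sqrt 2 would do; 2 avoids the
    root. *)
Lemma L2norm_half (f : R -> R) : (forall x, continuous f x) ->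
  L2norm (fun x => f (x / 2)) <= 2 * L2norm f.
Proof.
  intros Hf.
  assert (Hc : forall x, continuous (fun x => f x * f x) x) by (intros; now apply (continuous_mult f f)).
  assert (Hex : forall a b, ex_RInt (fun x => f x * f x) a b).
  { intros a b; apply (ex_RInt_continuous (V := R_CompleteNormedModule)); intros; apply Hc. }
  apply L2norm_le_sqr; [generalize (L2norm_nonneg f); lra|].
  rewrite Rpow_mult_distr, L2norm_sqr by now apply cont01_continuous.
  assert (E : inner (fun x => f (x / 2)) (fun x => f (x / 2))
    = 2 * RInt (fun x => f x * f x) 0 (/ 2)).
  { assert (H := RInt_comp_lin (V := R_CompleteNormedModule) (fun x => f x * f x) (/ 2) 0 0 1).
    replace (/ 2 * 0 + 0) with 0 in H by ring; replace (/ 2 * 1 + 0) with (/ 2) in H by ring.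
    rewrite <- H by apply Hex.
    rewrite (RInt_scal (V := R_CompleteNormedModule)).
    - unfold scal; simpl; unfold mult; simpl; rewrite <- Rmult_assoc, Rinv_r, Rmult_1_l by lra.
      apply RInt01_ext; intros x _; now replace (/ 2 * x + 0) with (x / 2) by field.
    - apply (ex_RInt_continuous (V := R_CompleteNormedModule)); intros z _.
      apply (continuous_comp (fun y => / 2 * y + 0) (fun x => f x * f x)); [|apply Hc].
      apply (ex_derive_continuous (fun y => / 2 * y + 0)); auto_derive; easy. }
  rewrite E; unfold inner.
  rewrite <- (RInt_Chasles (V := R_CompleteNormedModule) (fun x => f x * f x) 0 (/ 2) 1)
    by apply Hex; unfold plus; simpl.
  assert (forall a b, a <= b -> 0 <= RInt (fun x => f x * f x) a b).
  { intros a b Hab; apply RInt_ge_0; [easy|apply Hex|intros; nra]. }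
  assert (0 <= RInt (fun x => f x * f x) 0 (/ 2)) by (apply H; lra).
  assert (0 <= RInt (fun x => f x * f x) (/ 2) 1) by (apply H; lra).
  lra.
Qed.

Lemma sum_n_abs_le (d : nat) (f : nat -> R) (M : R) :
  (forall k, (k <= d)%nat -> Rabs (f k) <= M) -> Rabs (sum_n f d) <= INR (S d) * M.
Proof.
  induction d as [|d IH]; intros H.
  - rewrite sum_O; simpl; rewrite Rmult_1_l; now apply H.
  - rewrite sum_Sn, S_INR; unfold plus; simpl plus.
    apply Rle_trans with (1 := Rabs_triang _ _).
    rewrite Rmult_plus_distr_r, Rmult_1_l; apply Rplus_le_compat; [apply IH; intros; apply H; lia|].
    apply H; lia.
Qed.

(* [2^(d+1) p(x/2) - p(x)] has degree at most [d], which bounds the lower coefficients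
   by induction. *)
Lemma pol_coef_le (d : nat) :
  exists K, 0 <= K /\ forall c k, (k <= d)%nat -> Rabs (c k) <= K * L2norm (pol c d).
Proof.
  induction d as [|d [K [HK IH]]].
  - exists 1; split; [lra|]; intros c k Hk; replace k with 0%nat by lia.
    rewrite (L2norm_ext (pol c 0) (fun x => c 0%nat * 1)) by (intros; rewrite pol_O; ring).
    rewrite L2norm_scal by apply continuous_on_const.
    unfold L2norm, inner; rewrite RInt01_const, Rmult_1_r, sqrt_1; lra.
  - set (K1 := K * (2 ^ S d * 2 + 1)).
    assert (Hp2 : 1 <= 2 ^ S d) by (apply pow_R1_Rle; lra).
    assert (HK1 : 0 <= K1) by (unfold K1; nra).
    assert (Hlow : forall c k, (k <= d)%nat -> Rabs (c k) <= K1 * L2norm (pol c (S d))).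
    { intros c k Hk.
      (* The factor of [c k] is at least 1 for [k <= d], so passing to [c'] loses nothing, and it
         vanishes for [k = d + 1]. *)
      set (c' := fun k => c k * (2 ^ S d / 2 ^ k - 1)).
      assert (Hc' : forall x, pol c' d x = 2 ^ S d * pol c (S d) (x / 2) + (-1) * pol c (S d) x).
      { intros x; rewrite !pol_S.
        replace (pol c' d x) with (2 ^ S d * pol c d (x / 2) + (-1) * pol c d x).
        - unfold Rdiv; rewrite (Rpow_mult_distr x), pow_inv; field; apply pow_nonzero; lra.
        - unfold pol; rewrite <- !sum_n_Rscal, <- sum_n_Rplus; apply (sum_n_ext (G := R_AbelianMonoid)); intros j.
          change (2 ^ S d * (c j * (x / 2) ^ j) + -1 * (c j * x ^ j) = c' j * x ^ j).
          unfold c', Rdiv; rewrite (Rpow_mult_distr x), pow_inv; ring. }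
      apply Rle_trans with (Rabs (c' k)).
      - unfold c'; rewrite Rabs_mult.
        assert (H2k : 0 < 2 ^ k) by (apply pow_lt; lra).
        assert (2 <= 2 ^ S d / 2 ^ k).
        { apply Rmult_le_reg_r with (2 ^ k); [easy|].
          unfold Rdiv; rewrite Rmult_assoc, Rinv_l, Rmult_1_r by lra.
          change (2 ^ S k <= 2 ^ S d); apply Rle_pow; [lra|lia]. }
        rewrite (Rabs_pos_eq (_ - 1)) by lra; generalize (Rabs_pos (c k)); intros; nra.
      - apply Rle_trans with (1 := IH c' k Hk); unfold K1.
        rewrite Rmult_assoc; apply Rmult_le_compat_l; [easy|].
        assert (Hpc : cont01 (pol c (S d))) by (apply cont01_continuous, continuous_pol).
        assert (Hph : forall x, continuous (fun x => pol c (S d) (x / 2)) x).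
        { intros x; apply (continuous_comp (fun x => x / 2) (pol c (S d))); [|apply continuous_pol].
          apply (ex_derive_continuous (fun x => x / 2)); auto_derive; easy. }
        assert (Hphc : cont01 (fun x => pol c (S d) (x / 2))) by now apply cont01_continuous.
        rewrite (L2norm_ext _ _ (fun x _ => Hc' x)).
        apply Rle_trans with (1 := L2norm_triang (fun x => 2 ^ S d * pol c (S d) (x / 2))
          (fun x => (-1) * pol c (S d) x)
          (continuous_on_mult 0 1 _ _ (continuous_on_const 0 1 _) Hphc)
          (continuous_on_mult 0 1 _ _ (continuous_on_const 0 1 _) Hpc)).
        rewrite !L2norm_scal by easy.
        rewrite (Rabs_left (-1)), (Rabs_pos_eq (2 ^ S d)) by lra.
        assert (Hh := L2norm_half (pol c (S d)) (continuous_pol c (S d))).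
        assert (2 ^ S d * L2norm (fun x => pol c (S d) (x / 2)) <= 2 ^ S d * (2 * L2norm (pol c (S d))))
          by (apply Rmult_le_compat_l; lra).
        lra. }
    (* The leading monomial is the polynomial minus its lower part, whose coefficients are bounded
       by now; dividing by the norm [m] of [x^(d+1)] bounds the last coefficient. *)
    set (m := L2norm (fun x => x ^ S d)).
    assert (Hpw : cont01 (fun x => x ^ S d)).
    { apply cont01_continuous; intros x; apply (ex_derive_continuous (fun x => x ^ S d)).
      auto_derive; easy. }
    assert (Hm : 0 < m).
    { unfold m, L2norm; apply sqrt_lt_R0; unfold inner.
      set (p := (2 * S d + 1)%nat).
      assert (HI : is_RInt (fun x => x ^ S d * x ^ S d) 0 1 (/ INR p * 1 ^ p - / INR p * 0 ^ p)).
      { apply (is_RInt_derive (V := R_CompleteNormedModule) (fun x => / INR p * x ^ p)).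
        - intros x _; evar_last; [apply is_derive_scal_pow|].
          replace (pred p) with (S d + S d)%nat by (unfold p; lia).
          rewrite pow_add, <- Rmult_assoc, Rinv_l, Rmult_1_l; [easy|].
          apply not_0_INR; unfold p; lia.
        - intros x _; apply (ex_derive_continuous (fun x => x ^ S d * x ^ S d)); auto_derive; easy. }
      rewrite (is_RInt_unique (V := R_CompleteNormedModule) _ _ _ _ HI).
      rewrite pow1, pow_i, Rmult_0_r, Rminus_0_r, Rmult_1_r by (unfold p; lia).
      apply Rinv_0_lt_compat, lt_0_INR; unfold p; lia. }
    exists (K1 + / m * (1 + INR (S d) * K1)).
    assert (Him : 0 < / m) by now apply Rinv_0_lt_compat.
    assert (HS : 0 <= INR (S d) * K1) by (apply Rmult_le_pos; [apply pos_INR|easy]).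
    split; [nra|]; intros c k Hk.
    assert (Hn := L2norm_nonneg (pol c (S d))).
    destruct (Nat.eq_dec k (S d)) as [->|Hne].
    2: { apply Rle_trans with (1 := Hlow c k ltac:(lia)).
         apply Rmult_le_compat_r; [easy|]; nra. }
    apply Rle_trans with (/ m * (1 + INR (S d) * K1) * L2norm (pol c (S d))); [|nra].
    apply Rmult_le_reg_l with m; [easy|].
    rewrite <- !Rmult_assoc, Rinv_r, Rmult_1_l, Rmult_comm by lra.
    unfold m; rewrite <- L2norm_scal by easy.
    rewrite (L2norm_ext _ (fun x => pol c (S d) x + (-1) * pol c d x))
      by (intros; rewrite pol_S; ring).
    assert (Hpc : forall j, cont01 (pol c j)) by (intros; apply cont01_continuous, continuous_pol).
    apply Rle_trans with (1 := L2norm_triang (pol c (S d)) (fun x => (-1) * pol c d x)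
      (Hpc (S d)) (continuous_on_mult 0 1 _ _ (continuous_on_const 0 1 _) (Hpc d))).
    rewrite L2norm_scal, (Rabs_left (-1)) by easy || lra.
    assert (L2norm (pol c d) <= INR (S d) * (K1 * L2norm (pol c (S d)))).
    { apply L2norm_le_sup; [easy|apply Rmult_le_pos; [apply pos_INR|nra]|].
      intros x Hx; apply sum_n_abs_le; intros j Hj.
      rewrite Rabs_mult, <- (Rmult_1_r (K1 * _)).
      apply Rmult_le_compat; [apply Rabs_pos|apply Rabs_pos|now apply Hlow|].
      rewrite <- RPow_abs, <- (pow1 j); apply pow_incr.
      rewrite Rabs_pos_eq; unfold Icc in Hx; lra. }
    lra.
Qed.

Lemma pol_inverse (d : nat) :
  exists K, 0 <= K /\ forall c x, Icc 0 1 x ->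
    pol c d x ^ 2 <= K * inner (pol c d) (pol c d) /\
    dpol c d x ^ 2 <= K * inner (pol c d) (pol c d).
Proof.
  destruct (pol_coef_le d) as [K [HK H]].
  set (M := INR (S d) * (K * INR (S d))).
  exists (M ^ 2); split; [apply pow2_ge_0|]; intros c x Hx.
  assert (Hpc : cont01 (pol c d)) by apply cont01_continuous, continuous_pol.
  assert (Hn := L2norm_nonneg (pol c d)).
  rewrite <- L2norm_sqr, <- Rpow_mult_distr by easy.
  assert (HS : 1 <= INR (S d)) by (rewrite S_INR; generalize (pos_INR d); lra).
  assert (Hxk : forall k, Rabs (x ^ k) <= 1).
  { intros k; rewrite <- RPow_abs, <- (pow1 k); apply pow_incr.
    rewrite Rabs_pos_eq; unfold Icc in Hx; lra. }
  assert (HKn : 0 <= K * L2norm (pol c d)) by now apply Rmult_le_pos.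
  unfold M; split; rewrite <- pow2_abs; apply pow_incr; split; try apply Rabs_pos;
    rewrite Rmult_assoc; apply sum_n_abs_le; intros k Hk; rewrite Rabs_mult;
    specialize (H c k Hk).
  - apply Rle_trans with (K * L2norm (pol c d) * 1).
    + apply Rmult_le_compat; [apply Rabs_pos|apply Rabs_pos|easy|apply Hxk].
    + nra.
  - apply Rle_trans with (K * L2norm (pol c d) * INR (S d)); [|right; ring].
    apply Rmult_le_compat; [apply Rabs_pos|apply Rabs_pos|easy|].
    rewrite Rabs_mult, (Rabs_pos_eq (INR k)) by apply pos_INR.
    assert (INR k <= INR (S d)) by (apply le_INR; lia).
    generalize (Hxk (pred k)) (pos_INR k) (Rabs_pos (x ^ pred k)); intros; nra.
Qed.

(** Rescaling to [[0,1]]: the integral contributes one power of [b - a], and the square of a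
    derivative two more, whence the exponents 1 and 3. *)
Lemma poly_on_inverse (d : nat) :
  exists K, 0 <= K /\ forall a b f x, a < b -> poly_on d a b f -> Icc a b x ->
    f x ^ 2 <= K / (b - a) * RInt (fun y => f y * f y) a b /\
    forall l, is_derive_on a b f x l ->
      l ^ 2 <= K / (b - a) ^ 3 * RInt (fun y => f y * f y) a b.
Proof.
  destruct (pol_inverse d) as [K [HK H]]; exists K; split; [easy|].
  intros a b f x Hab [c Hc] Hx.
  destruct (is_pol_affine d a (b - a) (pol c d)) as [c' Hc']; [now exists c|].
  set (s := (x - a) / (b - a)).
  assert (Hs : Icc 0 1 s).
  { unfold s, Icc in *; split.
    - apply Rdiv_le_0_compat; lra.
    - apply Rmult_le_reg_r with (b - a); [lra|].
      unfold Rdiv; rewrite Rmult_assoc, Rinv_l; lra. }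
  assert (Hf : forall y, Icc a b y -> f y = pol c' d ((y - a) / (b - a))).
  { intros y Hy; rewrite <- Hc'; replace (a + (b - a) * ((y - a) / (b - a))) with y by (field; lra).
    now apply Hc. }
  assert (HI : RInt (fun y => f y * f y) a b = (b - a) * inner (pol c' d) (pol c' d)).
  { rewrite (RInt_ext _ (fun y => pol c d y * pol c d y)).
    2: { intros y; rewrite Rmin_left, Rmax_right by lra; intros Hy.
         rewrite (Hc y) by (unfold Icc; lra); easy. }
    assert (HR := RInt_comp_lin (V := R_CompleteNormedModule) (fun y => pol c d y * pol c d y)
      (b - a) a 0 1).
    replace ((b - a) * 0 + a) with a in HR by ring.
    replace ((b - a) * 1 + a) with b in HR by ring.
    assert (Hcc : forall y, continuous (fun y => pol c d y * pol c d y) y).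
    { intros y; apply (continuous_mult (pol c d) (pol c d)); apply continuous_pol. }
    rewrite <- HR.
    - rewrite (RInt_scal (V := R_CompleteNormedModule)).
      + unfold scal; simpl; unfold mult; simpl; f_equal; apply RInt01_ext; intros y _.
        now rewrite Rplus_comm, Hc'.
      + apply (ex_RInt_continuous (V := R_CompleteNormedModule)); intros z _.
        apply (continuous_comp (fun y => (b - a) * y + a) (fun x => pol c d x * pol c d x));
          [|apply Hcc].
        apply (ex_derive_continuous (fun y => (b - a) * y + a)); auto_derive; easy.
    - apply (ex_RInt_continuous (V := R_CompleteNormedModule)); intros z _; apply Hcc. }
  destruct (H c' s Hs) as [H1 H2]; rewrite HI; split.
  - rewrite Hf by easy; fold s; apply Rle_trans with (1 := H1); right; field; lra.
  - intros l Hl.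
    assert (El : l = dpol c' d s * / (b - a)).
    { apply (is_derive_on_unique a b f x); [easy|easy|easy|].
      apply is_derive_on_eq with (fun y => pol c' d ((y - a) / (b - a))) (dpol c' d s * / (b - a));
        [easy|intros; now rewrite Hf|easy|].
      apply (is_derive_on_comp a b (fun y => (y - a) / (b - a)) (pol c' d)); [easy| |].
      - apply is_derive_on_is_derive; [easy|]; auto_derive; [easy|field; lra].
      - apply is_derive_pol. }
    rewrite El, Rpow_mult_distr.
    apply Rle_trans with (K * inner (pol c' d) (pol c' d) * (/ (b - a)) ^ 2).
    + apply Rmult_le_compat_r; [apply pow2_ge_0|easy].
    + right; field; lra.
Qed.

(** * Partitions and spline spaces *)

Lemma mesh_bounds (N : nat) (x : nat -> R) (j : nat) :
  (1 <= j <= N)%nat -> mesh_min N x <= x (j + 1)%nat - x j <= mesh_max N x.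
Proof.
  intros Hj.
  assert (Hin : In (x (j + 1)%nat - x j) (mesh_lengths N x)).
  { apply (in_map (fun j => x (j + 1)%nat - x j)), in_seq; lia. }
  split; [now apply MinRlist_P1|now apply MaxRlist_P1].
Qed.

Lemma partition_N_pos (N : nat) (x : nat -> R) : is_partition N x -> (1 <= N)%nat.
Proof.
  intros [H1 [H2 _]]; destruct N as [|N]; [|lia].
  simpl in H2; lra.
Qed.

Lemma partition_node_in (N : nat) (x : nat -> R) (j : nat) :
  is_partition N x -> (1 <= j <= N + 1)%nat -> Icc 0 1 (x j).
Proof.
  intros [H1 [H2 H3]] Hj; split.
  - destruct Hj as [Hj0 Hj1]; induction Hj0 as [|j Hj0 IH]; [lra|].
    assert (x j < x (j + 1)%nat) by (apply H3; lia).
    rewrite Nat.add_1_r in H; assert (0 <= x j) by (apply IH; lia); lra.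
  - replace j with (N + 1 - (N + 1 - j))%nat by lia.
    assert (Hk : (N + 1 - j <= N)%nat) by lia; revert Hk.
    generalize (N + 1 - j)%nat; induction n as [|k IH]; intros Hk.
    + rewrite Nat.sub_0_r; lra.
    + assert (x (N + 1 - S k)%nat < x (N + 1 - S k + 1)%nat) by (apply H3; lia).
      replace (N + 1 - S k + 1)%nat with (N + 1 - k)%nat in H by lia.
      assert (x (N + 1 - k)%nat <= 1) by (apply IH; lia); lra.
Qed.

Lemma partition_find (N : nat) (x : nat -> R) (y : R) :
  is_partition N x -> Icc 0 1 y ->
  exists j, (1 <= j <= N)%nat /\ Icc (x j) (x (j + 1)%nat) y.
Proof.
  intros HP Hy; assert (HN := partition_N_pos N x HP); destruct HP as [H1 [H2 H3]].
  assert (H : forall k, (k <= N)%nat -> y <= x (k + 1)%nat ->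
    exists j, (1 <= j <= N)%nat /\ Icc (x j) (x (j + 1)%nat) y).
  { induction k as [|k IH]; intros Hk Hyk.
    - exists 1%nat; split; [lia|]; simpl in Hyk.
      assert (x 1%nat < x (1 + 1)%nat) by (apply H3; lia).
      unfold Icc in *; lra.
    - destruct (Rle_lt_dec y (x (k + 1)%nat)) as [Hle|Hlt]; [apply IH; [lia|easy]|].
      exists (S k); split; [lia|]; rewrite Nat.add_1_r in Hlt; unfold Icc; lra. }
  apply (H N); [lia|]; rewrite H2; apply Hy.
Qed.

Lemma Ck_on_plus (a b : R) (k : nat) (f g : R -> R) :
  Ck_on a b k f -> Ck_on a b k g -> Ck_on a b k (fun x => f x + g x).
Proof.
  intros [D [HD0 [HD1 HD2]]] [E [HE0 [HE1 HE2]]].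
  exists (fun i x => D i x + E i x); split; [|split].
  - intros x Hx; now rewrite HD0, HE0.
  - intros i x Hi Hx; apply is_derive_on_plus; auto.
  - intros i Hi; apply continuous_on_plus; auto.
Qed.

Lemma Ck_on_scal (a b : R) (k : nat) (c : R) (f : R -> R) :
  Ck_on a b k f -> Ck_on a b k (fun x => c * f x).
Proof.
  intros [D [HD0 [HD1 HD2]]]; exists (fun i x => c * D i x); split; [|split].
  - intros x Hx; now rewrite HD0.
  - intros i x Hi Hx; apply is_derive_on_scal; auto.
  - intros i Hi; apply continuous_on_mult; [apply continuous_on_const|auto].
Qed.

Lemma poly_on_is_pol (d : nat) (a b : R) (f : R -> R) :
  poly_on d a b f <-> exists p, is_pol d p /\ forall x, Icc a b x -> f x = p x.
Proof.
  split.
  - intros [c Hc]; exists (pol c d); split; [now exists c|easy].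
  - intros [p [[c Hc] Hp]]; exists c; intros x Hx; rewrite Hp by easy; apply Hc.
Qed.

Lemma poly_on_plus (d : nat) (a b : R) (f g : R -> R) :
  poly_on d a b f -> poly_on d a b g -> poly_on d a b (fun x => f x + g x).
Proof.
  rewrite !poly_on_is_pol; intros [p [Hp Hf]] [q [Hq Hg]].
  exists (fun x => p x + q x); split; [now apply is_pol_plus|].
  intros x Hx; now rewrite Hf, Hg.
Qed.

Lemma poly_on_scal (d : nat) (a b c : R) (f : R -> R) :
  poly_on d a b f -> poly_on d a b (fun x => c * f x).
Proof.
  rewrite !poly_on_is_pol; intros [p [Hp Hf]].
  exists (fun x => c * p x); split; [now apply is_pol_scal|].
  intros x Hx; now rewrite Hf.
Qed.

Lemma spline_plus (r N : nat) (x : nat -> R) (f g : R -> R) :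
  spline r N x f -> spline r N x g -> spline r N x (fun y => f y + g y).
Proof.
  intros [Hf Hf'] [Hg Hg']; split; [now apply Ck_on_plus|].
  intros j Hj; apply poly_on_plus; auto.
Qed.

Lemma spline_scal (r N : nat) (x : nat -> R) (c : R) (f : R -> R) :
  spline r N x f -> spline r N x (fun y => c * f y).
Proof.
  intros [Hf Hf']; split; [now apply Ck_on_scal|].
  intros j Hj; apply poly_on_scal; auto.
Qed.

Lemma spline_zero (r N : nat) (x : nat -> R) : spline r N x (fun _ => 0).
Proof.
  split.
  - exists (fun _ _ => 0); split; [easy|split].
    + intros; now apply is_derive_on_const.
    + intros; apply continuous_on_const.
  - intros j _; apply poly_on_is_pol; exists (fun _ => 0); split; [apply is_pol_const_le|easy].
Qed.

Lemma spline_cont (r N : nat) (x : nat -> R) (f : R -> R) : spline r N x f -> cont01 f.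
Proof.
  intros [[D [H0 [_ H2]]] _]; apply continuous_on_eq with (D 0%nat); [easy|].
  apply H2; lia.
Qed.

Lemma spline_C1 (r N : nat) (x : nat -> R) (f : R -> R) :
  (3 <= r)%nat -> spline r N x f ->
  (forall y, Icc 0 1 y -> is_derive_on 0 1 f y (Derive_on 0 1 f y)) /\
  cont01 (Derive_on 0 1 f).
Proof.
  intros Hr [[D [H0 [H1 H2]]] _].
  assert (Hd : forall y, Icc 0 1 y -> is_derive_on 0 1 f y (D 1%nat y)).
  { intros y Hy; apply is_derive_on_eq with (D 0%nat) (D 1%nat y); [easy|easy|easy|].
    apply H1; [lia|easy]. }
  assert (He : forall y, Icc 0 1 y -> Derive_on 0 1 f y = D 1%nat y).
  { intros y Hy; apply Derive_on_eq; [lra|easy|now apply Hd]. }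
  split.
  - intros y Hy; rewrite He by easy; now apply Hd.
  - apply continuous_on_eq with (D 1%nat); [intros; now rewrite He|apply H2; lia].
Qed.

Lemma function_space_left (r N : nat) (x : nat -> R) : function_space (S_left r N x).
Proof.
  split.
  - intros f [Hf _]; now apply spline_cont with r N x.
  - split; [apply spline_zero|easy].
  - intros f g [Hf Hf0] [Hg Hg0]; split; [now apply spline_plus|lra].
  - intros c f [Hf Hf0]; split; [now apply spline_scal|rewrite Hf0; ring].
Qed.

Lemma function_space_right (r N : nat) (x : nat -> R) : function_space (S_right r N x).
Proof.
  split.
  - intros f [Hf _]; now apply spline_cont with r N x.
  - split; [apply spline_zero|easy].
  - intros f g [Hf Hf0] [Hg Hg0]; split; [now apply spline_plus|lra].
  - intros c f [Hf Hf0]; split; [now apply spline_scal|rewrite Hf0; ring].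
Qed.

Lemma RInt_sub_le (f : R -> R) (a b : R) :
  0 <= a -> a <= b -> b <= 1 -> cont01 f -> (forall x, Icc 0 1 x -> 0 <= f x) ->
  RInt f a b <= RInt f 0 1.
Proof.
  intros Ha Hab Hb Hf Hpos.
  assert (Hex : forall c d, 0 <= c -> c <= d -> d <= 1 -> ex_RInt f c d).
  { intros c d Hc Hcd Hd; apply ex_RInt_on; [easy|].
    intros y Hy; assert (Hy' : Icc 0 1 y) by (unfold Icc in *; lra).
    apply filterlim_locally; intros e.
    destruct (proj1 (filterlim_locally _ _) (Hf y Hy') e) as [de Hde].
    exists de; intros z Hz Hz'; apply Hde; [easy|unfold Icc in *; lra]. }
  assert (Hge : forall c d, 0 <= c -> c <= d -> d <= 1 -> 0 <= RInt f c d).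
  { intros c d Hc Hcd Hd; apply RInt_ge_0; [easy|now apply Hex|].
    intros y Hy; apply Hpos; unfold Icc; lra. }
  rewrite <- (RInt_Chasles (V := R_CompleteNormedModule) f 0 a 1) by (apply Hex; lra).
  rewrite <- (RInt_Chasles (V := R_CompleteNormedModule) f a b 1) by (apply Hex; lra).
  unfold plus; simpl.
  generalize (Hge 0 a ltac:(lra) Ha ltac:(lra)) (Hge b 1 ltac:(lra) Hb ltac:(lra)); lra.
Qed.

(** The polynomial estimate on the cell that contains [y], whose integral is at most the whole one.
    The length [hm] is any lower bound of the cells, and [K] depends on the degree alone. *)
Lemma spline_inverse (r : nat) : (3 <= r)%nat ->
  exists K, 0 <= K /\ forall N x hm f y,
    is_partition N x -> 0 < hm -> (forall j, (1 <= j <= N)%nat -> hm <= x (j + 1)%nat - x j) ->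
    spline r N x f -> Icc 0 1 y ->
    f y ^ 2 <= K / hm * inner f f /\ Derive_on 0 1 f y ^ 2 <= K / hm ^ 3 * inner f f.
Proof.
  intros Hr; destruct (poly_on_inverse (r - 1)) as [K [HK H]].
  exists K; split; [easy|]; intros N x hm f y HP Hhm Hh Hf Hy.
  destruct (partition_find N x y HP Hy) as [j [Hj Hyj]].
  assert (Hlen := Hh j Hj).
  assert (Hj0 := partition_node_in N x j HP ltac:(lia)).
  assert (Hj1 := partition_node_in N x (j + 1)%nat HP ltac:(lia)).
  assert (Hfc := spline_cont r N x f Hf).
  set (l := x (j + 1)%nat - x j) in *.
  assert (HI : RInt (fun y => f y * f y) (x j) (x (j + 1)%nat) <= inner f f).
  { apply RInt_sub_le; [apply Hj0|unfold l in Hlen; lra|apply Hj1|now apply continuous_on_mult|].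
    intros; nra. }
  assert (HI0 := inner_nonneg f Hfc).
  destruct (H (x j) (x (j + 1)%nat) f y ltac:(unfold l in Hlen; lra) (proj2 Hf j Hj) Hyj)
    as [H1 H2]; fold l in H1, H2.
  assert (Hdiv : forall a b, 0 < a -> a <= b -> 0 <= K / b <= K / a).
  { intros a b Ha Hab; split.
    - apply Rmult_le_pos; [easy|left; apply Rinv_0_lt_compat; lra].
    - apply Rmult_le_compat_l; [easy|apply Rinv_le_contravar; lra]. }
  assert (Hfin : forall a b s, 0 < a -> a <= b ->
    s <= K / b * RInt (fun y => f y * f y) (x j) (x (j + 1)%nat) -> s <= K / a * inner f f).
  { intros a b s Ha Hab Hs; apply Rle_trans with (1 := Hs); destruct (Hdiv a b Ha Hab) as [D1 D2].
    apply Rle_trans with (K / b * inner f f); [now apply Rmult_le_compat_l|].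
    now apply Rmult_le_compat_r. }
  split; [now apply Hfin with l|].
  apply Hfin with (l ^ 3); [now apply pow_lt|apply pow_incr; lra|].
  apply H2, is_derive_on_sub with 0 1; [apply Hj0|apply Hj1|easy|].
  now apply (spline_C1 r N x f).
Qed.

(** * Spline quasi-interpolation *)

(* The knots are continued to the right of 1 so that all splines below have full support
   on that side. *)
Record knots (N : nat) (h : R) (y : nat -> R) : Prop := {
  knots_0 : y 0%nat = 0;
  knots_N : y N = 1;
  knots_lt : forall j, y j < y (S j);
  knots_gap : forall j, (j < N)%nat -> y (S j) - y j <= h
}.

Lemma knots_le (N : nat) (h : R) (y : nat -> R) (i j : nat) :
  knots N h y -> (i <= j)%nat -> y i <= y j.
Proof.
  intros Hy Hij; induction Hij as [|j Hij IH]; [lra|].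
  generalize (knots_lt N h y Hy j); lra.
Qed.

Lemma knots_in (N : nat) (h : R) (y : nat -> R) (j : nat) :
  knots N h y -> (j <= N)%nat -> Icc 0 1 (y j).
Proof.
  intros Hy Hj; rewrite <- (knots_0 N h y Hy), <- (knots_N N h y Hy).
  split; apply (knots_le N h y); easy || lia.
Qed.

Lemma knots_find (N : nat) (h : R) (y : nat -> R) (x : R) :
  knots N h y -> Icc 0 1 x -> exists i, (i < N)%nat /\ Icc (y i) (y (S i)) x.
Proof.
  intros Hy Hx.
  assert (H : forall k, x <= y k -> (0 < k)%nat -> exists i, (i < k)%nat /\ Icc (y i) (y (S i)) x).
  { induction k as [|k IH]; intros Hk Hk0; [lia|].
    destruct (Nat.eq_dec k 0) as [->|Hne].
    - exists 0%nat; split; [lia|split; [rewrite (knots_0 N h y Hy); apply Hx|easy]].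
    - destruct (Rle_lt_dec x (y k)) as [Hle|Hlt].
      + destruct (IH Hle ltac:(lia)) as [i [Hi H]]; exists i; split; [lia|easy].
      + exists k; split; [lia|split; lra]. }
  apply H; [rewrite (knots_N N h y Hy); apply Hx|].
  destruct N as [|N]; [|lia].
  generalize (knots_0 _ _ _ Hy) (knots_N _ _ _ Hy); lra.
Qed.

(** * Splines on the whole line *)

Definition smooth (m : nat) (f : R -> R) : Prop :=
  exists D : nat -> R -> R,
    (forall x, D 0%nat x = f x) /\
    (forall i x, (i < m)%nat -> is_derive (D i) x (D (S i) x)) /\
    (forall i x, (i <= m)%nat -> continuous (D i) x).

Lemma smooth_cont (m : nat) (f : R -> R) (x : R) : smooth m f -> continuous f x.
Proof.
  intros [D [H0 [_ H2]]]; apply continuous_ext with (D 0%nat); [easy|].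
  apply H2; lia.
Qed.

Lemma smooth_plus (m : nat) (f g : R -> R) :
  smooth m f -> smooth m g -> smooth m (fun x => f x + g x).
Proof.
  intros [D [HD0 [HD1 HD2]]] [E [HE0 [HE1 HE2]]].
  exists (fun i x => D i x + E i x); split; [|split].
  - intros x; now rewrite HD0, HE0.
  - intros i x Hi; apply (is_derive_plus (D i) (E i)); auto.
  - intros i x Hi; apply (continuous_plus (D i) (E i)); auto.
Qed.

Lemma smooth_scal (m : nat) (c : R) (f : R -> R) : smooth m f -> smooth m (fun x => c * f x).
Proof.
  intros [D [HD0 [HD1 HD2]]]; exists (fun i x => c * D i x); split; [|split].
  - intros x; now rewrite HD0.
  - intros i x Hi; apply is_derive_scal; auto.
  - intros i x Hi; apply (continuous_mult (fun _ => c) (D i)); [apply continuous_const|auto].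
Qed.

Lemma smooth_const (m : nat) (c : R) : smooth m (fun _ => c).
Proof.
  exists (fun i _ => match i with O => c | S _ => 0 end); split; [easy|split].
  - intros [|i] x _; apply (is_derive_const (V := R_NormedModule)).
  - intros i x _; apply continuous_const.
Qed.

Lemma smooth_int (m : nat) (f : R -> R) : smooth m f -> smooth (S m) (fun x => RInt f 0 x).
Proof.
  intros Hf; assert (Hfc : forall x, continuous f x) by (intros; now apply smooth_cont with m).
  destruct Hf as [D [H0 [H1 H2]]].
  assert (HD : forall x, is_derive (fun x => RInt f 0 x) x (D 0%nat x)).
  { intros x; rewrite H0; now apply is_derive_RInt_cont. }
  exists (fun i => match i with O => fun x => RInt f 0 x | S j => D j end); split; [easy|split].
  - intros [|i] x Hi; [apply HD|apply H1; lia].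
  - intros [|i] x Hi; [|apply H2; lia].
    apply (ex_derive_continuous (fun x => RInt f 0 x)); eexists; apply HD.
Qed.

(** Indexing: the degree is [S k] and the smoothness [C^k]. *)
Definition gspline (y : nat -> R) (k : nat) (f : R -> R) : Prop :=
  smooth k f /\ forall j, poly_on (S k) (y j) (y (S j)) f.

Lemma gspline_plus (y : nat -> R) (k : nat) (f g : R -> R) :
  gspline y k f -> gspline y k g -> gspline y k (fun x => f x + g x).
Proof.
  intros [Hf Hf'] [Hg Hg']; split; [now apply smooth_plus|].
  intros j; now apply poly_on_plus.
Qed.

Lemma gspline_scal (y : nat -> R) (k : nat) (c : R) (f : R -> R) :
  gspline y k f -> gspline y k (fun x => c * f x).
Proof.
  intros [Hf Hf']; split; [now apply smooth_scal|].
  intros j; now apply poly_on_scal.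
Qed.

Lemma gspline_const (y : nat -> R) (k : nat) (c : R) : gspline y k (fun _ => c).
Proof.
  split; [apply smooth_const|].
  intros j; apply poly_on_is_pol; exists (fun _ => c); split; [apply is_pol_const_le|easy].
Qed.

Lemma gspline_cont (y : nat -> R) (k : nat) (f : R -> R) (x : R) :
  gspline y k f -> continuous f x.
Proof. intros [Hf _]; now apply smooth_cont with k. Qed.

Lemma is_pol_primitive (d : nat) (p : R -> R) :
  is_pol d p -> exists P, is_pol (S d) P /\ forall x, is_derive P x (p x).
Proof.
  intros [c Hc].
  set (C := fun k => match k with O => 0 | S j => c j / INR (S j) end).
  exists (pol C (S d)); split; [now exists C|].
  intros x; rewrite Hc; evar_last; [apply is_derive_pol|].
  unfold dpol, pol; clear Hc; induction d as [|d IH].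
  - rewrite sum_Sn, !sum_O; unfold plus, C; simpl; field.
  - rewrite sum_Sn, IH, sum_Sn; unfold plus; simpl plus; f_equal.
    unfold C; simpl pred; field; apply not_0_INR; lia.
Qed.

(** Integration raises degree and smoothness by one: on each cell the primitive differs by a
    constant from a polynomial primitive of the local polynomial. *)
Lemma gspline_int (N : nat) (h : R) (y : nat -> R) (k : nat) (f : R -> R) :
  knots N h y -> gspline y k f -> gspline y (S k) (fun x => RInt f 0 x).
Proof.
  intros Hy Hf; split; [now apply smooth_int, Hf|].
  assert (Hfc : forall x, continuous f x) by (intros; now apply gspline_cont with y k).
  intros j; apply poly_on_is_pol.
  destruct (proj1 (poly_on_is_pol _ _ _ _) (proj2 Hf j)) as [p [Hp Hfp]].
  destruct (is_pol_primitive _ _ Hp) as [P [HP HPd]].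
  exists (fun x => P x + (RInt f 0 (y j) - P (y j))); split.
  { apply is_pol_plus; [easy|apply is_pol_const_le]. }
  assert (Hlt := knots_lt N h y Hy j).
  intros x Hx.
  destruct (mvt_on (y j) (y (S j)) (fun x => RInt f 0 x - P x) (fun x => f x - p x) (y j) x)
    as [c [Hc [_ H]]].
  - intros z Hz; apply is_derive_on_minus; [easy| |].
    + apply is_derive_on_is_derive; [easy|now apply is_derive_RInt_cont].
    + now apply is_derive_on_is_derive.
  - unfold Icc; lra.
  - easy.
  - rewrite Hfp in H by easy; lra.
Qed.

(** Smooth steps, used as integrated bumps in place of B-splines. What matters is that the rise
    takes [w] cells, with [w] independent of the mesh. *)
Definition heaviside (y : nat -> R) (k w : nat) (H : nat -> R -> R) : Prop :=
  forall j, gspline y k (H j) /\ (forall x, 0 <= H j x <= 1) /\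
    (forall x, x <= y j -> H j x = 0) /\ (forall x, y (j + w)%nat <= x -> H j x = 1).

Definition ramp (y : nat -> R) (j : nat) (x : R) : R :=
  clamp 0 1 ((x - y j) / (y (S j) - y j)).

Lemma ramp_mid (N : nat) (h : R) (y : nat -> R) (j : nat) (x : R) :
  knots N h y -> Icc (y j) (y (S j)) x -> ramp y j x = (x - y j) / (y (S j) - y j).
Proof.
  intros Hy Hx; assert (Hlt := knots_lt N h y Hy j); unfold Icc in *.
  apply clamp_id; split.
  - apply Rdiv_le_0_compat; lra.
  - apply Rmult_le_reg_r with (y (S j) - y j); [lra|].
    unfold Rdiv; rewrite Rmult_assoc, Rinv_l; lra.
Qed.

Lemma heaviside_ramp (N : nat) (h : R) (y : nat -> R) :
  knots N h y -> heaviside y 0 1 (ramp y).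
Proof.
  intros Hy j; assert (Hlt := knots_lt N h y Hy j).
  assert (H0 : forall x, x <= y j -> ramp y j x = 0).
  { intros x Hx; unfold ramp, clamp.
    assert ((x - y j) / (y (S j) - y j) <= 0).
    { apply Rmult_le_reg_r with (y (S j) - y j); [lra|].
      unfold Rdiv; rewrite Rmult_assoc, Rinv_l; lra. }
    rewrite Rmin_right, Rmax_left; lra. }
  assert (H1 : forall x, y (j + 1)%nat <= x -> ramp y j x = 1).
  { intros x Hx; unfold ramp, clamp; rewrite Nat.add_1_r in Hx.
    assert (1 <= (x - y j) / (y (S j) - y j)).
    { apply Rmult_le_reg_r with (y (S j) - y j); [lra|].
      unfold Rdiv; rewrite Rmult_assoc, Rinv_l; lra. }
    rewrite Rmin_left, Rmax_right; lra. }
  split; [split|split; [|split; easy]].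
  - exists (fun _ => ramp y j); split; [easy|split; [lia|]].
    intros i x _; unfold ramp.
    apply (continuous_comp (fun x => (x - y j) / (y (S j) - y j)) (clamp 0 1)).
    + apply (ex_derive_continuous (fun x => (x - y j) / (y (S j) - y j))).
      auto_derive; lra.
    + apply continuous_clamp.
  - intros i; apply poly_on_is_pol.
    destruct (lt_eq_lt_dec i j) as [[Hij| ->]|Hij].
    + exists (fun _ => 0); split; [apply is_pol_const_le|].
      intros x Hx; apply H0; apply Rle_trans with (1 := proj2 Hx), (knots_le N h y); [easy|lia].
    + exists (fun x => - y j / (y (S j) - y j) + / (y (S j) - y j) * x); split.
      * apply is_pol_plus; [apply is_pol_const_le|].
        apply is_pol_scal, is_pol_ext with (fun x => x * 1); [intros; ring|].
        apply is_pol_mult_id, is_pol_const.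
      * intros x Hx; rewrite (ramp_mid N h) by easy; field; lra.
    + exists (fun _ => 1); split; [apply is_pol_const_le|].
      intros x Hx; apply H1; apply Rle_trans with (2 := proj1 Hx), (knots_le N h y); [easy|lia].
  - intros x; apply clamp_in; lra.
Qed.

Lemma primitive_mean (f : R -> R) (a b : R) : (forall x, continuous f x) ->
  exists c, Rmin a b <= c <= Rmax a b /\ RInt f 0 b - RInt f 0 a = f c * (b - a).
Proof.
  intros Hf; apply (MVT_gen (fun x => RInt f 0 x) a b f).
  - intros x _; now apply is_derive_RInt_cont.
  - intros x _; apply continuity_pt_filterlim.
    apply (ex_derive_continuous (fun x => RInt f 0 x)); exists (f x); now apply is_derive_RInt_cont.
Qed.

(* The next family is the normalised primitive of the bumps [H_j - H_(j+w)]. *)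
Lemma heaviside_exists (N : nat) (h : R) (y : nat -> R) (k : nat) :
  knots N h y -> exists H, heaviside y k (2 ^ k) H.
Proof.
  intros Hy; induction k as [|k [H HH]]; [exists (ramp y); now apply (heaviside_ramp N h)|].
  set (w := (2 ^ k)%nat) in *.
  assert (Hw : (0 < w)%nat) by (apply Nat.neq_0_lt_0, Nat.pow_nonzero; lia).
  set (M := fun j x => H j x + (-1) * H (j + w)%nat x).
  assert (HMg : forall j, gspline y k (M j)).
  { intros j; apply gspline_plus; [apply HH|apply gspline_scal, HH]. }
  assert (HMc : forall j x, continuous (M j) x) by (intros; now apply gspline_cont with y k).
  set (J := fun j x => RInt (M j) 0 x).
  (* The second step starts where the first one ends, so at each point at least one of them is
     constant; this is why the width doubles. *)
  assert (HM0 : forall j x, 0 <= M j x).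
  { intros j x; unfold M; destruct (HH j) as [_ [B1 [_ U1]]]; destruct (HH (j + w)%nat) as [_ [B2 [Z2 _]]].
    destruct (Rle_lt_dec x (y (j + w)%nat)) as [Hx|Hx].
    - rewrite (Z2 x Hx); generalize (B1 x); lra.
    - rewrite (U1 x) by lra; generalize (B2 x); lra. }
  assert (HMl : forall j x, x <= y j -> M j x = 0).
  { intros j x Hx; unfold M; destruct (HH j) as [_ [_ [Z1 _]]]; destruct (HH (j + w)%nat) as [_ [_ [Z2 _]]].
    rewrite (Z1 x Hx), Z2; [ring|].
    apply Rle_trans with (1 := Hx), (knots_le N h y); [easy|lia]. }
  assert (HMr : forall j x, y (j + w + w)%nat <= x -> M j x = 0).
  { intros j x Hx; unfold M; destruct (HH j) as [_ [_ [_ U1]]]; destruct (HH (j + w)%nat) as [_ [_ [_ U2]]].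
    rewrite (U2 x Hx), U1; [ring|].
    apply Rle_trans with (2 := Hx), (knots_le N h y); [easy|lia]. }
  assert (HJmono : forall j a b, a <= b -> J j a <= J j b).
  { intros j a b Hab; destruct (primitive_mean (M j) a b (HMc j)) as [c [_ Hc]].
    fold (J j a) (J j b) in Hc; generalize (HM0 j c); nra. }
  assert (Hy0 : forall j, 0 <= y j).
  { intros j; rewrite <- (knots_0 N h y Hy); apply (knots_le N h y); [easy|lia]. }
  assert (HJ0 : forall j, J j 0 = 0).
  { intros j; unfold J; rewrite RInt_point; easy. }
  assert (HJl : forall j x, x <= y j -> J j x = 0).
  { intros j x Hx; destruct (primitive_mean (M j) 0 x (HMc j)) as [c [Hc1 Hc]].
    fold (J j 0) (J j x) in Hc; rewrite HJ0, HMl in Hc; [lra|].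
    apply Rle_trans with (1 := proj2 Hc1); apply Rmax_lub; [apply Hy0|easy]. }
  assert (HJr : forall j x, y (j + w + w)%nat <= x -> J j x = J j (y (j + w + w)%nat)).
  { intros j x Hx; destruct (primitive_mean (M j) (y (j + w + w)%nat) x (HMc j)) as [c [Hc1 Hc]].
    rewrite Rmin_left in Hc1 by easy; fold (J j (y (j + w + w)%nat)) (J j x) in Hc.
    rewrite HMr in Hc by easy; lra. }
  assert (HJpos : forall j, 0 < J j (y (j + w + w)%nat)).
  { intros j; set (Y := y (j + w + w)%nat); set (m := y (j + w)%nat).
    assert (Hm : y j < m < Y).
    { assert (S1 := knots_lt N h y Hy j); assert (S2 := knots_lt N h y Hy (j + w)%nat); split.
      - apply Rlt_le_trans with (1 := S1), (knots_le N h y); [easy|lia].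
      - apply Rlt_le_trans with (1 := S2), (knots_le N h y); [easy|lia]. }
    assert (Hyj := Hy0 j).
    destruct (Rle_lt_dec (J j Y) 0) as [Hle|]; [exfalso|easy].
    assert (Hm1 : M j m = 1).
    { unfold M; destruct (HH j) as [_ [_ [_ U1]]]; destruct (HH (j + w)%nat) as [_ [_ [Z2 _]]].
      rewrite Z2, U1; [ring|apply Rle_refl|apply Rle_refl]. }
    (* If the bump had no mass, its monotone primitive would vanish on [[0,Y]], whereas its
       derivative at [m] is [M j m = 1]. *)
    assert (H10 : 1 = 0).
    { apply (is_derive_on_unique 0 Y (J j) m); [lra|unfold Icc; lra| |].
      - rewrite <- Hm1; apply is_derive_on_is_derive; [unfold Icc; lra|].
        now apply is_derive_RInt_cont.
      - apply is_derive_on_eq with (fun _ => 0) 0; [unfold Icc; lra| |easy|].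
        + intros z [Hz0 HzY]; assert (J j 0 <= J j z) by now apply HJmono.
          assert (J j z <= J j Y) by now apply HJmono.
          rewrite HJ0 in *; lra.
        + apply is_derive_on_const; unfold Icc; lra. }
    lra. }
  exists (fun j x => / J j (y (j + w + w)%nat) * J j x); intros j.
  assert (Hj := HJpos j).
  replace (2 ^ S k)%nat with (w + w)%nat by (unfold w; simpl; lia).
  rewrite Nat.add_assoc.
  split; [|split; [|split]].
  - apply gspline_scal, (gspline_int N h); [easy|apply HMg].
  - intros x; assert (0 < / J j (y (j + w + w)%nat)) by now apply Rinv_0_lt_compat.
    assert (Hx : 0 <= J j x <= J j (y (j + w + w)%nat)).
    { split.
      - destruct (Rle_lt_dec x 0) as [Hx|Hx].
        + rewrite HJl; [lra|]; generalize (Hy0 j); lra.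
        + rewrite <- (HJ0 j); apply HJmono; lra.
      - destruct (Rle_lt_dec x (y (j + w + w)%nat)) as [Hx|Hx]; [now apply HJmono|].
        rewrite (HJr j x); lra. }
    split; [nra|].
    rewrite <- (Rinv_l (J j (y (j + w + w)%nat))) by lra; apply Rmult_le_compat_l; lra.
  - intros x Hx; rewrite (HJl j x Hx); ring.
  - intros x Hx; rewrite (HJr j x Hx); field; lra.
Qed.

(** A local spline operator after Abel summation: each increment of [g] between knots is switched on
    by a smooth step. The factor 1 is the constant spline, kept visible so that the value is a
    combination of splines with point values as coefficients. *)
Definition quasi (N : nat) (y : nat -> R) (H : nat -> R -> R) (g : R -> R) (x : R) : R :=
  g 0 * 1 + vsum N (fun j => (g (y (S j)) - g (y j)) * H j x).

(** Steps that start to the right of the cell vanish at [x]; the increments up to the cell telescope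
    to [g (y (S i))], corrected by the part of each step that is still missing. *)
Lemma quasi_local (N : nat) (h : R) (y : nat -> R) (k w : nat) (H : nat -> R -> R)
    (g : R -> R) (x : R) (i : nat) :
  knots N h y -> heaviside y k w H -> (i < N)%nat -> Icc (y i) (y (S i)) x ->
  quasi N y H g x = g (y (S i)) - vsum (S i) (fun j => (g (y (S j)) - g (y j)) * (1 - H j x)).
Proof.
  intros Hy HH Hi Hx; unfold quasi.
  replace N with (S i + (N - S i))%nat by lia.
  rewrite vsum_split, (vsum_zero (N - S i)).
  - assert (Ht := vsum_telescope (S i) (fun j => g (y j))); cbv beta in Ht; rewrite (knots_0 N h y Hy) in Ht.
    replace (vsum (S i) (fun j => (g (y (S j)) - g (y j)) * (1 - H j x)))
      with (vsum (S i) (fun j => g (y (S j)) - g (y j))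
        - vsum (S i) (fun j => (g (y (S j)) - g (y j)) * H j x)).
    + rewrite Ht; ring.
    + rewrite <- vsum_minus; apply vsum_ext; intros; ring.
  - intros j Hj; destruct (HH (S i + j)%nat) as [_ [_ [Z _]]]; rewrite Z; [ring|].
    apply Rle_trans with (1 := proj2 Hx), (knots_le N h y); [easy|lia].
Qed.

(** Only the last [w] steps before [x] can be incomplete, each contributing at most [L h] whatever
    the ratios of the cells; replacing [g x] by [g (y (S i))] costs another [L h], hence [S w]. *)
Lemma quasi_error (N : nat) (h : R) (y : nat -> R) (k w : nat) (H : nat -> R -> R)
    (g : R -> R) (L x : R) :
  knots N h y -> heaviside y k w H -> (0 < w)%nat -> 0 <= L ->
  (forall a b, Icc 0 1 a -> Icc 0 1 b -> Rabs (g b - g a) <= L * Rabs (b - a)) ->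
  Icc 0 1 x -> Rabs (g x - quasi N y H g x) <= INR (S w) * (L * h).
Proof.
  intros Hy HH Hw HL Hg Hx; destruct (knots_find N h y x Hy Hx) as [i [Hi Hxi]].
  rewrite (quasi_local N h y k w H g x i) by easy.
  assert (Hgap := knots_gap N h y Hy); assert (Hlt := knots_lt N h y Hy).
  assert (Hh : 0 <= h) by (generalize (Hgap i Hi) (Hlt i); lra).
  assert (HLh : 0 <= L * h) by now apply Rmult_le_pos.
  assert (Hd : forall j, (j < N)%nat -> Rabs (g (y (S j)) - g (y j)) <= L * h).
  { intros j Hj; apply Rle_trans with (1 := Hg (y j) (y (S j)) (knots_in N h y j Hy ltac:(lia))
      (knots_in N h y (S j) Hy ltac:(lia))).
    apply Rmult_le_compat_l; [easy|].
    rewrite Rabs_pos_eq; [now apply Hgap|generalize (Hlt j); lra]. }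
  set (f := fun j => (g (y (S j)) - g (y j)) * (1 - H j x)).
  assert (Hf : forall j, (j < S i)%nat -> Rabs (f j) <= L * h).
  { intros j Hj; unfold f; rewrite Rabs_mult, <- (Rmult_1_r (L * h)).
    apply Rmult_le_compat; [apply Rabs_pos|apply Rabs_pos|apply Hd; lia|].
    destruct (HH j) as [_ [B _]]; specialize (B x); apply Rabs_le; lra. }
  assert (Hf0 : forall j, (j + w <= i)%nat -> f j = 0).
  { intros j Hj; unfold f; destruct (HH j) as [_ [_ [_ U]]]; rewrite U; [ring|].
    apply Rle_trans with (2 := proj1 Hxi), (knots_le N h y); easy. }
  assert (Hsum : Rabs (vsum (S i) f) <= INR w * (L * h)).
  { assert (Hcount : forall a n, (a + n <= S i)%nat ->
      Rabs (vsum n (fun j => f (a + j)%nat)) <= INR n * (L * h)).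
    { intros a n Han; apply Rle_trans with (1 := vsum_abs _ _).
      rewrite <- vsum_const; apply vsum_le; intros j Hj; apply Hf; lia. }
    destruct (le_lt_dec (S i) w) as [Hle|Hgt].
    - apply Rle_trans with (1 := Hcount 0%nat (S i) ltac:(lia)).
      apply Rmult_le_compat_r; [easy|now apply le_INR].
    - replace (S i) with ((S i - w) + w)%nat by lia.
      rewrite vsum_split, (vsum_zero (S i - w)), Rplus_0_l; [apply Hcount; lia|].
      intros j Hj; apply Hf0; lia. }
  assert (H1 : Rabs (g x - g (y (S i))) <= L * h).
  { apply Rle_trans with (1 := Hg (y (S i)) x (knots_in N h y (S i) Hy ltac:(lia)) Hx).
    apply Rmult_le_compat_l; [easy|].
    rewrite Rabs_minus_sym, Rabs_pos_eq; generalize (Hgap i Hi); unfold Icc in Hxi; lra. }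
  rewrite S_INR, Rmult_plus_distr_r, Rmult_1_l.
  replace (g x - (g (y (S i)) - vsum (S i) f)) with ((g x - g (y (S i))) + vsum (S i) f) by ring.
  apply Rle_trans with (1 := Rabs_triang _ _); lra.
Qed.

(** * Approximation operators acting on a function together with its derivatives *)

Definition tower (m : nat) (D : nat -> R -> R) : Prop :=
  forall i x, (i < m)%nat -> Icc 0 1 x -> is_derive_on 0 1 (D i) x (D (S i) x).

(** With ramps the operator is piecewise linear interpolation. The error in a cell is
    [(D 1 c' - D 1 c) (x - y i)] for two mean value points of that cell, and the second derivative
    bounds the first factor by [M h]. *)
Lemma ramp_error (N : nat) (h : R) (y : nat -> R) (D : nat -> R -> R) (M x : R) :
  knots N h y -> tower 2 D -> (forall z, Icc 0 1 z -> Rabs (D 2%nat z) <= M) ->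
  Icc 0 1 x -> Rabs (D 0%nat x - quasi N y (ramp y) (D 0%nat) x) <= M * h ^ 2.
Proof.
  intros Hy HD HM Hx; destruct (knots_find N h y x Hy Hx) as [i [Hi Hxi]].
  rewrite (quasi_local N h y 0 1 (ramp y) (D 0%nat) x i) by
    (easy || now apply (heaviside_ramp N h)).
  assert (Hgap := knots_gap N h y Hy i Hi); assert (Hlt := knots_lt N h y Hy i).
  cbn [vsum]; rewrite vsum_zero.
  2: { intros j Hj; destruct (heaviside_ramp N h y Hy j) as [_ [_ [_ U]]]; rewrite U; [ring|].
       apply Rle_trans with (2 := proj1 Hxi), (knots_le N h y); [easy|lia]. }
  rewrite (ramp_mid N h) by easy.
  assert (Hi0 := knots_in N h y i Hy ltac:(lia)); assert (Hi1 := knots_in N h y (S i) Hy ltac:(lia)).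
  destruct (mvt_on 0 1 (D 0%nat) (D 1%nat) (y i) (y (S i))) as [c [Hc [Hc1 E1]]];
    [intros; apply HD; easy || lia|easy|easy|].
  destruct (mvt_on 0 1 (D 0%nat) (D 1%nat) (y i) x) as [c' [Hc' [Hc1' E2]]];
    [intros; apply HD; easy || lia|easy|easy|].
  rewrite Rmin_left, Rmax_right in Hc1 by lra.
  rewrite Rmin_left, Rmax_right in Hc1' by apply Hxi.
  match goal with |- Rabs ?e <= _ => replace e with ((D 1%nat c' - D 1%nat c) * (x - y i)) end.
  2: { replace (D 0%nat x) with (D 0%nat (y i) + D 1%nat c' * (x - y i)) by lra.
       replace (D 0%nat (y (S i))) with (D 0%nat (y i) + D 1%nat c * (y (S i) - y i)) by lra.
       field; lra. }
  assert (HL := lipschitz_on 0 1 M (D 1%nat) (D 2%nat) c c'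
    (fun z Hz => HD 1%nat z ltac:(lia) Hz) HM Hc Hc').
  unfold Icc in Hxi.
  assert (Hcc : Rabs (c' - c) <= h) by (apply Rabs_le; lra).
  assert (HM0 : 0 <= M) by (apply Rle_trans with (2 := HM x Hx); apply Rabs_pos).
  rewrite Rabs_mult, (Rabs_pos_eq (x - y i)) by lra.
  replace (M * h ^ 2) with (M * h * h) by ring.
  apply Rmult_le_compat; [apply Rabs_pos|lra| |lra].
  apply Rle_trans with (1 := HL); now apply Rmult_le_compat_l.
Qed.

(** Finite combinations of fixed functions with values of [D i], [i <= K], at points of
    [[0,1]] as coefficients; such operators commute with differentiation in time. *)
Inductive point_op (P : (R -> R) -> Prop) (K : nat) : ((nat -> R -> R) -> R -> R) -> Prop :=
| point_op_val (l : nat) (p : R) (Phi : R -> R) :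
    (l <= K)%nat -> Icc 0 1 p -> P Phi -> point_op P K (fun D x => D l p * Phi x)
| point_op_plus (Q Q' : (nat -> R -> R) -> R -> R) :
    point_op P K Q -> point_op P K Q' -> point_op P K (fun D x => Q D x + Q' D x)
| point_op_ext (Q Q' : (nat -> R -> R) -> R -> R) :
    (forall D x, Q D x = Q' D x) -> point_op P K Q -> point_op P K Q'.

Definition shift (D : nat -> R -> R) (i : nat) : R -> R := D (S i).

Lemma point_op_range (P : (R -> R) -> Prop) (K : nat) Q :
  (forall f g, P f -> P g -> P (fun x => f x + g x)) ->
  (forall c f, P f -> P (fun x => c * f x)) ->
  (forall f g, (forall x, f x = g x) -> P f -> P g) ->
  point_op P K Q -> forall D, P (Q D).
Proof.
  intros H1 H2 H3 HQ D; induction HQ as [l p Phi _ _ HP|Q Q' _ IH _ IH'|Q Q' He _ IH].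
  - now apply H2.
  - now apply H1.
  - now apply H3 with (Q D).
Qed.

Lemma point_op_impl (P P' : (R -> R) -> Prop) (K K' : nat) Q :
  (K <= K')%nat -> (forall f, P f -> P' f) -> point_op P K Q -> point_op P' K' Q.
Proof.
  intros HK HP HQ; induction HQ as [l p Phi Hl Hp H|Q Q' _ IH _ IH'|Q Q' He _ IH].
  - apply point_op_val; [lia|easy|now apply HP].
  - now apply point_op_plus.
  - now apply point_op_ext with Q.
Qed.

(** Allows an operator to be evaluated at a point inside another one, as when [quasi] is applied to
    an approximation error or when a boundary value is subtracted. *)
Lemma point_op_scal_eval (P P' : (R -> R) -> Prop) (K : nat) Q (c : R) (Psi : R -> R) :
  (forall a f, P' f -> P' (fun x => a * f x)) -> P' Psi -> point_op P K Q ->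
  point_op P' K (fun D x => Q D c * Psi x).
Proof.
  intros HP' HPsi HQ; induction HQ as [l p Phi Hl Hp H|Q Q' _ IH _ IH'|Q Q' He _ IH].
  - apply point_op_ext with (fun D x => D l p * (Phi c * Psi x)); [intros; ring|].
    apply (point_op_val P' K l p (fun x => Phi c * Psi x)); [easy|easy|now apply HP'].
  - apply point_op_ext with (fun D x => Q D c * Psi x + Q' D c * Psi x); [intros; ring|].
    now apply point_op_plus.
  - apply point_op_ext with (fun D x => Q D c * Psi x); [intros; now rewrite He|easy].
Qed.

Lemma point_op_vsum (P : (R -> R) -> Prop) (K n : nat) (Q : nat -> (nat -> R -> R) -> R -> R) :
  P (fun _ => 0) -> (forall j, (j < n)%nat -> point_op P K (Q j)) ->
  point_op P K (fun D x => vsum n (fun j => Q j D x)).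
Proof.
  intros HP; induction n as [|n IH]; intros HQ; simpl.
  - apply point_op_ext with (fun D x => D 0%nat 0 * 0); [intros; ring|].
    apply (point_op_val P K 0 0 (fun _ => 0)); [lia|unfold Icc; lra|easy].
  - apply (point_op_plus P K (fun D x => vsum n (fun j => Q j D x)) (Q n)).
    + apply IH; intros; apply HQ; lia.
    + apply HQ; lia.
Qed.

Lemma gspline_point_op (y : nat -> R) (k K : nat) Q (D : nat -> R -> R) :
  point_op (gspline y k) K Q -> gspline y k (Q D).
Proof.
  intros HQ; apply point_op_range with K; [| | |easy].
  - intros; now apply gspline_plus.
  - intros; now apply gspline_scal.
  - intros f g Hfg [[E [H0 H1]] Hp]; split.
    + exists E; split; [intros; now rewrite H0|easy].
    + intros j; destruct (Hp j) as [c Hc]; exists c; intros; rewrite <- Hfg; now apply Hc.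
Qed.

(** The operator is applied to the tower of the derivative, so after integration it evaluates
    derivatives of one order more. *)
Lemma point_op_int (N : nat) (h : R) (y : nat -> R) (k K : nat) Q :
  knots N h y -> point_op (gspline y k) K Q ->
  point_op (gspline y (S k)) (S K) (fun D x => RInt (Q (shift D)) 0 x).
Proof.
  intros Hy HQ; induction HQ as [l p Phi Hl Hp H|Q Q' H IH H' IH'|Q Q' He _ IH].
  - apply point_op_ext with (fun D x => D (S l) p * RInt Phi 0 x).
    + intros D x; symmetry; apply (RInt_scal (V := R_CompleteNormedModule) Phi).
      apply (ex_RInt_continuous (V := R_CompleteNormedModule)); intros.
      now apply gspline_cont with y k.
    + apply (point_op_val _ _ (S l) p (fun x => RInt Phi 0 x)); [lia|easy|].
      now apply (gspline_int N h).
  - apply point_op_ext with (fun D x => RInt (Q (shift D)) 0 x + RInt (Q' (shift D)) 0 x).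
    + intros D x; symmetry.
      apply (RInt_plus (V := R_CompleteNormedModule) (Q (shift D)) (Q' (shift D)));
        apply (ex_RInt_continuous (V := R_CompleteNormedModule)); intros;
        apply gspline_cont with y k; now apply gspline_point_op with K.
    + now apply point_op_plus.
  - apply point_op_ext with (fun D x => RInt (Q (shift D)) 0 x); [|easy].
    intros D x; apply RInt_ext; intros; apply He.
Qed.

Lemma point_op_quasi (N : nat) (h : R) (y : nat -> R) (k K w : nat) (H : nat -> R -> R)
    (E : (nat -> R -> R) -> R -> R) :
  knots N h y -> heaviside y k w H ->
  (forall c Psi, Icc 0 1 c -> gspline y k Psi -> point_op (gspline y k) K (fun D x => E D c * Psi x)) ->
  point_op (gspline y k) K (fun D x => quasi N y H (E D) x).
Proof.
  intros Hy HH HE; unfold quasi.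
  apply (point_op_plus _ _ (fun D x => E D 0 * 1)
    (fun D x => vsum N (fun j => (E D (y (S j)) - E D (y j)) * H j x))).
  - apply (HE 0 (fun _ => 1)); [unfold Icc; lra|apply gspline_const].
  - apply (point_op_vsum _ _ _ (fun j D x => (E D (y (S j)) - E D (y j)) * H j x)).
    + apply gspline_const.
    + intros j Hj.
      apply point_op_ext with (fun D x => E D (y (S j)) * H j x + E D (y j) * ((-1) * H j x));
        [intros; ring|].
      apply (point_op_plus _ _ (fun D x => E D (y (S j)) * H j x) (fun D x => E D (y j) * ((-1) * H j x))).
      * apply HE; [apply (knots_in N h); easy || lia|apply HH].
      * apply (HE (y j) (fun x => (-1) * H j x)); [apply (knots_in N h); easy || lia|].
        apply gspline_scal, HH.
Qed.

(* Integrating an approximation of [g'] leaves an error [g - S] with a small derivative,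
   which the first-order operator [quasi] turns into a gain of one power of [h]. *)
Lemma quasi_interpolant (k : nat) :
  exists C, 0 <= C /\ forall N h y, knots N h y ->
    exists Q, point_op (gspline y k) k Q /\
      forall D M x, tower (k + 2) D -> (forall z, Icc 0 1 z -> Rabs (D (k + 2)%nat z) <= M) ->
        Icc 0 1 x -> Rabs (D 0%nat x - Q D x) <= C * M * h ^ (k + 2).
Proof.
  induction k as [|k [C [HC IH]]].
  - exists 1; split; [lra|]; intros N h y Hy.
    exists (fun D x => quasi N y (ramp y) (D 0%nat) x); split.
    + apply (point_op_quasi N h y 0 0 1); [easy|now apply (heaviside_ramp N h)|].
      intros c Psi Hc HPsi; now apply (point_op_val _ _ 0 c Psi).
    + intros D M x HD HM Hx; rewrite Rmult_1_l; now apply ramp_error.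
  - set (w := (2 ^ S k)%nat).
    assert (Hw : (0 < w)%nat) by (apply Nat.neq_0_lt_0, Nat.pow_nonzero; lia).
    exists (INR (S w) * C); split; [apply Rmult_le_pos; [apply pos_INR|easy]|].
    intros N h y Hy; destruct (IH N h y Hy) as [Q [HQ HQe]].
    destruct (heaviside_exists N h y (S k) Hy) as [H HH]; fold w in HH.
    set (S0 := fun (D : nat -> R -> R) x => D 0%nat 0 * 1 + RInt (Q (shift D)) 0 x).
    assert (HS0 : point_op (gspline y (S k)) (S k) S0).
    { apply point_op_plus.
      - apply (point_op_val _ _ 0 0 (fun _ => 1)); [lia|unfold Icc; lra|apply gspline_const].
      - now apply (point_op_int N h). }
    exists (fun D x => S0 D x + quasi N y H (fun z => D 0%nat z - S0 D z) x); split.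
    + apply point_op_plus; [easy|].
      apply (point_op_quasi N h y (S k) (S k) w H (fun D z => D 0%nat z - S0 D z)); [easy|easy|].
      intros c Psi Hc HPsi.
      apply point_op_ext with (fun D x => D 0%nat c * Psi x + S0 D c * ((-1) * Psi x)); [intros; ring|].
      apply point_op_plus; [apply point_op_val; easy || lia|].
      apply (point_op_scal_eval (gspline y (S k))); [intros; now apply gspline_scal| |easy].
      now apply gspline_scal.
    + intros D M x HD HM Hx.
      assert (HsD : tower (k + 2) (shift D)) by (intros i z Hi Hz; apply HD; [lia|easy]).
      assert (HsM : forall z, Icc 0 1 z -> Rabs (shift D (k + 2)%nat z) <= M) by (intros; now apply HM).
      assert (Hder : forall z, Icc 0 1 z -> Rabs (D 1%nat z - Q (shift D) z) <= C * M * h ^ (k + 2)).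
      { intros z Hz; now apply (HQe (shift D) M z). }
      set (g := fun z => D 0%nat z - S0 D z).
      assert (HM0 : 0 <= C * M * h ^ (k + 2)).
      { apply Rle_trans with (2 := Hder x Hx); apply Rabs_pos. }
      replace (D 0%nat x - (S0 D x + quasi N y H g x)) with (g x - quasi N y H g x)
        by (unfold g; ring).
      replace (INR (S w) * C * M * h ^ (S k + 2)) with (INR (S w) * (C * M * h ^ (k + 2) * h))
        by (simpl; ring).
      apply (quasi_error N h y (S k) w); [easy|easy|easy|easy| |easy].
      intros a b Ha Hb.
      apply (lipschitz_on 0 1 _ g (fun z => D 1%nat z - (0 + Q (shift D) z))); [| |easy|easy].
      * intros z Hz; apply is_derive_on_minus; [easy|apply HD; [lia|easy]|].
        apply is_derive_on_plus; [easy|now apply is_derive_on_const|].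
        apply is_derive_on_is_derive; [easy|]; apply is_derive_RInt_cont; intros s.
        apply gspline_cont with y k; now apply gspline_point_op with k.
      * intros z Hz; rewrite Rplus_0_l; now apply Hder.
Qed.

(** The nodes [x 1, ..., x (N+1)] become the knots with indices [0, ..., N]. For smoothness index
    [k = r - 2] the degree [S k] is [r - 1]. *)
Lemma gspline_spline (r N : nat) (x : nat -> R) (f : R -> R) :
  (3 <= r)%nat -> is_partition N x ->
  gspline (fun j => if le_lt_dec j N then x (S j) else 1 + INR (j - N)) (r - 2) f ->
  spline r N x f.
Proof.
  intros Hr HP [[D [H0 [H1 H2]]] Hp]; split.
  - exists D; split; [easy|split].
    + intros i z Hi Hz; apply is_derive_on_is_derive; auto.
    + intros i Hi; apply continuous_on_continuous; auto.
  - intros j Hj; specialize (Hp (j - 1)%nat); cbv beta in Hp.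
    destruct (le_lt_dec (j - 1) N) as [_|]; [|lia].
    destruct (le_lt_dec (S (j - 1)) N) as [_|]; [|lia].
    replace (S (r - 2)) with (r - 1)%nat in Hp by lia.
    replace (S (j - 1)) with j in Hp by lia.
    now rewrite Nat.add_1_r.
Qed.

Lemma partition_knots (N : nat) (x : nat -> R) :
  is_partition N x ->
  knots N (mesh_max N x) (fun j => if le_lt_dec j N then x (S j) else 1 + INR (j - N)).
Proof.
  intros HP; assert (HN := partition_N_pos N x HP); destruct HP as [H1 [H2 H3]]; split.
  - now destruct (le_lt_dec 0 N); [|lia].
  - destruct (le_lt_dec N N); [|lia]; now rewrite <- Nat.add_1_r.
  - intros j; destruct (le_lt_dec j N) as [Hj|Hj]; destruct (le_lt_dec (S j) N) as [Hj'|Hj'].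
    + replace (S (S j)) with (S j + 1)%nat by lia; apply H3; lia.
    + replace j with N by lia; rewrite Nat.add_1_r in H2; rewrite H2.
      replace (S N - N)%nat with 1%nat by lia; simpl; lra.
    + lia.
    + replace (S j - N)%nat with (S (j - N)) by lia; rewrite S_INR; lra.
  - intros j Hj; destruct (le_lt_dec j N); [|lia]; destruct (le_lt_dec (S j) N); [|lia].
    assert (H := mesh_bounds N x (S j) ltac:(lia)); rewrite Nat.add_1_r in H; lra.
Qed.

(** [QL] integrates from 0 the quasi-interpolant with [k = r - 3] of the derivative, a spline of
    degree [r - 2] with error [O(h^(k+2)) = O(h^(r-1))]; [QR] subtracts the value at 1. The zero at
    one end is thus automatic, and no bound below on the cells enters. *)
Lemma spline_approx (r : nat) : (3 <= r)%nat ->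
  exists C, 0 <= C /\ forall N x, is_partition N x ->
    exists QL QR,
      point_op (spline r N x) r QL /\ point_op (spline r N x) r QR /\
      (forall D, S_left r N x (QL D)) /\ (forall D, S_right r N x (QR D)) /\
      forall D M z, tower r D -> (forall z, Icc 0 1 z -> Rabs (D r z) <= M) -> Icc 0 1 z ->
        Rabs (D 1%nat z - Derive_on 0 1 (QL D) z) <= C * M * mesh_max N x ^ (r - 1) /\
        Rabs (D 1%nat z - Derive_on 0 1 (QR D) z) <= C * M * mesh_max N x ^ (r - 1) /\
        (D 0%nat 0 = 0 -> Rabs (D 0%nat z - QL D z) <= C * M * mesh_max N x ^ (r - 1)) /\
        (D 0%nat 1 = 0 -> Rabs (D 0%nat z - QR D z) <= C * M * mesh_max N x ^ (r - 1)).
Proof.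
  intros Hr; destruct (quasi_interpolant (r - 3)) as [C [HC H]]; exists C; split; [easy|].
  intros N x HP; set (h := mesh_max N x).
  assert (Hy := partition_knots N x HP); fold h in Hy.
  set (y := fun j => if le_lt_dec j N then x (S j) else 1 + INR (j - N)) in *.
  destruct (H N h y Hy) as [Q [HQ HQe]].
  assert (HI := point_op_int N h y (r - 3) (r - 3) Q Hy HQ).
  set (QL := fun D x => RInt (Q (shift D)) 0 x) in HI.
  set (QR := fun D x => QL D x + QL D 1 * (-1)).
  assert (HR : point_op (gspline y (S (r - 3))) (S (r - 3)) QR).
  { apply point_op_plus; [easy|].
    apply (point_op_scal_eval (gspline y (S (r - 3)))); [intros; now apply gspline_scal| |easy].
    apply gspline_const. }
  replace (S (r - 3)) with (r - 2)%nat in HI, HR by lia.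
  assert (Hsp : forall f, gspline y (r - 2) f -> spline r N x f).
  { intros f; now apply (gspline_spline r N x). }
  assert (HQLd : forall D z, is_derive (QL D) z (Q (shift D) z)).
  { intros D z; apply is_derive_RInt_cont; intros s.
    apply gspline_cont with y (r - 3)%nat; now apply gspline_point_op with (r - 3)%nat. }
  assert (HQRd : forall D z, is_derive (QR D) z (Q (shift D) z)).
  { intros D z; evar_last; [apply (is_derive_plus (QL D) (fun _ => QL D 1 * -1));
      [apply HQLd|apply (is_derive_const (V := R_NormedModule))]|].
    unfold plus, zero; simpl; ring. }
  assert (HDL : forall D z, Icc 0 1 z -> Derive_on 0 1 (QL D) z = Q (shift D) z).
  { intros D z Hz; apply Derive_on_eq; [lra|easy|now apply is_derive_on_is_derive]. }
  assert (HDR : forall D z, Icc 0 1 z -> Derive_on 0 1 (QR D) z = Q (shift D) z).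
  { intros D z Hz; apply Derive_on_eq; [lra|easy|now apply is_derive_on_is_derive]. }
  assert (HL0 : forall D, QL D 0 = 0).
  { intros D; unfold QL; rewrite RInt_point; easy. }
  exists QL, QR; split; [|split; [|split; [|split]]].
  - apply point_op_impl with (gspline y (r - 2)) (r - 2)%nat; [lia|easy|easy].
  - apply point_op_impl with (gspline y (r - 2)) (r - 2)%nat; [lia|easy|easy].
  - intros D; split; [|apply HL0].
    apply Hsp; now apply gspline_point_op with (r - 2)%nat.
  - intros D; split; [|unfold QR; ring].
    apply Hsp; now apply gspline_point_op with (r - 2)%nat.
  - intros D M z HD HM Hz; rewrite HDL, HDR by easy.
    (* The shifted tower has length [r - 1 = (r - 3) + 2], and its top entry is the derivative of
       order [r]. *)
    assert (HsD : tower (r - 3 + 2) (shift D)) by (intros i s Hi Hs; apply HD; [lia|easy]).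
    assert (Hder : forall s, Icc 0 1 s -> Rabs (D 1%nat s - Q (shift D) s) <= C * M * h ^ (r - 1)).
    { intros s Hs; assert (H' := HQe (shift D) M s HsD).
      unfold shift in H' at 1; replace (S (r - 3 + 2)) with r in H' by lia.
      replace (r - 3 + 2)%nat with (r - 1)%nat in H' by lia; now apply H'. }
    assert (H01 : Icc 0 1 0 /\ Icc 0 1 1) by (unfold Icc; lra); destruct H01 as [H00 H11].
    assert (HM0 : 0 <= C * M * h ^ (r - 1)).
    { apply Rle_trans with (2 := Hder z Hz); apply Rabs_pos. }
    split; [now apply Hder|split; [now apply Hder|split]]; intros HD0.
    (* Function and spline agree at the end point, so the error of the derivative, integrated over a
       length of at most 1, bounds that of the values. *)
    + assert (HLip := lipschitz_on 0 1 (C * M * h ^ (r - 1)) (fun s => D 0%nat s - QL D s)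
        (fun s => D 1%nat s - Q (shift D) s) 0 z).
      cbv beta in HLip; rewrite HD0, HL0, !Rminus_0_r in HLip.
      apply Rle_trans with (C * M * h ^ (r - 1) * Rabs z).
      * apply HLip; [|easy|easy|easy]; intros s Hs; apply is_derive_on_minus; [easy| |].
        -- apply HD; [lia|easy].
        -- now apply is_derive_on_is_derive.
      * rewrite Rabs_pos_eq by apply Hz; unfold Icc in Hz; nra.
    + assert (HLip := lipschitz_on 0 1 (C * M * h ^ (r - 1)) (fun s => D 0%nat s - QR D s)
        (fun s => D 1%nat s - Q (shift D) s) 1 z).
      assert (HR1 : QR D 1 = 0) by (unfold QR; ring).
      cbv beta in HLip; rewrite HD0, HR1, !Rminus_0_r in HLip.
      apply Rle_trans with (C * M * h ^ (r - 1) * Rabs (z - 1)).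
      * apply HLip; [|easy|easy|easy]; intros s Hs; apply is_derive_on_minus; [easy| |].
        -- apply HD; [lia|easy].
        -- now apply is_derive_on_is_derive.
      * rewrite Rabs_left1 by (unfold Icc in Hz; lra); unfold Icc in Hz; nra.
Qed.

(** Time enters only through the coefficients [D s l p], so the operator commutes with the time
    derivative. The statement is tested against [psi] because the coordinates in a basis are such
    products. *)
Lemma point_op_time (P : (R -> R) -> Prop) (K : nat) Q (T : R) (D Dt : R -> nat -> R -> R)
    (psi : R -> R) (t : R) :
  (forall f, P f -> cont01 f) -> point_op P K Q -> cont01 psi -> Icc 0 T t ->
  (forall i p, (i <= K)%nat -> Icc 0 1 p -> is_derive_on 0 T (fun s => D s i p) t (Dt t i p)) ->
  (forall D, cont01 (Q D)) /\
  is_derive_on 0 T (fun s => inner (Q (D s)) psi) t (inner (Q (Dt t)) psi).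
Proof.
  intros HP HQ Hpsi Ht HD.
  induction HQ as [l p Phi Hl Hp H|Q Q' _ [IHc IH] _ [IHc' IH']|Q Q' He _ [IHc IH]].
  - assert (HPhi := HP Phi H); split.
    { intros E; apply continuous_on_mult; [apply continuous_on_const|easy]. }
    apply is_derive_on_eq with (fun s => inner Phi psi * D s l p) (inner Phi psi * Dt t l p).
    + easy.
    + intros s _; rewrite inner_scal_l by easy; ring.
    + rewrite inner_scal_l by easy; ring.
    + apply is_derive_on_scal; [easy|now apply HD].
  - split; [intros E; apply continuous_on_plus; [apply IHc|apply IHc']|].
    apply is_derive_on_eq with (fun s => inner (Q (D s)) psi + inner (Q' (D s)) psi)
      (inner (Q (Dt t)) psi + inner (Q' (Dt t)) psi); [easy| | |].
    + intros s _; rewrite inner_plus_l; [easy|apply IHc|apply IHc'|easy].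
    + rewrite inner_plus_l; [easy|apply IHc|apply IHc'|easy].
    + now apply is_derive_on_plus.
  - split; [intros E; apply continuous_on_eq with (Q E); [intros; apply He|apply IHc]|].
    apply is_derive_on_eq with (fun s => inner (Q (D s)) psi) (inner (Q (Dt t)) psi); [easy| | |easy].
    + intros s _; apply inner_ext; intros; [apply He|easy].
    + apply inner_ext; intros; [apply He|easy].
Qed.

Lemma point_op_time_cont (P : (R -> R) -> Prop) (K : nat) Q (T : R) (D : R -> nat -> R -> R)
    (psi : R -> R) :
  (forall f, P f -> cont01 f) -> point_op P K Q -> cont01 psi ->
  (forall i p, (i <= K)%nat -> Icc 0 1 p -> continuous_on (Icc 0 T) (fun s => D s i p)) ->
  (forall D, cont01 (Q D)) /\ continuous_on (Icc 0 T) (fun s => inner (Q (D s)) psi).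
Proof.
  intros HP HQ Hpsi HD.
  induction HQ as [l p Phi Hl Hp H|Q Q' _ [IHc IH] _ [IHc' IH']|Q Q' He _ [IHc IH]].
  - assert (HPhi := HP Phi H); split.
    { intros E; apply continuous_on_mult; [apply continuous_on_const|easy]. }
    apply continuous_on_eq with (fun s => inner Phi psi * D s l p).
    + intros s _; rewrite inner_scal_l by easy; ring.
    + apply continuous_on_mult; [apply continuous_on_const|now apply HD].
  - split; [intros E; apply continuous_on_plus; [apply IHc|apply IHc']|].
    apply continuous_on_eq with (fun s => inner (Q (D s)) psi + inner (Q' (D s)) psi).
    + intros s _; rewrite inner_plus_l; [easy|apply IHc|apply IHc'|easy].
    + now apply continuous_on_plus.
  - split; [intros E; apply continuous_on_eq with (Q E); [intros; apply He|apply IHc]|].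
    apply continuous_on_eq with (fun s => inner (Q (D s)) psi); [|easy].
    intros s _; apply inner_ext; intros; [apply He|easy].
Qed.

(** * Regularity of the Riemann invariants *)

Definition in_rect (T : R) (p : R * R) : Prop := Icc 0 1 (fst p) /\ Icc 0 T (snd p).

Definition cont2 (T : R) (f : R -> R -> R) : Prop :=
  continuous_on (in_rect T) (fun p : R * R => f (fst p) (snd p)).

Lemma cont2_ext (T : R) (f g : R -> R -> R) :
  (forall x t, Icc 0 1 x -> Icc 0 T t -> f x t = g x t) -> cont2 T f -> cont2 T g.
Proof.
  intros Hfg Hf [x t] Hp; simpl.
  rewrite <- Hfg by apply Hp.
  apply filterlim_within_ext with (fun p : R * R => f (fst p) (snd p)).
  - intros q Hq; apply Hfg; apply Hq.
  - now apply (Hf (x, t)).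
Qed.

Lemma cont2_const (T c : R) : cont2 T (fun _ _ => c).
Proof. intros p _; apply filterlim_const. Qed.

Lemma cont2_plus (T : R) (f g : R -> R -> R) :
  cont2 T f -> cont2 T g -> cont2 T (fun x t => f x t + g x t).
Proof.
  intros Hf Hg p Hp; apply (filterlim_Rplus _ _ (fun p : R * R => f (fst p) (snd p))
    (fun p : R * R => g (fst p) (snd p))); [now apply Hf|now apply Hg].
Qed.

Lemma cont2_mult (T : R) (f g : R -> R -> R) :
  cont2 T f -> cont2 T g -> cont2 T (fun x t => f x t * g x t).
Proof.
  intros Hf Hg p Hp; apply (filterlim_Rmult _ _ (fun p : R * R => f (fst p) (snd p))
    (fun p : R * R => g (fst p) (snd p))); [now apply Hf|now apply Hg].
Qed.

Lemma cont2_comp (T : R) (f : R -> R -> R) (g : R -> R) :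
  cont2 T f -> (forall x t, Icc 0 1 x -> Icc 0 T t -> continuous g (f x t)) ->
  cont2 T (fun x t => g (f x t)).
Proof.
  intros Hf Hg p Hp; eapply filterlim_comp; [now apply Hf|].
  apply Hg; apply Hp.
Qed.

Lemma cont2_time (T : R) (f : R -> R -> R) (x : R) :
  Icc 0 1 x -> cont2 T f -> continuous_on (Icc 0 T) (f x).
Proof.
  intros Hx Hf t Ht; apply filterlim_locally; intros e.
  destruct (proj1 (filterlim_locally _ _) (Hf (x, t) (conj Hx Ht)) e) as [d Hd].
  exists d; intros s Hs Hs'; apply (Hd (x, s)); [|easy].
  split; [apply ball_center|easy].
Qed.

Lemma cont2_space (T : R) (f : R -> R -> R) (t : R) :
  Icc 0 T t -> cont2 T f -> continuous_on (Icc 0 1) (fun x => f x t).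
Proof.
  intros Ht Hf x Hx; apply filterlim_locally; intros e.
  destruct (proj1 (filterlim_locally _ _) (Hf (x, t) (conj Hx Ht)) e) as [d Hd].
  exists d; intros s Hs Hs'; apply (Hd (s, t)); [|easy].
  split; [easy|apply ball_center].
Qed.

(** [compactness_list] yields, up to double negation, a finite cover by boxes on which [|f|] exceeds
    its value at the centre by at most one; the bound is the sum of [|f| + 1] over the centres. *)
Lemma cont2_bounded (T : R) (f : R -> R -> R) :
  cont2 T f -> exists M, 0 <= M /\
    forall x t, Icc 0 1 x -> Icc 0 T t -> Rabs (f x t) <= M.
Proof.
  intros Hf.
  assert (Hd : forall p : R * (R * unit), exists d : posreal, in_rect T (fst p, fst (snd p)) ->
    forall x t, Icc 0 1 x -> Icc 0 T t -> Rabs (x - fst p) < d -> Rabs (t - fst (snd p)) < d ->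
      Rabs (f x t) <= Rabs (f (fst p) (fst (snd p))) + 1).
  { intros [x0 [t0 []]]; simpl; destruct (classic (in_rect T (x0, t0))) as [Hp|Hp].
    - destruct (proj1 (filterlim_locally _ _) (Hf (x0, t0) Hp) (mkposreal 1 Rlt_0_1)) as [d Hd].
      exists d; intros _ x t Hx Ht Hxd Htd.
      assert (H : Rabs (f x t - f x0 t0) < 1) by (apply (Hd (x, t)); [split|]; easy).
      replace (f x t) with ((f x t - f x0 t0) + f x0 t0) by ring.
      apply Rle_trans with (1 := Rabs_triang _ _); lra.
    - exists (mkposreal 1 Rlt_0_1); easy. }
  set (delta := fun p => proj1_sig (constructive_indefinite_description _ (Hd p))).
  apply NNPP; intros Hn.
  apply (compactness_list 2 (0, (0, tt)) (1, (T, tt)) delta); intros [l Hl]; apply Hn.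
  exists (fold_right (fun p s => Rabs (f (fst p) (fst (snd p))) + 1 + s) 0 l).
  assert (Hpos : forall l : list (R * (R * unit)),
    0 <= fold_right (fun p s => Rabs (f (fst p) (fst (snd p))) + 1 + s) 0 l).
  { induction l0 as [|p l0 IH]; simpl; [lra|].
    generalize (Rabs_pos (f (fst p) (fst (snd p)))); lra. }
  split; [apply Hpos|]; intros x t Hx Ht.
  destruct (Hl (x, (t, tt)) ltac:(simpl; unfold Icc in *; easy)) as [[x0 [t0 []]] [Hin [Hb Hc]]].
  assert (H : Rabs (f x t) <= Rabs (f x0 t0) + 1).
  { assert (H := proj2_sig (constructive_indefinite_description _ (Hd (x0, (t0, tt))))).
    simpl in H, Hb, Hc; unfold in_rect, Icc in H; simpl in H.
    apply H; unfold Icc in *; try easy; apply Hc. }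
  apply Rle_trans with (1 := H); clear - Hin Hpos.
  induction l as [|p l IH]; [easy|simpl]; destruct Hin as [->|Hin].
  - simpl; generalize (Hpos l); lra.
  - generalize (IH Hin) (Rabs_pos (f (fst p) (fst (snd p)))); simpl; lra.
Qed.

(** [f] and its time derivative [fd] have [k] continuous [x]-derivatives, which correspond
    to each other under differentiation in time. *)
Fixpoint xjet (T : R) (k : nat) (f fd : R -> R -> R) : Prop :=
  (forall x t, Icc 0 1 x -> Icc 0 T t -> is_derive_on 0 T (f x) t (fd x t)) /\
  cont2 T f /\ cont2 T fd /\
  match k with
  | O => True
  | S j => exists g gd : R -> R -> R,
      (forall x t, Icc 0 1 x -> Icc 0 T t ->
         is_derive_on 0 1 (fun y => f y t) x (g x t) /\
         is_derive_on 0 1 (fun y => fd y t) x (gd x t)) /\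
      xjet T j g gd
  end.

Lemma xjet_cont2 (T : R) (k : nat) (f fd : R -> R -> R) : xjet T k f fd -> cont2 T f.
Proof. destruct k; intros [_ [H _]]; exact H. Qed.

Lemma xjet_ext (T : R) (k : nat) (f fd g gd : R -> R -> R) :
  (forall x t, Icc 0 1 x -> Icc 0 T t -> f x t = g x t /\ fd x t = gd x t) ->
  xjet T k f fd -> xjet T k g gd.
Proof.
  intros H; destruct k as [|k]; intros [H1 [H2 [H3 H4]]];
    (split; [|split; [|split]];
     [intros x t Hx Ht; apply is_derive_on_eq with (f x) (fd x t);
        [easy|intros; now apply H|now apply H|now apply H1]
     |apply cont2_ext with f; [intros; now apply H|easy]
     |apply cont2_ext with fd; [intros; now apply H|easy]
     |]); [easy|].
  destruct H4 as [a [ad [H4 H5]]]; exists a, ad; split; [|easy].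
  intros x t Hx Ht; split.
  - apply is_derive_on_eq with (fun y => f y t) (a x t);
      [easy|intros; now apply H|easy|now apply H4].
  - apply is_derive_on_eq with (fun y => fd y t) (ad x t);
      [easy|intros; now apply H|easy|now apply H4].
Qed.

Lemma xjet_pred (T : R) (k : nat) (f fd : R -> R -> R) : xjet T (S k) f fd -> xjet T k f fd.
Proof.
  revert f fd; induction k as [|k IH]; intros f fd [H1 [H2 [H3 [g [gd [H4 H5]]]]]].
  - split; [easy|split; [easy|now split]].
  - repeat (split; [easy|]); exists g, gd; split; [easy|now apply IH].
Qed.

Lemma xjet_const (T c : R) (k : nat) : xjet T k (fun _ _ => c) (fun _ _ => 0).
Proof.
  assert (H0 : forall c t, Icc 0 T t -> is_derive_on 0 T (fun _ => c) t 0)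
    by (intros; now apply is_derive_on_const).
  assert (H1 : forall c, cont2 T (fun _ _ => c)) by (intros; apply cont2_const).
  induction k as [|k IH] in c |- *;
    (split; [intros; now apply H0|split; [apply H1|split; [apply H1|]]]); [easy|].
  exists (fun _ _ => 0), (fun _ _ => 0); split; [|apply IH].
  intros; split; now apply is_derive_on_const.
Qed.

Lemma xjet_plus (T : R) (k : nat) (f fd g gd : R -> R -> R) :
  xjet T k f fd -> xjet T k g gd ->
  xjet T k (fun x t => f x t + g x t) (fun x t => fd x t + gd x t).
Proof.
  revert f fd g gd; induction k as [|k IH];
    intros f fd g gd [H1 [H2 [H3 H4]]] [K1 [K2 [K3 K4]]];
    (split; [intros; apply is_derive_on_plus; auto|
     split; [now apply cont2_plus|split; [now apply cont2_plus|]]]); [easy|].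
  destruct H4 as [a [ad [H4 H5]]], K4 as [b [bd [K4 K5]]].
  exists (fun x t => a x t + b x t), (fun x t => ad x t + bd x t); split; [|now apply IH].
  intros x t Hx Ht; split.
  - apply is_derive_on_plus; [easy|now apply H4|now apply K4].
  - apply is_derive_on_plus; [easy|now apply H4|now apply K4].
Qed.

Lemma xjet_mult (T : R) (k : nat) (f fd g gd : R -> R -> R) :
  xjet T k f fd -> xjet T k g gd ->
  xjet T k (fun x t => f x t * g x t) (fun x t => fd x t * g x t + f x t * gd x t).
Proof.
  revert f fd g gd; induction k as [|k IH]; intros f fd g gd Hf Hg;
    assert (Hf' := Hf); assert (Hg' := Hg);
    destruct Hf' as [H1 [H2 [H3 H4]]], Hg' as [K1 [K2 [K3 K4]]];
    (split; [intros; apply is_derive_on_mult; auto|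
     split; [now apply cont2_mult|
     split; [apply cont2_plus; now apply cont2_mult|]]]); [easy|].
  destruct H4 as [a [ad [H4 H5]]], K4 as [b [bd [K4 K5]]].
  apply xjet_pred in Hf; apply xjet_pred in Hg.
  exists (fun x t => a x t * g x t + f x t * b x t),
    (fun x t => (ad x t * g x t + a x t * gd x t) + (fd x t * b x t + f x t * bd x t)).
  split; [|apply xjet_plus; now apply IH].
  intros x t Hx Ht; split.
  - apply (is_derive_on_mult 0 1 (fun y => f y t) (fun y => g y t)); [easy|now apply H4|now apply K4].
  - apply is_derive_on_eq with (fun y => fd y t * g y t + f y t * gd y t)
      ((ad x t * g x t + fd x t * b x t) + (a x t * gd x t + f x t * bd x t)); [easy|easy|ring|].
    apply is_derive_on_plus; [easy| |].
    + apply (is_derive_on_mult 0 1 (fun y => fd y t) (fun y => g y t)); [easy|now apply H4|now apply K4].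
    + apply (is_derive_on_mult 0 1 (fun y => f y t) (fun y => gd y t)); [easy|now apply H4|now apply K4].
Qed.

Lemma xjet_scal (T c : R) (k : nat) (f fd : R -> R -> R) :
  xjet T k f fd -> xjet T k (fun x t => c * f x t) (fun x t => c * fd x t).
Proof.
  intros Hf; apply xjet_ext with (fun x t => c * f x t) (fun x t => 0 * f x t + c * fd x t).
  - intros; split; [easy|ring].
  - apply (xjet_mult T k (fun _ _ => c) (fun _ _ => 0)); [apply xjet_const|easy].
Qed.

Lemma is_derive_inv_sqrt (z : R) : 0 < z ->
  is_derive (fun z => / sqrt z) z (- (1 / 2) * (/ sqrt z * / sqrt z * / sqrt z)).
Proof.
  intros Hz; assert (Hs := sqrt_lt_R0 z Hz).
  auto_derive; [split; [easy|split; [lra|easy]]|].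
  field; lra.
Qed.

(** [s = f^(-1/2)] satisfies [s' = - s^3 f' / 2], a polynomial in [s] and [f'], so the next
    derivative is a product of jets already available and the induction on [k] closes. The square
    root itself is recovered as [f s]. *)
Lemma xjet_inv_sqrt (T : R) (k : nat) (f fd : R -> R -> R) :
  (forall x t, Icc 0 1 x -> Icc 0 T t -> 0 < f x t) -> xjet T k f fd ->
  let s := fun x t => / sqrt (f x t) in
  xjet T k s (fun x t => - (1 / 2) * (s x t * s x t * s x t) * fd x t).
Proof.
  intros Hpos; revert fd; induction k as [|k IH]; intros fd Hf s.
  all: assert (Hf' := Hf); destruct Hf' as [H1 [H2 [H3 H4]]].
  all: assert (Hs : cont2 T s) by
    (apply (cont2_comp T f (fun z => / sqrt z)); [easy|];
     intros x t Hx Ht; apply (ex_derive_continuous (fun z => / sqrt z));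
     eexists; now apply is_derive_inv_sqrt, Hpos).
  all: split; [intros x t Hx Ht;
    apply (is_derive_on_comp 0 T (f x) (fun z => / sqrt z)); [easy|now apply H1|];
    now apply is_derive_inv_sqrt, Hpos|split; [easy|split; [|]]].
  1, 3: apply cont2_mult; [apply cont2_mult; [apply cont2_const|];
    apply cont2_mult; [now apply cont2_mult|easy]|easy].
  - easy.
  - destruct H4 as [a [ad [H4 H5]]].
    assert (Hk := IH fd (xjet_pred _ _ _ _ Hf)); fold s in Hk.
    set (sd := fun x t => - (1 / 2) * (s x t * s x t * s x t) * fd x t) in *.
    exists (fun x t => - (1 / 2) * (s x t * s x t * s x t * a x t)).
    exists (fun x t => - (1 / 2) * (((sd x t * s x t + s x t * sd x t) * s x t
      + s x t * s x t * sd x t) * a x t + s x t * s x t * s x t * ad x t)).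
    assert (Hsx : forall x t, Icc 0 1 x -> Icc 0 T t ->
      is_derive_on 0 1 (fun y => s y t) x (- (1 / 2) * (s x t * s x t * s x t) * a x t)).
    { intros x t Hx Ht; apply (is_derive_on_comp 0 1 (fun y => f y t) (fun z => / sqrt z));
        [easy|now apply H4|now apply is_derive_inv_sqrt, Hpos]. }
    split.
    + intros x t Hx Ht; split.
      * apply is_derive_on_eq with (fun y => s y t) (- (1 / 2) * (s x t * s x t * s x t) * a x t);
          [easy|easy|ring|now apply Hsx].
      * set (sx := - (1 / 2) * (s x t * s x t * s x t) * a x t) in Hsx.
        apply is_derive_on_eq with (fun y => (- (1 / 2) * (s y t * s y t * s y t)) * fd y t)
          ((- (1 / 2) * ((sx * s x t + s x t * sx) * s x t + s x t * s x t * sx)) * fd x t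
            + (- (1 / 2) * (s x t * s x t * s x t)) * ad x t); [easy|easy| |].
        { unfold sx, sd; ring. }
        apply (is_derive_on_mult 0 1 (fun y => - (1 / 2) * (s y t * s y t * s y t))
          (fun y => fd y t)); [easy| |now apply H4].
        apply (is_derive_on_scal 0 1 (- (1 / 2)) (fun y => s y t * s y t * s y t)); [easy|].
        apply (is_derive_on_mult 0 1 (fun y => s y t * s y t) (fun y => s y t)); [easy| |now apply Hsx].
        apply (is_derive_on_mult 0 1 (fun y => s y t) (fun y => s y t)); now try apply Hsx.
    + apply (xjet_scal T (- (1 / 2)) k (fun x t => s x t * s x t * s x t * a x t)).
      apply (xjet_mult T k (fun x t => s x t * s x t * s x t)); [|easy].
      apply (xjet_mult T k (fun x t => s x t * s x t)); [|easy].
      now apply (xjet_mult T k s).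
Qed.

Lemma xjet_sqrt (T : R) (k : nat) (f fd : R -> R -> R) :
  (forall x t, Icc 0 1 x -> Icc 0 T t -> 0 < f x t) -> xjet T k f fd ->
  exists gd, xjet T k (fun x t => sqrt (f x t)) gd.
Proof.
  intros Hpos Hf.
  assert (H := xjet_mult T k _ _ _ _ Hf (xjet_inv_sqrt T k f fd Hpos Hf)); cbv zeta beta in H.
  eexists; eapply xjet_ext; [|exact H].
  intros x t Hx Ht; split; [|reflexivity].
  assert (Hp := Hpos x t Hx Ht); assert (Hs := sqrt_lt_R0 _ Hp).
  rewrite <- (sqrt_sqrt (f x t)) at 1 by lra; field; lra.
Qed.

(** The time derivative uses up one of the [m] orders, whence [k < m]. *)
Lemma Cm_rect_xjet (T : R) (m k : nat) (f : R -> R -> R) :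
  (k < m)%nat -> Cm_rect T m f -> exists fd, xjet T k f fd.
Proof.
  intros Hk [D [H0 [H1 H2]]]; exists (D 0%nat 1%nat).
  apply xjet_ext with (D 0%nat 0%nat) (D 0%nat 1%nat).
  { intros; split; [now apply H0|easy]. }
  assert (H : forall i, (i + k < m)%nat -> xjet T k (D i 0%nat) (D i 1%nat)).
  2: now apply H.
  clear Hk; induction k as [|k IH]; intros i Hi;
    (split; [intros x t Hx Ht; apply (H1 i 0%nat x t); [lia|easy|easy]|
     split; [apply H2; lia|split; [apply H2; lia|]]]); [easy|].
  exists (D (S i) 0%nat), (D (S i) 1%nat); split; [|apply IH; lia].
  intros x t Hx Ht; split; apply H1; easy || lia.
Qed.

(** Unfolds the nested existentials of [xjet] into the sequences on which the operators act, with
    one bound for all derivatives and times. *)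
Lemma xjet_towers (T : R) (k : nat) (f fd : R -> R -> R) :
  xjet T k f fd ->
  exists a b : R -> nat -> R -> R, exists M : R, 0 <= M /\
    (forall x t, a t 0%nat x = f x t /\ b t 0%nat x = fd x t) /\
    (forall t, Icc 0 T t -> tower k (a t) /\ tower k (b t)) /\
    (forall i p, (i <= k)%nat -> Icc 0 1 p ->
       continuous_on (Icc 0 T) (fun t => b t i p) /\
       forall t, Icc 0 T t ->
         is_derive_on 0 T (fun t => a t i p) t (b t i p) /\
         Rabs (a t i p) <= M /\ Rabs (b t i p) <= M).
Proof.
  revert f fd; induction k as [|k IH]; intros f fd [H1 [H2 [H3 H4]]];
    destruct (cont2_bounded T f H2) as [M1 [HM1 B1]];
    destruct (cont2_bounded T fd H3) as [M2 [HM2 B2]].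
  - exists (fun t _ x => f x t), (fun t _ x => fd x t), (M1 + M2); split; [lra|].
    split; [easy|split; [intros t Ht; split; intros i x Hi; lia|]].
    intros i p Hi Hp; split; [now apply cont2_time|].
    intros t Ht; split; [now apply H1|].
    generalize (B1 p t Hp Ht) (B2 p t Hp Ht); lra.
  - destruct H4 as [g [gd [H4 H5]]].
    destruct (IH g gd H5) as [a [b [M [HM [E [Ht' Hi']]]]]].
    exists (fun t i => match i with O => fun x => f x t | S j => a t j end),
      (fun t i => match i with O => fun x => fd x t | S j => b t j end), (M1 + M2 + M).
    split; [lra|split; [easy|split]].
    + intros t Ht; destruct (Ht' t Ht) as [Ta Tb]; split; intros [|i] x Hi Hx.
      * rewrite (proj1 (E x t)); now apply H4.
      * apply Ta; [lia|easy].
      * rewrite (proj2 (E x t)); now apply H4.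
      * apply Tb; [lia|easy].
    + intros [|i] p Hi Hp.
      * split; [now apply cont2_time|]; intros t Ht; split; [now apply H1|].
        generalize (B1 p t Hp Ht) (B2 p t Hp Ht); lra.
      * destruct (Hi' i p ltac:(lia) Hp) as [Hc Hr]; split; [easy|].
        intros t Ht; destruct (Hr t Ht) as [R1 [R2 R3]]; split; [easy|lra].
Qed.

(** * From the shallow water equations to the diagonal system *)

Lemma riemann_derive (a b eta0 u0 e' q' : R) (e q : R -> R) (x : R) :
  Icc a b x -> 0 < 1 + e x -> is_derive_on a b e x e' -> is_derive_on a b q x q' ->
  is_derive_on a b (fun y => riemann_v eta0 u0 (e y) (q y)) x (1 / 2 * (q' + e' / sqrt (1 + e x))) /\
  is_derive_on a b (fun y => riemann_w eta0 u0 (e y) (q y)) x (1 / 2 * (q' - e' / sqrt (1 + e x))).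
Proof.
  intros Hx Hpos He Hq; assert (Hs := sqrt_lt_R0 _ Hpos).
  assert (Hc : is_derive_on a b (fun y => sqrt (1 + e y)) x (/ (2 * sqrt (1 + e x)) * e')).
  { apply (is_derive_on_comp a b e (fun z => sqrt (1 + z))); [easy|easy|].
    auto_derive; [easy|]; field; lra. }
  assert (Hk : is_derive_on a b (fun _ => - u0 - 2 * sqrt (1 + eta0)) x 0)
    by now apply is_derive_on_const.
  assert (Hk' : is_derive_on a b (fun _ => - u0 + 2 * sqrt (1 + eta0)) x 0)
    by now apply is_derive_on_const.
  split; unfold riemann_v, riemann_w.
  - apply is_derive_on_eq with
      (fun y => 1 / 2 * ((q y + 2 * sqrt (1 + e y)) + (- u0 - 2 * sqrt (1 + eta0))))
      (1 / 2 * ((q' + 2 * (/ (2 * sqrt (1 + e x)) * e')) + 0));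
      [easy|intros; ring|field; lra|].
    apply (is_derive_on_scal a b (1 / 2) (fun y => (q y + 2 * sqrt (1 + e y)) + (- u0 - 2 * sqrt (1 + eta0))));
      [easy|].
    apply (is_derive_on_plus a b (fun y => q y + 2 * sqrt (1 + e y))); [easy| |easy].
    apply is_derive_on_plus; [easy|easy|].
    now apply (is_derive_on_scal a b 2 (fun y => sqrt (1 + e y))).
  - apply is_derive_on_eq with
      (fun y => 1 / 2 * ((q y + (-2) * sqrt (1 + e y)) + (- u0 + 2 * sqrt (1 + eta0))))
      (1 / 2 * ((q' + (-2) * (/ (2 * sqrt (1 + e x)) * e')) + 0));
      [easy|intros; ring|field; lra|].
    apply (is_derive_on_scal a b (1 / 2) (fun y => (q y + (-2) * sqrt (1 + e y)) + (- u0 + 2 * sqrt (1 + eta0))));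
      [easy|].
    apply (is_derive_on_plus a b (fun y => q y + (-2) * sqrt (1 + e y))); [easy| |easy].
    apply is_derive_on_plus; [easy|easy|].
    now apply (is_derive_on_scal a b (-2) (fun y => sqrt (1 + e y))).
Qed.

(** With [c = sqrt (1 + eta)], the identities [u + c = u0 + delta0 + (3 v + w) / 2] and
    [u - c = u0 - delta0 + (v + 3 w) / 2] identify the speeds; the time derivatives of [eta] and [u]
    are then eliminated by the equations. *)
Lemma swe_diag (T eta0 u0 : R) (etai ui : R -> R) (eta u : R -> R -> R) :
  0 < T -> 0 < 1 + eta0 ->
  (forall x t, Icc 0 1 x -> Icc 0 T t -> 0 < 1 + eta x t) ->
  Cm_rect T 1 eta -> Cm_rect T 1 u -> swe_solution T eta0 u0 etai ui eta u ->
  diag_solution T (sqrt (1 + eta0)) u0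
    (fun x => riemann_v eta0 u0 (etai x) (ui x)) (fun x => riemann_w eta0 u0 (etai x) (ui x))
    (fun x t => riemann_v eta0 u0 (eta x t) (u x t))
    (fun x t => riemann_w eta0 u0 (eta x t) (u x t)).
Proof.
  intros HT H0 Hpos [D [D0 [D1 _]]] [E [E0 [E1 _]]] [Hmass Hmom Hinit Hl Hr].
  assert (H01 : 0 < 1) by lra.
  assert (Hex : forall x t, Icc 0 1 x -> Icc 0 T t ->
    is_derive_on 0 1 (fun y => eta y t) x (D 1%nat 0%nat x t)).
  { intros x t Hx Ht; apply is_derive_on_eq with (fun y => D 0%nat 0%nat y t) (D 1%nat 0%nat x t);
      [easy|intros; now apply D0|easy|apply D1; easy || lia]. }
  assert (Het : forall x t, Icc 0 1 x -> Icc 0 T t ->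
    is_derive_on 0 T (fun s => eta x s) t (D 0%nat 1%nat x t)).
  { intros x t Hx Ht; apply is_derive_on_eq with (fun s => D 0%nat 0%nat x s) (D 0%nat 1%nat x t);
      [easy|intros; now apply D0|easy|apply D1; easy || lia]. }
  assert (Hux : forall x t, Icc 0 1 x -> Icc 0 T t ->
    is_derive_on 0 1 (fun y => u y t) x (E 1%nat 0%nat x t)).
  { intros x t Hx Ht; apply is_derive_on_eq with (fun y => E 0%nat 0%nat y t) (E 1%nat 0%nat x t);
      [easy|intros; now apply E0|easy|apply E1; easy || lia]. }
  assert (Hut : forall x t, Icc 0 1 x -> Icc 0 T t ->
    is_derive_on 0 T (fun s => u x s) t (E 0%nat 1%nat x t)).
  { intros x t Hx Ht; apply is_derive_on_eq with (fun s => E 0%nat 0%nat x s) (E 0%nat 1%nat x t);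
      [easy|intros; now apply E0|easy|apply E1; easy || lia]. }
  assert (Hpde : forall x t, Icc 0 1 x -> Icc 0 T t ->
    D 0%nat 1%nat x t + E 1%nat 0%nat x t
      + (D 1%nat 0%nat x t * u x t + eta x t * E 1%nat 0%nat x t) = 0 /\
    E 0%nat 1%nat x t + D 1%nat 0%nat x t + u x t * E 1%nat 0%nat x t = 0).
  { intros x t Hx Ht; specialize (Hmass x t Hx Ht); specialize (Hmom x t Hx Ht).
    unfold Defs.Dx, Defs.Dt in Hmass, Hmom.
    rewrite (Derive_on_eq 0 T _ t _ HT Ht (Het x t Hx Ht)) in Hmass.
    rewrite (Derive_on_eq 0 1 _ x _ H01 Hx (Hux x t Hx Ht)) in Hmass, Hmom.
    rewrite (Derive_on_eq 0 T _ t _ HT Ht (Hut x t Hx Ht)) in Hmom.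
    rewrite (Derive_on_eq 0 1 _ x _ H01 Hx (Hex x t Hx Ht)) in Hmom.
    rewrite (Derive_on_eq 0 1 _ x _ H01 Hx (is_derive_on_mult 0 1 _ _ x _ _ Hx
      (Hex x t Hx Ht) (Hux x t Hx Ht))) in Hmass.
    easy. }
  assert (Hsq : forall x t, Icc 0 1 x -> Icc 0 T t -> 0 < sqrt (1 + eta x t) /\
    sqrt (1 + eta x t) * sqrt (1 + eta x t) = 1 + eta x t).
  { intros x t Hx Ht; assert (Hp := Hpos x t Hx Ht); split; [now apply sqrt_lt_R0|].
    apply sqrt_sqrt; lra. }
  split.
  - intros x t Hx Ht; unfold Defs.Dx, Defs.Dt.
    destruct (riemann_derive 0 1 eta0 u0 _ _ (fun y => eta y t) (fun y => u y t) x Hx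
      (Hpos x t Hx Ht) (Hex x t Hx Ht) (Hux x t Hx Ht)) as [V1 _].
    destruct (riemann_derive 0 T eta0 u0 _ _ (fun s => eta x s) (fun s => u x s) t Ht
      (Hpos x t Hx Ht) (Het x t Hx Ht) (Hut x t Hx Ht)) as [V2 _].
    rewrite (Derive_on_eq 0 1 _ x _ H01 Hx V1), (Derive_on_eq 0 T _ t _ HT Ht V2).
    destruct (Hpde x t Hx Ht) as [P1 P2]; destruct (Hsq x t Hx Ht) as [S1 S2].
    unfold riemann_v, riemann_w; set (c := sqrt (1 + eta x t)) in *.
    replace (D 0%nat 1%nat x t) with (- (c * c * E 1%nat 0%nat x t + D 1%nat 0%nat x t * u x t))
      by (rewrite S2; lra).
    replace (E 0%nat 1%nat x t) with (- (D 1%nat 0%nat x t + u x t * E 1%nat 0%nat x t)) by lra.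
    field; lra.
  - intros x t Hx Ht; unfold Defs.Dx, Defs.Dt.
    destruct (riemann_derive 0 1 eta0 u0 _ _ (fun y => eta y t) (fun y => u y t) x Hx
      (Hpos x t Hx Ht) (Hex x t Hx Ht) (Hux x t Hx Ht)) as [_ V1].
    destruct (riemann_derive 0 T eta0 u0 _ _ (fun s => eta x s) (fun s => u x s) t Ht
      (Hpos x t Hx Ht) (Het x t Hx Ht) (Hut x t Hx Ht)) as [_ V2].
    rewrite (Derive_on_eq 0 1 _ x _ H01 Hx V1), (Derive_on_eq 0 T _ t _ HT Ht V2).
    destruct (Hpde x t Hx Ht) as [P1 P2]; destruct (Hsq x t Hx Ht) as [S1 S2].
    unfold riemann_v, riemann_w; set (c := sqrt (1 + eta x t)) in *.
    replace (D 0%nat 1%nat x t) with (- (c * c * E 1%nat 0%nat x t + D 1%nat 0%nat x t * u x t))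
      by (rewrite S2; lra).
    replace (E 0%nat 1%nat x t) with (- (D 1%nat 0%nat x t + u x t * E 1%nat 0%nat x t)) by lra.
    field; lra.
  - intros x Hx; destruct (Hinit x Hx) as [-> ->]; easy.
  - intros t Ht; specialize (Hl t Ht); specialize (Hr t Ht); unfold riemann_v, riemann_w; lra.
Qed.

Lemma riemann_xjet (T eta0 u0 : R) (k : nat) (eta u : R -> R -> R) :
  (forall x t, Icc 0 1 x -> Icc 0 T t -> 0 < 1 + eta x t) ->
  Cm_rect T (S k) eta -> Cm_rect T (S k) u ->
  (exists vd, xjet T k (fun x t => riemann_v eta0 u0 (eta x t) (u x t)) vd) /\
  (exists wd, xjet T k (fun x t => riemann_w eta0 u0 (eta x t) (u x t)) wd).
Proof.
  intros Hpos Heta Hu.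
  destruct (Cm_rect_xjet T (S k) k eta ltac:(lia) Heta) as [ed He].
  destruct (Cm_rect_xjet T (S k) k u ltac:(lia) Hu) as [ud Hud].
  destruct (xjet_sqrt T k (fun x t => 1 + eta x t) (fun x t => 0 + ed x t) Hpos) as [cd Hc].
  { apply (xjet_plus T k (fun _ _ => 1) (fun _ _ => 0) eta ed); [apply xjet_const|easy]. }
  assert (H : forall a b, exists d, xjet T k
    (fun x t => 1 / 2 * u x t + (a * sqrt (1 + eta x t) + b)) d).
  { intros a b; eexists.
    apply (xjet_plus T k (fun x t => 1 / 2 * u x t)); [exact (xjet_scal T (1 / 2) k u ud Hud)|].
    apply (xjet_plus T k (fun x t => a * sqrt (1 + eta x t)));
      [exact (xjet_scal T a k (fun x t => sqrt (1 + eta x t)) cd Hc)|apply xjet_const]. }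
  split.
  - destruct (H 1 (- (1 / 2) * u0 - sqrt (1 + eta0))) as [d Hd]; exists d.
    refine (xjet_ext T k _ _ _ _ _ Hd); intros; split; [unfold riemann_v; field|easy].
  - destruct (H (-1) (- (1 / 2) * u0 + sqrt (1 + eta0))) as [d Hd]; exists d.
    refine (xjet_ext T k _ _ _ _ _ Hd); intros; split; [unfold riemann_w; field|easy].
Qed.

(** * The Galerkin scheme on a fixed mesh *)

Definition C1on (f f' : R -> R) : Prop :=
  (forall x, Icc 0 1 x -> is_derive_on 0 1 f x (f' x)) /\ cont01 f'.

Lemma C1on_cont (f f' : R -> R) : C1on f f' -> cont01 f.
Proof. intros [H _]; now apply continuous_on_derive with f'. Qed.

(* The nonlinear terms are, up to terms without derivatives of [th], the derivative of
   [- G th^2 / 2 + mu (th^3 / 2 + xi th^2 / 4)] with [G = g + 3/2 V + 1/2 W]. *)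
Lemma energy_half (g M mu eps : R) (th th' xi xi' V V' W W' Rs : R -> R) :
  C1on th th' -> C1on xi xi' -> C1on V V' -> C1on W W' -> cont01 Rs ->
  0 <= mu ->
  (forall x, Icc 0 1 x -> Rabs (V' x) <= M) -> (forall x, Icc 0 1 x -> Rabs (W' x) <= M) ->
  (forall x, Icc 0 1 x -> Rabs (mu * xi' x) <= 1) ->
  (forall x, Icc 0 1 x -> Rabs (Rs x) <= eps) ->
  let Phi := fun x => - (1 / 2) * ((g + (3 / 2 * V x + 1 / 2 * W x)) * (th x * th x))
    + mu * (1 / 2 * (th x * th x * th x) + 1 / 4 * (xi x * (th x * th x))) in
  Phi 1 <= Phi 0 ->
  inner (fun x => Rs x - (g * th' x + (3 / 2 * V x + 1 / 2 * W x) * th' x)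
    - (3 / 2 * th x + 1 / 2 * xi x) * V' x
    + mu * ((3 / 2 * th x + 1 / 2 * xi x) * th' x)) th
  <= 1 / 2 * eps ^ 2 + (1 + 3 * M) * (inner th th + inner xi xi).
Proof.
  intros Hth Hxi HV HW HR Hmu HVM HWM Hxi1 HRe Phi HPhi.
  assert (Cth := C1on_cont _ _ Hth); assert (Cxi := C1on_cont _ _ Hxi).
  assert (CV := C1on_cont _ _ HV); assert (CW := C1on_cont _ _ HW).
  destruct Hth as [Dth Cth'], Hxi as [Dxi Cxi'], HV as [DV CV'], HW as [DW CW'].
  set (Phi' := fun x => - (1 / 2) * ((0 + (3 / 2 * V' x + 1 / 2 * W' x)) * (th x * th x)
      + (g + (3 / 2 * V x + 1 / 2 * W x)) * (th' x * th x + th x * th' x))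
    + mu * (1 / 2 * ((th' x * th x + th x * th' x) * th x + th x * th x * th' x)
      + 1 / 4 * (xi' x * (th x * th x) + xi x * (th' x * th x + th x * th' x)))).
  unfold cont01 in *.
  assert (CPhi' : cont01 Phi') by (unfold cont01, Phi'; cont_on).
  assert (HFTC : RInt Phi' 0 1 = Phi 1 - Phi 0).
  { apply RInt_derive_on; [lra| |easy].
    intros x Hx.
    assert (Dtt : is_derive_on 0 1 (fun x => th x * th x) x (th' x * th x + th x * th' x))
      by (apply is_derive_on_mult; auto).
    apply is_derive_on_plus; [easy| |]; apply is_derive_on_scal; try easy.
    - apply (is_derive_on_mult 0 1 (fun x => g + (3 / 2 * V x + 1 / 2 * W x))
        (fun x => th x * th x)); [easy| |easy].
      apply is_derive_on_plus; [easy|now apply is_derive_on_const|].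
      apply is_derive_on_plus; [easy| |]; apply is_derive_on_scal; auto.
    - apply is_derive_on_plus; [easy| |]; apply is_derive_on_scal; try easy.
      + apply (is_derive_on_mult 0 1 (fun x => th x * th x) th); auto.
      + apply (is_derive_on_mult 0 1 xi (fun x => th x * th x)); auto. }
  (* What is left beside the total derivative. The derivative [xi'] occurs here only multiplied by
     [mu], so it is [mu xi'] that must be bounded. *)
  set (low := fun x => Rs x * th x + (1 / 2 * (3 / 2 * V' x + 1 / 2 * W' x) - 1 / 4 * (mu * xi' x))
      * (th x * th x) - (3 / 2 * th x + 1 / 2 * xi x) * V' x * th x).
  assert (Clow : cont01 low) by (unfold cont01, low; cont_on).
  assert (E : inner (fun x => Rs x - (g * th' x + (3 / 2 * V x + 1 / 2 * W x) * th' x)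
    - (3 / 2 * th x + 1 / 2 * xi x) * V' x
    + mu * ((3 / 2 * th x + 1 / 2 * xi x) * th' x)) th = RInt Phi' 0 1 + RInt low 0 1).
  { rewrite <- RInt01_plus by easy; apply RInt01_ext; intros x _; unfold Phi', low; field. }
  rewrite E, HFTC.
  (* The contributions to the factor of [th^2] add up to [3/4 + 11/4 M], rounded up to [1 + 3 M]. *)
  assert (Hlow : RInt low 0 1 <= 1 / 2 * eps ^ 2 + (1 + 3 * M) * (inner th th + inner xi xi)).
  { apply Rle_trans with (RInt (fun x => 1 / 2 * eps ^ 2
      + (1 + 3 * M) * (th x * th x + xi x * xi x)) 0 1).
    - apply RInt01_le; [easy|unfold cont01; cont_on|].
      intros x Hx; specialize (HVM x Hx); specialize (HWM x Hx); specialize (Hxi1 x Hx).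
      specialize (HRe x Hx); unfold low.
      apply Rabs_le_between in HVM, HWM, Hxi1, HRe.
      set (s := th x) in *; set (q := xi x) in *; set (a := V' x) in *; set (b := W' x) in *.
      set (m := mu * xi' x) in *; set (ro := Rs x) in *.
      assert (T1 : ro * s <= 1 / 2 * eps ^ 2 + 1 / 2 * (s * s)).
      { assert (ro * ro <= eps * eps) by nra.
        assert (0 <= (ro - s) * (ro - s)) by apply Rle_0_sqr; nra. }
      assert (Hss : 0 <= s * s) by apply Rle_0_sqr.
      assert (Hqq : 0 <= q * q) by apply Rle_0_sqr.
      assert (T2 : (1 / 2 * (3 / 2 * a + 1 / 2 * b) - 1 / 4 * m) * (s * s) <= (M + 1 / 4) * (s * s)).
      { apply Rmult_le_compat_r; [easy|lra]. }
      assert (T3 : - (3 / 2 * (s * s)) * a <= 3 / 2 * M * (s * s)) by nra.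
      (* [P3 + P4] reads [0 <= 2 M (s^2 + q^2) + 4 a s q], which is the claim up to a factor. *)
      assert (T4 : - (1 / 2 * (q * s)) * a <= 1 / 4 * M * (s * s + q * q)).
      { assert (P1 : 0 <= (M - a) * ((s + q) * (s + q)))
          by (apply Rmult_le_pos; [lra|apply Rle_0_sqr]).
        assert (P2 : 0 <= (M + a) * ((s - q) * (s - q)))
          by (apply Rmult_le_pos; [lra|apply Rle_0_sqr]).
        assert (P3 : 0 <= (M + a) * ((s + q) * (s + q)))
          by (apply Rmult_le_pos; [lra|apply Rle_0_sqr]).
        assert (P4 : 0 <= (M - a) * ((s - q) * (s - q)))
          by (apply Rmult_le_pos; [lra|apply Rle_0_sqr]).
        nra. }
      assert (HM0 : 0 <= M) by lra.
      assert (0 <= M * (s * s)) by now apply Rmult_le_pos.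
      assert (0 <= M * (q * q)) by now apply Rmult_le_pos.
      replace ((3 / 2 * s + 1 / 2 * q) * a * s) with (- (- (3 / 2 * (s * s)) * a + - (1 / 2 * (q * s)) * a)) by ring.
      nra.
    - right; rewrite RInt01_plus by (unfold cont01; cont_on).
      rewrite RInt01_const; f_equal.
      rewrite RInt01_scal, RInt01_plus by (unfold cont01; cont_on); easy. }
  lra.
Qed.

(** * The scheme in coordinates *)

Definition conv (g : R) (v w v' : R -> R) (x : R) : R :=
  g * v' x + (3 / 2 * v x + 1 / 2 * w x) * v' x.

Lemma C1on_comb (n : nat) (z : nat -> R) (e e' : nat -> R -> R) :
  (forall i, (i < n)%nat -> C1on (e i) (e' i)) -> C1on (comb n z e) (comb n z e').
Proof.
  intros H; split.
  - intros x Hx; apply (is_derive_on_vsum 0 1 n (fun i x => z i * e i x)); [easy|].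
    intros i Hi; apply is_derive_on_scal; [easy|now apply H].
  - apply cont_comb; intros; now apply H.
Qed.

Definition stiff (g d : R) (e f e' f' : nat -> R -> R) (i k : nat) : R :=
  inner (fun x => g * e' k x) (e i) + inner (fun x => d * f' k x) (f i).

(** The index [i] belongs to the test pair, [j] to the transporting and [k] to the differentiated
    factor; the exchange of [e] and [f] between the summands reflects the symmetry of the two
    equations. *)
Definition transport (e f e' f' : nat -> R -> R) (i j k : nat) : R :=
  inner (fun x => (3 / 2 * e j x + 1 / 2 * f j x) * e' k x) (e i)
  + inner (fun x => (3 / 2 * f j x + 1 / 2 * e j x) * f' k x) (f i).

Lemma inner_weighted_comb (n : nat) (g : R) (z : nat -> R) (e : nat -> R -> R) (p : R -> R) :
  (forall i, (i < n)%nat -> cont01 (e i)) -> cont01 p ->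
  inner (fun x => g * comb n z e x) p = vsum n (fun k => inner (fun x => g * e k x) p * z k).
Proof.
  intros He Hp.
  rewrite (inner_ext _ p (fun x => vsum n (fun k => z k * (g * e k x))) p).
  - rewrite (inner_comb_l n z (fun k x => g * e k x)).
    + apply vsum_ext; intros; ring.
    + intros i Hi; apply continuous_on_mult; [apply continuous_on_const|now apply He].
    + easy.
  - intros x _; unfold comb; rewrite <- vsum_scal; apply vsum_ext; intros; ring.
  - easy.
Qed.

Lemma inner_product_comb (n : nat) (y z : nat -> R) (a b : nat -> R -> R) (p : R -> R) :
  (forall i, (i < n)%nat -> cont01 (a i)) -> (forall i, (i < n)%nat -> cont01 (b i)) -> cont01 p ->
  inner (fun x => comb n y a x * comb n z b x) p =
  vsum n (fun j => vsum n (fun k => inner (fun x => a j x * b k x) p * (y j * z k))).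
Proof.
  intros Ha Hb Hp.
  rewrite (inner_ext _ p (fun x => vsum n (fun j => y j * (a j x * comb n z b x))) p); [|
    intros x _; unfold comb at 1; rewrite <- vsum_scal_r; apply vsum_ext; intros; ring|easy].
  assert (Hcb := cont_comb n z b Hb).
  rewrite (inner_comb_l n y (fun j x => a j x * comb n z b x));
    [|intros i Hi; apply continuous_on_mult; [now apply Ha|easy]|easy].
  apply vsum_ext; intros j Hj.
  rewrite (inner_ext _ p (fun x => vsum n (fun k => z k * (a j x * b k x))) p); [|
    intros x _; unfold comb; rewrite <- vsum_scal; apply vsum_ext; intros; ring|easy].
  rewrite (inner_comb_l n z (fun k x => a j x * b k x));
    [|intros i Hi; apply continuous_on_mult; [now apply Ha|now apply Hb]|easy].
  rewrite <- vsum_scal; apply vsum_ext; intros; ring.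
Qed.

Lemma lin_stiff (n : nat) (g d : R) (e f e' f' : nat -> R -> R) (z : nat -> R) (i : nat) :
  (forall i, (i < n)%nat -> C1on (e i) (e' i)) -> (forall i, (i < n)%nat -> C1on (f i) (f' i)) ->
  (i < n)%nat ->
  lin n (stiff g d e f e' f') z i =
  inner (fun x => g * comb n z e' x) (e i) + inner (fun x => d * comb n z f' x) (f i).
Proof.
  intros He Hf Hi.
  rewrite !inner_weighted_comb;
    try (intros; now apply He); try (intros; now apply Hf).
  - unfold lin, stiff; rewrite <- vsum_plus; apply vsum_ext; intros; ring.
  - now apply C1on_cont with (f' i), Hf.
  - now apply C1on_cont with (e' i), He.
Qed.

Lemma bil_transport (n : nat) (e f e' f' : nat -> R -> R) (y z : nat -> R) (i : nat) :
  (forall i, (i < n)%nat -> C1on (e i) (e' i)) -> (forall i, (i < n)%nat -> C1on (f i) (f' i)) ->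
  (i < n)%nat ->
  bil n (transport e f e' f') y z i =
  inner (fun x => (3 / 2 * comb n y e x + 1 / 2 * comb n y f x) * comb n z e' x) (e i)
  + inner (fun x => (3 / 2 * comb n y f x + 1 / 2 * comb n y e x) * comb n z f' x) (f i).
Proof.
  intros He Hf Hi.
  assert (Cei : cont01 (e i)) by now apply C1on_cont with (e' i), He.
  assert (Cfi : cont01 (f i)) by now apply C1on_cont with (f' i), Hf.
  assert (Hc : forall p q, (forall i, (i < n)%nat -> cont01 (p i)) ->
    (forall i, (i < n)%nat -> cont01 (q i)) ->
    forall i, (i < n)%nat -> cont01 (fun x => 3 / 2 * p i x + 1 / 2 * q i x)).
  { intros p q Hp Hq j Hj; apply continuous_on_plus; apply continuous_on_mult;
      try apply continuous_on_const; [now apply Hp|now apply Hq]. }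
  assert (Ce : forall i, (i < n)%nat -> cont01 (e i)) by (intros j Hj; now apply C1on_cont with (e' j), He).
  assert (Cf : forall i, (i < n)%nat -> cont01 (f i)) by (intros j Hj; now apply C1on_cont with (f' j), Hf).
  assert (Hcomb : forall p q x, 3 / 2 * comb n y p x + 1 / 2 * comb n y q x
    = comb n y (fun j x => 3 / 2 * p j x + 1 / 2 * q j x) x).
  { intros p q x; unfold comb; rewrite <- !vsum_scal, <- vsum_plus; apply vsum_ext; intros; ring. }
  rewrite (inner_ext _ (e i) (fun x => comb n y (fun j x => 3 / 2 * e j x + 1 / 2 * f j x) x
    * comb n z e' x) (e i)) by (intros; now rewrite ?Hcomb).
  rewrite (inner_ext _ (f i) (fun x => comb n y (fun j x => 3 / 2 * f j x + 1 / 2 * e j x) x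
    * comb n z f' x) (f i)) by (intros; now rewrite ?Hcomb).
  rewrite !inner_product_comb; try easy; try (intros; now apply He); try (intros; now apply Hf);
    try now apply Hc.
  unfold bil, transport; rewrite <- vsum_plus; apply vsum_ext; intros.
  rewrite <- vsum_plus; apply vsum_ext; intros; ring.
Qed.

Lemma pair_inner_comb (n : nat) (z : nat -> R) (e f : nat -> R -> R) (p q : R -> R) :
  (forall i, (i < n)%nat -> cont01 (e i)) -> (forall i, (i < n)%nat -> cont01 (f i)) ->
  cont01 p -> cont01 q ->
  vsum n (fun i => z i * (inner p (e i) + inner q (f i)))
  = inner p (comb n z e) + inner q (comb n z f).
Proof.
  intros He Hf Hp Hq; rewrite !inner_comb_r, <- vsum_plus by easy.
  apply vsum_ext; intros; ring.
Qed.

Lemma galerkin_conv (g : R) (vt v w v' p : R -> R) :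
  cont01 vt -> cont01 v -> cont01 w -> cont01 v' -> cont01 p ->
  inner vt p + inner (fun y => g * v' y) p + 3 / 2 * inner (fun y => v y * v' y) p
    + 1 / 2 * inner (fun y => w y * v' y) p
  = inner (fun y => vt y + conv g v w v' y) p.
Proof.
  intros Hvt Hv Hw Hv' Hp; unfold cont01 in *.
  rewrite (inner_ext (fun y => vt y + conv g v w v' y) p
    (fun y => vt y + (g * v' y + (3 / 2 * (v y * v' y) + 1 / 2 * (w y * v' y)))) p)
    by (intros; unfold conv; ring).
  rewrite !inner_plus_l, !inner_scal_l by (unfold cont01; cont_on).
  ring.
Qed.

(** Differentiability in norm passes to each coordinate by Cauchy-Schwarz. Hence the coordinates of
    an arbitrary semidiscrete solution solve the quadratic system, on which uniqueness rests. *)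
Lemma is_C1_map_inner (T : R) (V : (R -> R) -> Prop) (z zt : R -> R -> R) (p : R -> R) (t : R) :
  (forall f, V f -> cont01 f) -> is_C1_map T V z zt -> cont01 p -> Icc 0 T t ->
  is_derive_on 0 T (fun s => inner (z s) p) t (inner (zt t) p).
Proof.
  intros HV Hz Hp Ht; apply is_derive_on_eps; [easy|]; intros eps Heps.
  destruct (Hz t Ht) as [Hzt [Hztt [Hlim _]]].
  assert (Hn := L2norm_nonneg p).
  assert (He : 0 < eps / (L2norm p + 1)) by (apply Rdiv_lt_0_compat; lra).
  destruct (proj1 (filterlim_locally _ _) Hlim (mkposreal _ He)) as [d Hd].
  exists d; split; [apply cond_pos|]; intros s Hs Hst.
  destruct (Req_EM_T s t) as [->|Hne].
  { rewrite !Rminus_diag, Rmult_0_r, Rminus_0_r, Rabs_R0; lra. }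
  specialize (Hd s Hst Hne Hs).
  set (q := fun x => (z s x - z t x) / (s - t) - zt t x) in Hd.
  change (Rabs (L2norm q - 0) < eps / (L2norm p + 1)) in Hd.
  assert (Cs := HV _ (proj1 (Hz s Hs))); assert (Ct := HV _ Hzt); assert (Ctt := HV _ Hztt).
  assert (Cq : cont01 q).
  { unfold cont01 in *; apply (continuous_on_eq 0 1 (fun x => (z s x - z t x) * / (s - t) - zt t x));
      [easy|cont_on]. }
  assert (E : inner (z s) p - inner (z t) p - inner (zt t) p * (s - t) = (s - t) * inner q p).
  { rewrite <- inner_scal_l by easy.
    rewrite (inner_ext (fun x => (s - t) * q x) p
      (fun x => (z s x - z t x) - (s - t) * zt t x) p)
      by (intros; unfold q; field; lra || easy).
    unfold cont01 in *.
    rewrite !inner_minus_l, inner_scal_l by (unfold cont01; cont_on); ring. }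
  rewrite E, Rabs_mult, Rmult_comm.
  apply Rmult_le_compat_r; [apply Rabs_pos|].
  apply Rle_trans with (1 := inner_abs_le q p Cq Hp).
  rewrite Rminus_0_r, (Rabs_pos_eq _ (L2norm_nonneg q)) in Hd.
  apply Rle_trans with (eps / (L2norm p + 1) * (L2norm p + 1)); [|right; field; lra].
  generalize (L2norm_nonneg q); intros; nra.
Qed.

Lemma filterlim_vsum0 {S : Type} (F : (S -> Prop) -> Prop) (FF : Filter F) (n : nat)
    (f : nat -> S -> R) :
  (forall i, (i < n)%nat -> filterlim (f i) F (locally 0)) ->
  filterlim (fun s => vsum n (fun i => f i s)) F (locally 0).
Proof.
  induction n as [|n IH]; intros H; simpl; [apply filterlim_const|].
  replace 0 with (0 + 0) by ring.
  apply filterlim_Rplus; [easy|apply IH; intros; apply H; lia|apply H; lia].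
Qed.

Lemma L2norm_comb_lim {S : Type} (F : (S -> Prop) -> Prop) (FF : Filter F) (n : nat)
    (c : nat -> S -> R) (e : nat -> R -> R) (g : S -> R -> R) :
  (forall i, (i < n)%nat -> cont01 (e i)) ->
  (forall s x, g s x = comb n (fun i => c i s) e x) ->
  (forall i, (i < n)%nat -> filterlim (c i) F (locally 0)) ->
  filterlim (fun s => L2norm (g s)) F (locally 0).
Proof.
  intros He Hg Hc.
  assert (Hb : forall s, L2norm (g s) <= vsum n (fun i => Rabs (c i s) * L2norm (e i))).
  { intros s; rewrite (L2norm_ext _ (comb n (fun i => c i s) e)) by (intros; apply Hg).
    clear Hg Hc; induction n as [|n IH].
    - simpl; apply L2norm_le_sup; [apply continuous_on_const|lra|].
      intros; unfold comb; simpl; rewrite Rabs_R0; lra.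
    - unfold comb; cbn [vsum].
      assert (Hn : cont01 (fun x => c n s * e n x)).
      { apply continuous_on_mult; [apply continuous_on_const|apply He; lia]. }
      assert (Hcn : cont01 (comb n (fun i => c i s) e)).
      { apply cont_comb; intros; apply He; lia. }
      apply Rle_trans with (1 := L2norm_triang _ _ Hcn Hn).
      rewrite L2norm_scal by (apply He; lia).
      apply Rplus_le_compat_r, IH; intros; apply He; lia. }
  assert (Hl : filterlim (fun s => vsum n (fun i => Rabs (c i s) * L2norm (e i))) F (locally 0)).
  { apply (filterlim_vsum0 F FF n (fun i s => Rabs (c i s) * L2norm (e i))); intros i Hi.
    replace 0 with (Rabs 0 * L2norm (e i)) by (rewrite Rabs_R0; ring).
    apply filterlim_Rmult; [easy| |apply filterlim_const].
    apply filterlim_comp with (1 := Hc i Hi); apply (continuous_Rabs 0). }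
  apply filterlim_locally; intros eps.
  generalize (proj1 (filterlim_locally _ _) Hl eps); apply filter_imp; intros s Hs.
  change (Rabs (vsum n (fun i => Rabs (c i s) * L2norm (e i)) - 0) < eps) in Hs.
  change (Rabs (L2norm (g s) - 0) < eps).
  assert (H0 := L2norm_nonneg (g s)); specialize (Hb s).
  rewrite Rminus_0_r, Rabs_pos_eq in Hs |- *; lra.
Qed.

Lemma is_C1_map_comb (T : R) (V : (R -> R) -> Prop) (n : nat) (e : nat -> R -> R)
    (z zt : nat -> R -> R) :
  function_space V -> (forall i, (i < n)%nat -> V (e i)) ->
  (forall i t, (i < n)%nat -> Icc 0 T t -> is_derive_on 0 T (z i) t (zt i t)) ->
  (forall i, (i < n)%nat -> continuous_on (Icc 0 T) (zt i)) ->
  is_C1_map T V (fun t => comb n (fun i => z i t) e) (fun t => comb n (fun i => zt i t) e).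
Proof.
  intros HV He Hz Hzt t Ht.
  assert (Hc : forall i, (i < n)%nat -> cont01 (e i)) by (intros; now apply (fs_cont V HV), He).
  split; [exact (fs_comb V n _ e HV He)|split; [exact (fs_comb V n _ e HV He)|split]].
  - apply (L2norm_comb_lim _ _ n (fun i s => (z i s - z i t) / (s - t) - zt i t) e); [easy| |].
    + intros s x; unfold comb.
      unfold Rdiv; rewrite <- vsum_minus, <- vsum_scal_r, <- vsum_minus; apply vsum_ext; intros; ring.
    + intros i Hi; apply filterlim_locally; intros eps.
      assert (Heps : 0 < eps / 2) by (destruct eps; simpl; lra).
      destruct (proj1 (is_derive_on_eps _ _ _ _ _ Ht) (Hz i t Hi Ht) _ Heps) as [d [Hd H]].
      exists (mkposreal d Hd); intros s Hst Hne Hs; specialize (H s Hs Hst).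
      change (Rabs ((z i s - z i t) / (s - t) - zt i t - 0) < eps).
      assert (Hp : 0 < Rabs (s - t)) by (apply Rabs_pos_lt; lra).
      replace ((z i s - z i t) / (s - t) - zt i t - 0)
        with ((z i s - z i t - zt i t * (s - t)) / (s - t)) by (field; lra).
      unfold Rdiv; rewrite Rabs_mult, Rabs_inv.
      apply Rle_lt_trans with (eps / 2); [|destruct eps; simpl; lra].
      apply Rmult_le_reg_r with (Rabs (s - t)); [easy|].
      rewrite Rmult_assoc, Rinv_l by lra; lra.
  - apply (L2norm_comb_lim _ _ n (fun i s => zt i s - zt i t) e); [easy| |].
    + intros s x; unfold comb; rewrite <- vsum_minus; apply vsum_ext; intros; ring.
    + intros i Hi.
      assert (FF : Filter (within (Icc 0 T) (locally t))) by apply within_filter, locally_filter.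
      assert (H := filterlim_Rplus _ FF (zt i) (fun _ => - zt i t) _ _
        (Hzt i Hi t Ht) (filterlim_const (- zt i t))).
      rewrite Rplus_opp_r in H; exact H.
Qed.

Lemma Derive_on_comb (n : nat) (z : nat -> R) (e e' : nat -> R -> R) (v : R -> R) (y : R) :
  (forall i, (i < n)%nat -> C1on (e i) (e' i)) ->
  (forall s, Icc 0 1 s -> v s = comb n z e s) -> Icc 0 1 y ->
  Derive_on 0 1 v y = comb n z e' y.
Proof.
  intros He Hv Hy; apply Derive_on_eq; [lra|easy|].
  apply is_derive_on_eq with (comb n z e) (comb n z e' y);
    [easy|intros; now rewrite Hv|easy|now apply (C1on_comb n z e e')].
Qed.

Lemma cont_conv (g : R) (v w v' : R -> R) : cont01 v -> cont01 w -> cont01 v' -> cont01 (conv g v w v').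
Proof. intros Hv Hw Hv'; unfold cont01, conv in *; cont_on. Qed.

(** [v] and [w] need to be combinations of the basis on [[0,1]] only, so the lemma applies both to
    the constructed solution and to any competitor. *)
Lemma lin_bil_conv (n : nat) (g d : R) (e f e' f' : nat -> R -> R) (z : nat -> R)
    (v w : R -> R) (i : nat) :
  (forall i, (i < n)%nat -> C1on (e i) (e' i)) -> (forall i, (i < n)%nat -> C1on (f i) (f' i)) ->
  (forall s, Icc 0 1 s -> v s = comb n z e s /\ w s = comb n z f s) -> (i < n)%nat ->
  lin n (stiff g d e f e' f') z i + bil n (transport e f e' f') z z i =
  inner (conv g v w (Derive_on 0 1 v)) (e i) + inner (conv d w v (Derive_on 0 1 w)) (f i).
Proof.
  intros He Hf Hvw Hi.
  assert (Cei : cont01 (e i)) by now apply C1on_cont with (e' i), He.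
  assert (Cfi : cont01 (f i)) by now apply C1on_cont with (f' i), Hf.
  assert (Ce := C1on_cont _ _ (C1on_comb n z e e' He)).
  assert (Cf := C1on_cont _ _ (C1on_comb n z f f' Hf)).
  assert (Ce' := proj2 (C1on_comb n z e e' He)).
  assert (Cf' := proj2 (C1on_comb n z f f' Hf)).
  rewrite lin_stiff, bil_transport by easy.
  rewrite (inner_ext (conv g v w (Derive_on 0 1 v)) (e i) (fun x => g * comb n z e' x
    + (3 / 2 * comb n z e x + 1 / 2 * comb n z f x) * comb n z e' x) (e i)).
  2: { intros s Hs; destruct (Hvw s Hs) as [E1 E2]; unfold conv.
       rewrite (Derive_on_comb n z e e' v s He) by (easy || intros; now apply Hvw).
       now rewrite E1, E2. }
  2: easy.
  rewrite (inner_ext (conv d w v (Derive_on 0 1 w)) (f i) (fun x => d * comb n z f' x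
    + (3 / 2 * comb n z f x + 1 / 2 * comb n z e x) * comb n z f' x) (f i)).
  2: { intros s Hs; destruct (Hvw s Hs) as [E1 E2]; unfold conv.
       rewrite (Derive_on_comb n z f f' w s Hf) by (easy || intros; now apply Hvw).
       now rewrite E1, E2. }
  2: easy.
  unfold cont01 in *; rewrite !inner_plus_l by (unfold cont01; cont_on); ring.
Qed.

(* The eight terms are those of the truncated error equation tested with a basis pair. *)
Lemma error_form (n : nat) (g d mu : R) (e f e' f' : nat -> R -> R) (Z zeta : nat -> R)
    (vt wt : R -> R) (i : nat) :
  (forall i, (i < n)%nat -> C1on (e i) (e' i)) -> (forall i, (i < n)%nat -> C1on (f i) (f' i)) ->
  cont01 vt -> cont01 wt -> (i < n)%nat ->
  let A := stiff g d e f e' f' in let B := transport e f e' f' in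
  let F := fun h (e f e' : nat -> R -> R) (vt : R -> R) x =>
    (vt x + conv h (comb n Z e) (comb n Z f) (comb n Z e') x)
    - (h * comb n zeta e' x + (3 / 2 * comb n Z e x + 1 / 2 * comb n Z f x) * comb n zeta e' x)
    - (3 / 2 * comb n zeta e x + 1 / 2 * comb n zeta f x) * comb n Z e' x
    + mu * ((3 / 2 * comb n zeta e x + 1 / 2 * comb n zeta f x) * comb n zeta e' x) in
  (inner vt (e i) + inner wt (f i)) + lin n A Z i + bil n B Z Z i - lin n A zeta i
    - bil n B Z zeta i - bil n B zeta Z i + mu * bil n B zeta zeta i
  = inner (F g e f e' vt) (e i) + inner (F d f e f' wt) (f i).
Proof.
  intros He Hf Hvt Hwt Hi A B F; unfold A, B.
  assert (Cei : cont01 (e i)) by now apply C1on_cont with (e' i), He.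
  assert (Cfi : cont01 (f i)) by now apply C1on_cont with (f' i), Hf.
  assert (Ce := fun z => C1on_cont _ _ (C1on_comb n z e e' He)).
  assert (Cf := fun z => C1on_cont _ _ (C1on_comb n z f f' Hf)).
  assert (Ce' := fun z => proj2 (C1on_comb n z e e' He)).
  assert (Cf' := fun z => proj2 (C1on_comb n z f f' Hf)).
  rewrite !lin_stiff, !bil_transport by easy.
  assert (HF : forall h (e f e' : nat -> R -> R) vt p,
    (forall z, cont01 (comb n z e)) -> (forall z, cont01 (comb n z f)) ->
    (forall z, cont01 (comb n z e')) -> cont01 vt -> cont01 p ->
    inner (F h e f e' vt) p = inner vt p + inner (fun x => h * comb n Z e' x) p
      + inner (fun x => (3 / 2 * comb n Z e x + 1 / 2 * comb n Z f x) * comb n Z e' x) p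
      - inner (fun x => h * comb n zeta e' x) p
      - inner (fun x => (3 / 2 * comb n Z e x + 1 / 2 * comb n Z f x) * comb n zeta e' x) p
      - inner (fun x => (3 / 2 * comb n zeta e x + 1 / 2 * comb n zeta f x) * comb n Z e' x) p
      + mu * inner (fun x => (3 / 2 * comb n zeta e x + 1 / 2 * comb n zeta f x) * comb n zeta e' x) p).
  { clear; intros h e f e' vt p He Hf He' Hvt Hp; unfold F, conv.
    assert (Q1 := He Z); assert (Q2 := He zeta); assert (Q3 := Hf Z); assert (Q4 := Hf zeta).
    assert (Q5 := He' Z); assert (Q6 := He' zeta); clear He Hf He'; unfold cont01 in *.
    set (a1 := comb n Z e) in *; set (a2 := comb n zeta e) in *; set (b1 := comb n Z f) in *.
    set (b2 := comb n zeta f) in *; set (c1 := comb n Z e') in *; set (c2 := comb n zeta e') in *.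
    set (p1 := fun x => h * c1 x); set (p2 := fun x => (3 / 2 * a1 x + 1 / 2 * b1 x) * c1 x).
    set (p3 := fun x => h * c2 x); set (p4 := fun x => (3 / 2 * a1 x + 1 / 2 * b1 x) * c2 x).
    set (p5 := fun x => (3 / 2 * a2 x + 1 / 2 * b2 x) * c1 x).
    set (p6 := fun x => (3 / 2 * a2 x + 1 / 2 * b2 x) * c2 x).
    assert (R1 : cont01 p1) by (unfold cont01, p1; cont_on).
    assert (R2 : cont01 p2) by (unfold cont01, p2; cont_on).
    assert (R3 : cont01 p3) by (unfold cont01, p3; cont_on).
    assert (R4 : cont01 p4) by (unfold cont01, p4; cont_on).
    assert (R5 : cont01 p5) by (unfold cont01, p5; cont_on).
    assert (R6 : cont01 p6) by (unfold cont01, p6; cont_on).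
    change (inner (fun x => vt x + (p1 x + p2 x) - (p3 x + p4 x) - p5 x + mu * p6 x) p
      = inner vt p + inner p1 p + inner p2 p - inner p3 p - inner p4 p - inner p5 p + mu * inner p6 p).
    clearbody p1 p2 p3 p4 p5 p6; unfold cont01 in *.
    rewrite (inner_plus_l (fun x => vt x + (p1 x + p2 x) - (p3 x + p4 x) - p5 x) (fun x => mu * p6 x))
      by (unfold cont01; cont_on).
    rewrite (inner_minus_l (fun x => vt x + (p1 x + p2 x) - (p3 x + p4 x)) p5) by (unfold cont01; cont_on).
    rewrite (inner_minus_l (fun x => vt x + (p1 x + p2 x)) (fun x => p3 x + p4 x)) by (unfold cont01; cont_on).
    rewrite !inner_plus_l, inner_scal_l by (unfold cont01; cont_on); ring. }
  rewrite (HF g e f e' vt (e i)), (HF d f e f' wt (f i)) by easy; ring.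
Qed.

(** All dependence on the mesh is collected in [K1], [K2], [eps] and [rho]. The conditions on [rho]
    say that in the ball of that radius functions are at most [c / 4] and derivatives at most 1;
    [L <= rho^2] says that the Gronwall bound stays in the ball. *)
Lemma galerkin_mesh (r N : nat) (x : nat -> R) (T delta0 u0 K1 K2 M c eps rho : R)
    (vi wi : R -> R) (V W Vt Wt : R -> R -> R) :
  (3 <= r)%nat -> 0 < T -> 0 <= K1 ->
  (forall f y, spline r N x f -> Icc 0 1 y ->
     f y ^ 2 <= K1 * inner f f /\ Derive_on 0 1 f y ^ 2 <= K2 * inner f f) ->
  0 <= K2 -> 0 < c -> 0 <= eps -> 0 < rho -> K1 * rho ^ 2 <= (c / 4) ^ 2 -> K2 * rho ^ 2 <= 1 ->
  cont01 vi -> cont01 wi ->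
  (forall t, Icc 0 T t -> S_left r N x (V t) /\ S_left r N x (Vt t) /\
     S_right r N x (W t) /\ S_right r N x (Wt t)) ->
  (forall p t, cont01 p -> Icc 0 T t ->
     is_derive_on 0 T (fun s => inner (V s) p) t (inner (Vt t) p) /\
     is_derive_on 0 T (fun s => inner (W s) p) t (inner (Wt t) p)) ->
  (forall p, cont01 p -> continuous_on (Icc 0 T) (fun s => inner (Vt s) p) /\
     continuous_on (Icc 0 T) (fun s => inner (Wt s) p)) ->
  (forall y, Icc 0 1 y -> Rabs (V 0 y - vi y) <= eps /\ Rabs (W 0 y - wi y) <= eps) ->
  (forall t y, Icc 0 T t -> Icc 0 1 y ->
     Rabs (Derive_on 0 1 (V t) y) <= M /\ Rabs (Derive_on 0 1 (W t) y) <= M) ->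
  (forall t y, Icc 0 T t -> Icc 0 1 y ->
     Rabs (Vt t y + conv (u0 + delta0) (V t) (W t) (Derive_on 0 1 (V t)) y) <= eps /\
     Rabs (Wt t y + conv (u0 - delta0) (W t) (V t) (Derive_on 0 1 (W t)) y) <= eps) ->
  (forall t, Icc 0 T t -> c <= u0 + delta0 + (3 / 2 * V t 1 + 1 / 2 * W t 1) /\
     u0 - delta0 + (3 / 2 * W t 0 + 1 / 2 * V t 0) <= - c) ->
  let L := exp (2 * (2 * (1 + 3 * M)) * T) * (1 + 2 * T) * (2 * eps ^ 2) in
  L <= rho ^ 2 ->
  exists vh wh : R -> R -> R,
    semidiscrete_solution r N x T delta0 u0 vi wi vh wh /\
    (forall vh' wh' : R -> R -> R, semidiscrete_solution r N x T delta0 u0 vi wi vh' wh' ->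
       forall t y, Icc 0 T t -> Icc 0 1 y -> vh' t y = vh t y /\ wh' t y = wh t y) /\
    forall t, Icc 0 T t -> S_left r N x (vh t) /\ S_right r N x (wh t) /\
      inner (fun y => V t y - vh t y) (fun y => V t y - vh t y)
      + inner (fun y => W t y - wh t y) (fun y => W t y - wh t y) <= L.
Proof.
  intros Hr HT HK1 Hinv HK2 Hc Heps Hrho Hrho1 Hrho2 Hvi Hwi Hsp Hder Hcont Hini HM Hres Hbd L HL.
  assert (FL := function_space_left r N x); assert (FR := function_space_right r N x).
  destruct (orthonormal_basis (S_left r N x) (S_right r N x) K1) as [n [e [f [Ho Hrep]]]].
  { easy. } { easy. } { easy. }
  { intros g Hg y Hy; now apply Hinv; [apply Hg|]. }
  { intros g Hg y Hy; now apply Hinv; [apply Hg|]. }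
  assert (Hm := proj1 Ho).
  assert (Hsz : forall t, Icc 0 T t -> forall y, Icc 0 1 y -> 0 <= M).
  { intros t Ht y Hy; apply Rle_trans with (2 := proj1 (HM t y Ht Hy)); apply Rabs_pos. }
  assert (HM0 : 0 <= M) by (apply (Hsz 0) with 0; unfold Icc; lra).
  set (e' := fun i => Derive_on 0 1 (e i)); set (f' := fun i => Derive_on 0 1 (f i)).
  assert (HC1 : forall g, spline r N x g -> C1on g (Derive_on 0 1 g)).
  { intros g Hg; now apply (spline_C1 r N x g). }
  assert (He : forall i, (i < n)%nat -> C1on (e i) (e' i)) by (intros; now apply HC1, Hm).
  assert (Hf : forall i, (i < n)%nat -> C1on (f i) (f' i)) by (intros; now apply HC1, Hm).
  assert (Cei : forall i, (i < n)%nat -> cont01 (e i)) by (intros; now apply (fs_cont _ FL), Hm).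
  assert (Cfi : forall i, (i < n)%nat -> cont01 (f i)) by (intros; now apply (fs_cont _ FR), Hm).
  assert (HcombL : forall z, S_left r N x (comb n z e)).
  { intros z; apply (fs_comb _ n z e FL); intros; now apply Hm. }
  assert (HcombR : forall z, S_right r N x (comb n z f)).
  { intros z; apply (fs_comb _ n z f FR); intros; now apply Hm. }
  set (co := fun p q i => pair_inner p q (e i) (f i)).
  assert (Hrep' : forall v w, S_left r N x v -> S_right r N x w -> forall s, Icc 0 1 s ->
    v s = comb n (co v w) e s /\ w s = comb n (co v w) f s) by (intros; now apply Hrep).
  assert (Hco : forall z i, (i < n)%nat -> co (comb n z e) (comb n z f) i = z i).
  { intros z i Hi; exact (orthonormal_comb _ _ n e f z i FL FR Ho Hi). }
  assert (Hnorm : forall z, inner (comb n z e) (comb n z e) + inner (comb n z f) (comb n z f) = nsq n z).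
  { intros z; exact (orthonormal_norm _ _ n e f z FL FR Ho). }
  assert (Htest : forall p q, cont01 p -> cont01 q ->
    (forall i, (i < n)%nat -> inner p (e i) + inner q (f i) = 0) ->
    (forall phi, S_left r N x phi -> inner p phi = 0) /\
    (forall chi, S_right r N x chi -> inner q chi = 0)).
  { intros p q Hp Hq H0.
    assert (HH : forall z, inner p (comb n z e) + inner q (comb n z f) = 0).
    { intros z; rewrite <- pair_inner_comb by easy; apply vsum_zero; intros i Hi.
      rewrite H0 by easy; ring. }
    split; intros g Hg.
    - assert (R := Hrep' g (fun _ => 0) Hg (fs_zero _ FR)).
      specialize (HH (co g (fun _ => 0))).
      rewrite <- (inner_ext p g p _ (fun s _ => eq_refl) (fun s Hs => proj1 (R s Hs))) in HH.
      rewrite <- (inner_ext q (fun _ => 0) q _ (fun s _ => eq_refl) (fun s Hs => proj2 (R s Hs))) in HH.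
      rewrite (inner_sym q), (inner_zero_l (fun _ => 0)) in HH by easy; lra.
    - assert (R := Hrep' (fun _ => 0) g (fs_zero _ FL) Hg).
      specialize (HH (co (fun _ => 0) g)).
      rewrite <- (inner_ext p (fun _ => 0) p _ (fun s _ => eq_refl) (fun s Hs => proj1 (R s Hs))) in HH.
      rewrite <- (inner_ext q g q _ (fun s _ => eq_refl) (fun s Hs => proj2 (R s Hs))) in HH.
      rewrite (inner_sym p), (inner_zero_l (fun _ => 0)) in HH by easy; lra. }
  set (A := stiff (u0 + delta0) (u0 - delta0) e f e' f').
  set (B := transport e f e' f').
  set (Z := fun i t => co (V t) (W t) i); set (Zt := fun i t => co (Vt t) (Wt t) i).
  set (z0 := fun i => co vi wi i).
  assert (HZrep : forall t, Icc 0 T t -> forall s, Icc 0 1 s ->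
    V t s = comb n (fun i => Z i t) e s /\ W t s = comb n (fun i => Z i t) f s).
  { intros t Ht; destruct (Hsp t Ht) as [S1 [_ [S3 _]]]; now apply Hrep'. }
  (* Each of the two energy estimates yields [eps^2 / 2] and the factor [1 + 3 M]; [2 eps^2] also
     covers the initial error, which is [eps^2] for each component. *)
  destruct (quadratic_ode_exists T rho (2 * (1 + 3 * M)) (2 * eps ^ 2) n A B Z Zt z0)
    as [z [zt [Hz0 [Hztc Hz]]]].
  { easy. } { easy. } { lra. } { nra. }
  { intros i t Hi Ht; apply is_derive_on_plus; [easy| |].
    - exact (proj1 (Hder (e i) t (Cei i Hi) Ht)).
    - exact (proj2 (Hder (f i) t (Cfi i Hi) Ht)). }
  { intros i Hi; apply continuous_on_plus.
    - exact (proj1 (Hcont (e i) (Cei i Hi))).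
    - exact (proj2 (Hcont (f i) (Cfi i Hi))). }
  { intros t zeta mu Ht Hmu Hmur.
    destruct (Hsp t Ht) as [S1 [S2 [S3 S4]]].
    set (Zs := fun i => Z i t).
    assert (R := HZrep t Ht); fold Zs in R.
    assert (CVt := fs_cont _ FL _ S2); assert (CWt := fs_cont _ FR _ S4).
    rewrite (vsum_ext n _ (fun i => zeta i * (inner (fun x =>
        (Vt t x + conv (u0 + delta0) (comb n Zs e) (comb n Zs f) (comb n Zs e') x)
        - ((u0 + delta0) * comb n zeta e' x
           + (3 / 2 * comb n Zs e x + 1 / 2 * comb n Zs f x) * comb n zeta e' x)
        - (3 / 2 * comb n zeta e x + 1 / 2 * comb n zeta f x) * comb n Zs e' x
        + mu * ((3 / 2 * comb n zeta e x + 1 / 2 * comb n zeta f x) * comb n zeta e' x)) (e i)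
      + inner (fun x =>
        (Wt t x + conv (u0 - delta0) (comb n Zs f) (comb n Zs e) (comb n Zs f') x)
        - ((u0 - delta0) * comb n zeta f' x
           + (3 / 2 * comb n Zs f x + 1 / 2 * comb n Zs e x) * comb n zeta f' x)
        - (3 / 2 * comb n zeta f x + 1 / 2 * comb n zeta e x) * comb n Zs f' x
        + mu * ((3 / 2 * comb n zeta f x + 1 / 2 * comb n zeta e x) * comb n zeta f' x)) (f i)))).
    2: { intros i Hi; f_equal.
         exact (error_form n (u0 + delta0) (u0 - delta0) mu e f e' f' Zs zeta (Vt t) (Wt t) i
           He Hf CVt CWt Hi). }
    assert (C1 := fun z => C1on_comb n z e e' He); assert (C2 := fun z => C1on_comb n z f f' Hf).
    assert (Q1 := C1on_cont _ _ (C1 Zs)); assert (Q2 := C1on_cont _ _ (C1 zeta)).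
    assert (Q3 := C1on_cont _ _ (C2 Zs)); assert (Q4 := C1on_cont _ _ (C2 zeta)).
    assert (Q5 := proj2 (C1 Zs)); assert (Q6 := proj2 (C1 zeta)).
    assert (Q7 := proj2 (C2 Zs)); assert (Q8 := proj2 (C2 zeta)).
    assert (Q9 := cont_conv (u0 + delta0) _ _ _ Q1 Q3 Q5).
    assert (Q10 := cont_conv (u0 - delta0) _ _ _ Q3 Q1 Q7).
    unfold cont01 in *.
    rewrite pair_inner_comb by (easy || (unfold cont01; cont_on)).
    assert (DV : forall s, Icc 0 1 s -> Derive_on 0 1 (V t) s = comb n Zs e' s).
    { intros s Hs; apply (Derive_on_comb n Zs e e'); [easy|intros; now apply R|easy]. }
    assert (DW : forall s, Icc 0 1 s -> Derive_on 0 1 (W t) s = comb n Zs f' s).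
    { intros s Hs; apply (Derive_on_comb n Zs f f'); [easy|intros; now apply R|easy]. }
    assert (HVM : forall s, Icc 0 1 s -> Rabs (comb n Zs e' s) <= M).
    { intros s Hs; rewrite <- DV by easy; exact (proj1 (HM t s Ht Hs)). }
    assert (HWM : forall s, Icc 0 1 s -> Rabs (comb n Zs f' s) <= M).
    { intros s Hs; rewrite <- DW by easy; exact (proj2 (HM t s Ht Hs)). }
    assert (HR1 : forall s, Icc 0 1 s ->
      Rabs (Vt t s + conv (u0 + delta0) (comb n Zs e) (comb n Zs f) (comb n Zs e') s) <= eps).
    { intros s Hs; destruct (R s Hs) as [E1 E2]; unfold conv; rewrite <- E1, <- E2, <- DV by easy.
      exact (proj1 (Hres t s Ht Hs)). }
    assert (HR2 : forall s, Icc 0 1 s ->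
      Rabs (Wt t s + conv (u0 - delta0) (comb n Zs f) (comb n Zs e) (comb n Zs f') s) <= eps).
    { intros s Hs; destruct (R s Hs) as [E1 E2]; unfold conv; rewrite <- E1, <- E2, <- DW by easy.
      exact (proj2 (Hres t s Ht Hs)). }
    assert (HI1 := inner_nonneg _ Q2); assert (HI2 := inner_nonneg _ Q4).
    assert (Hnz := Hnorm zeta).
    (* [mu zeta] lies in the ball of radius [rho], where the inverse inequalities give exactly the
       smallness that the boundary terms and [energy_half] require. *)
    assert (Hsmall : forall g s, spline r N x g -> inner g g <= nsq n zeta -> Icc 0 1 s ->
      Rabs (mu * g s) <= c / 4 /\ Rabs (mu * Derive_on 0 1 g s) <= 1).
    { intros g s Hg Hgn Hs; destruct (Hinv g s Hg Hs) as [I1 I2].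
      assert (Hmu2 : 0 <= mu ^ 2) by apply pow2_ge_0.
      assert (Hpos : forall k a, 0 <= k -> a ^ 2 <= k * inner g g -> (mu * a) ^ 2 <= k * rho ^ 2).
      { intros k a Hk Ha; rewrite Rpow_mult_distr.
        apply Rle_trans with (mu ^ 2 * (k * nsq n zeta)).
        - apply Rmult_le_compat_l; [easy|]; apply Rle_trans with (1 := Ha).
          now apply Rmult_le_compat_l.
        - replace (mu ^ 2 * (k * nsq n zeta)) with (k * (mu ^ 2 * nsq n zeta)) by ring.
          now apply Rmult_le_compat_l. }
      assert (Habs : forall a b, 0 <= b -> a ^ 2 <= b ^ 2 -> Rabs a <= b).
      { intros a b Hb Hab; rewrite <- (Rabs_pos_eq b Hb); apply Rsqr_le_abs_0; unfold Rsqr; lra. }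
      split; apply Habs; try lra.
      - apply Rle_trans with (2 := Hrho1); now apply Hpos.
      - rewrite pow1; apply Rle_trans with (2 := Hrho2); now apply Hpos. }
    assert (HsL := proj1 (HcombL zeta)); assert (HsR := proj1 (HcombR zeta)).
    assert (Sth : forall s, Icc 0 1 s -> Rabs (mu * comb n zeta e s) <= c / 4 /\
      Rabs (mu * comb n zeta e' s) <= 1).
    { intros s Hs; rewrite <- (Derive_on_comb n zeta e e' (comb n zeta e) s He) by easy.
      apply Hsmall; [easy|lra|easy]. }
    assert (Sxi : forall s, Icc 0 1 s -> Rabs (mu * comb n zeta f s) <= c / 4 /\
      Rabs (mu * comb n zeta f' s) <= 1).
    { intros s Hs; rewrite <- (Derive_on_comb n zeta f f' (comb n zeta f) s Hf) by easy.
      apply Hsmall; [easy|lra|easy]. }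
    assert (I0 : Icc 0 1 0) by (unfold Icc; lra); assert (I1 : Icc 0 1 1) by (unfold Icc; lra).
    destruct (Hbd t Ht) as [B1 B2].
    destruct (R 0 I0) as [RV0 RW0]; destruct (R 1 I1) as [RV1 RW1].
    assert (Hen1 := energy_half (u0 + delta0) M mu eps (comb n zeta e) (comb n zeta e')
      (comb n zeta f) (comb n zeta f') (comb n Zs e) (comb n Zs e') (comb n Zs f) (comb n Zs f')
      (fun s => Vt t s + conv (u0 + delta0) (comb n Zs e) (comb n Zs f) (comb n Zs e') s)
      (C1 zeta) (C2 zeta) (C1 Zs) (C2 Zs) (continuous_on_plus 0 1 _ _ CVt Q9) (proj1 Hmu)
      HVM HWM (fun s Hs => proj2 (Sxi s Hs)) HR1); cbv zeta in Hen1.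
    assert (Hen2 := energy_half (u0 - delta0) M mu eps (comb n zeta f) (comb n zeta f')
      (comb n zeta e) (comb n zeta e') (comb n Zs f) (comb n Zs f') (comb n Zs e) (comb n Zs e')
      (fun s => Wt t s + conv (u0 - delta0) (comb n Zs f) (comb n Zs e) (comb n Zs f') s)
      (C2 zeta) (C1 zeta) (C2 Zs) (C1 Zs) (continuous_on_plus 0 1 _ _ CWt Q10) (proj1 Hmu)
      HWM HVM (fun s Hs => proj2 (Sth s Hs)) HR2); cbv zeta in Hen2.
    (* The factor of [a^2] is at most [- c / 2 + c / 8 + c / 16], so at the outflow end the
       quadratic boundary term dominates the cubic ones; at the inflow end the splines vanish. *)
    assert (P1 : forall G a b, 0 <= a * a -> c <= G -> Rabs (mu * a) <= c / 4 -> Rabs (mu * b) <= c / 4 ->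
      - (1 / 2) * (G * (a * a)) + mu * (1 / 2 * (a * a * a) + 1 / 4 * (b * (a * a))) <= 0).
    { intros G a b Haa HG Ha Hb; apply Rabs_le_between in Ha, Hb.
      replace (- (1 / 2) * (G * (a * a)) + mu * (1 / 2 * (a * a * a) + 1 / 4 * (b * (a * a))))
        with ((a * a) * (- (1 / 2) * G + 1 / 2 * (mu * a) + 1 / 4 * (mu * b))) by ring.
      assert (0 <= (a * a) * (1 / 2 * G - 1 / 2 * (mu * a) - 1 / 4 * (mu * b)))
        by (apply Rmult_le_pos; lra).
      lra. }
    assert (P2 : forall G a b, 0 <= a * a -> G <= - c -> Rabs (mu * a) <= c / 4 -> Rabs (mu * b) <= c / 4 ->
      0 <= - (1 / 2) * (G * (a * a)) + mu * (1 / 2 * (a * a * a) + 1 / 4 * (b * (a * a)))).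
    { intros G a b Haa HG Ha Hb; apply Rabs_le_between in Ha, Hb.
      replace (- (1 / 2) * (G * (a * a)) + mu * (1 / 2 * (a * a * a) + 1 / 4 * (b * (a * a))))
        with ((a * a) * (- (1 / 2) * G + 1 / 2 * (mu * a) + 1 / 4 * (mu * b))) by ring.
      apply Rmult_le_pos; lra. }
    match type of Hen1 with ?P -> _ => assert (Bd1 : P) end.
    { rewrite <- RV1, <- RW1, (proj2 (HcombL zeta)), !Rmult_0_r, Rplus_0_r, !Rmult_0_r, Rplus_0_r.
      apply P1; [apply Rle_0_sqr|easy|now apply Sth|now apply Sxi]. }
    match type of Hen2 with ?P -> _ => assert (Bd2 : P) end.
    { rewrite <- RV0, <- RW0, (proj2 (HcombR zeta)), !Rmult_0_r, Rplus_0_r, !Rmult_0_r, Rplus_0_r.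
      apply P2; [apply Rle_0_sqr|easy|now apply Sxi|now apply Sth]. }
    assert (G1 := Hen1 Bd1); assert (G2 := Hen2 Bd2).
    clear - G1 G2 Hnz; generalize (pow2_ge_0 eps); rewrite <- Hnz; intros; lra. }
  { assert (I0 : Icc 0 T 0) by (unfold Icc; lra).
    destruct (Hsp 0 I0) as [S1 [_ [S3 _]]].
    assert (CV := fs_cont _ FL _ S1); assert (CW := fs_cont _ FR _ S3).
    assert (Cd1 : cont01 (fun y => V 0 y - vi y)) by now apply continuous_on_minus.
    assert (Cd2 : cont01 (fun y => W 0 y - wi y)) by now apply continuous_on_minus.
    apply Rle_trans with (inner (fun y => V 0 y - vi y) (fun y => V 0 y - vi y)
      + inner (fun y => W 0 y - wi y) (fun y => W 0 y - wi y)).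
    (* [z0] holds the coordinates of the projected data, so the initial error vector has the
       coordinates of [V 0 - vi] and [W 0 - wi]. *)
    - apply Rle_trans with (2 := bessel _ _ n e f _ _ FL FR Ho Cd1 Cd2).
      right; apply vsum_ext; intros i Hi; unfold Z, z0, co, pair_inner.
      rewrite !inner_minus_l; [ring|easy|easy|now apply Cfi|easy|easy|now apply Cei].
    - assert (inner (fun y => V 0 y - vi y) (fun y => V 0 y - vi y) <= eps ^ 2)
        by (apply inner_self_le; [easy|exact (fun y Hy => proj1 (Hini y Hy))]).
      assert (inner (fun y => W 0 y - wi y) (fun y => W 0 y - wi y) <= eps ^ 2)
        by (apply inner_self_le; [easy|exact (fun y Hy => proj2 (Hini y Hy))]).
      lra. }
  { exact HL. }
  set (vh := fun t => comb n (fun i => z i t) e); set (wh := fun t => comb n (fun i => z i t) f).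
  set (vht := fun t => comb n (fun i => zt i t) e); set (wht := fun t => comb n (fun i => zt i t) f).
  assert (Hzd : forall i t, (i < n)%nat -> Icc 0 T t -> is_derive_on 0 T (z i) t (zt i t)).
  { intros i t Hi Ht; now apply (Hz t Ht). }
  assert (Cconv : forall g v w, spline r N x v -> spline r N x w ->
    cont01 (conv g v w (Derive_on 0 1 v))).
  { intros g v w Hv Hw; apply cont_conv; [now apply spline_cont with r N x..|now apply HC1]. }
  exists vh, wh; split; [|split].
  - exists vht, wht; split; [|split; [|split; [|split]]].
    + apply is_C1_map_comb; [easy|intros; now apply Hm|easy|easy].
    + apply is_C1_map_comb; [easy|intros; now apply Hm|easy|easy].
    + intros t Ht vhx whx.
      assert (S1 : S_left r N x (vh t)) by apply HcombL.
      assert (S2 : S_right r N x (wh t)) by apply HcombR.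
      assert (S3 : S_left r N x (vht t)) by apply HcombL.
      assert (S4 : S_right r N x (wht t)) by apply HcombR.
      assert (Cp := continuous_on_plus 0 1 _ _ (fs_cont _ FL _ S3) (Cconv (u0 + delta0) _ _ (proj1 S1) (proj1 S2))).
      assert (Cq := continuous_on_plus 0 1 _ _ (fs_cont _ FR _ S4) (Cconv (u0 - delta0) _ _ (proj1 S2) (proj1 S1))).
      destruct (Htest _ _ Cp Cq) as [T1 T2].
      { intros i Hi.
        assert (X1 := fs_cont _ FL _ S3); assert (X2 := fs_cont _ FR _ S4).
        assert (X3 := Cconv (u0 + delta0) _ _ (proj1 S1) (proj1 S2)).
        assert (X4 := Cconv (u0 - delta0) _ _ (proj1 S2) (proj1 S1)).
        assert (X5 := Cei i Hi); assert (X6 := Cfi i Hi).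
        rewrite !inner_plus_l by assumption.
        assert (E1 := Hco (fun i => zt i t) i Hi); unfold co, pair_inner in E1.
        assert (E2 := lin_bil_conv n (u0 + delta0) (u0 - delta0) e f e' f' (fun i => z i t) (vh t) (wh t) i
          He Hf (fun s _ => conj eq_refl eq_refl) Hi).
        assert (E3 := proj2 (proj1 (Hz t Ht) i Hi)); fold A B in E2.
        unfold vht, wht in *; lra. }
      split.
      * intros phi Hphi; rewrite galerkin_conv; [now apply T1| | | | |].
        -- apply (fs_cont _ FL _ S3).
        -- apply (fs_cont _ FL _ S1).
        -- apply (fs_cont _ FR _ S2).
        -- now apply HC1, S1.
        -- now apply (fs_cont _ FL).
      * intros chi Hchi; rewrite galerkin_conv; [now apply T2| | | | |].
        -- apply (fs_cont _ FR _ S4).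
        -- apply (fs_cont _ FR _ S2).
        -- apply (fs_cont _ FL _ S1).
        -- now apply HC1, S2.
        -- now apply (fs_cont _ FR).
    + assert (S1 : S_left r N x (vh 0)) by apply HcombL.
      assert (S2 : S_right r N x (wh 0)) by apply HcombR.
      split; [easy|]; intros phi Hphi.
      assert (Cd1 := continuous_on_minus 0 1 _ _ (fs_cont _ FL _ S1) Hvi).
      assert (Cd2 := continuous_on_minus 0 1 _ _ (fs_cont _ FR _ S2) Hwi).
      destruct (Htest _ _ Cd1 Cd2) as [T1 _].
      { intros i Hi; assert (X1 := fs_cont _ FL _ S1); assert (X2 := fs_cont _ FR _ S2).
        assert (X5 := Cei i Hi); assert (X6 := Cfi i Hi).
        rewrite !inner_minus_l by assumption.
        assert (E1 := Hco (fun i => z i 0) i Hi); unfold co, pair_inner in E1.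
        assert (E2 := Hz0 i Hi); unfold z0, co, pair_inner in E2; unfold vh, wh; lra. }
      assert (E := T1 phi Hphi); rewrite inner_minus_l in E; [lra|apply (fs_cont _ FL _ S1)|easy|].
      now apply (fs_cont _ FL).
    + assert (S1 : S_left r N x (vh 0)) by apply HcombL.
      assert (S2 : S_right r N x (wh 0)) by apply HcombR.
      split; [easy|]; intros chi Hchi.
      assert (Cd1 := continuous_on_minus 0 1 _ _ (fs_cont _ FL _ S1) Hvi).
      assert (Cd2 := continuous_on_minus 0 1 _ _ (fs_cont _ FR _ S2) Hwi).
      destruct (Htest _ _ Cd1 Cd2) as [_ T2].
      { intros i Hi; assert (X1 := fs_cont _ FL _ S1); assert (X2 := fs_cont _ FR _ S2).
        assert (X5 := Cei i Hi); assert (X6 := Cfi i Hi).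
        rewrite !inner_minus_l by assumption.
        assert (E1 := Hco (fun i => z i 0) i Hi); unfold co, pair_inner in E1.
        assert (E2 := Hz0 i Hi); unfold z0, co, pair_inner in E2; unfold vh, wh; lra. }
      assert (E := T2 chi Hchi); rewrite inner_minus_l in E; [lra|apply (fs_cont _ FR _ S2)|easy|].
      now apply (fs_cont _ FR).
  - intros vh' wh' [vht' [wht' [Hv' [Hw' [Heq [Hpv Hpw]]]]]].
    set (y := fun i t => co (vh' t) (wh' t) i); set (yt := fun i t => co (vht' t) (wht' t) i).
    (* The coordinates of the competitor start at [z0] by the projection property and solve the same
       system, as testing with the basis pairs shows. *)
    assert (Hy : forall i t, (i < n)%nat -> Icc 0 T t -> y i t = z i t).
    { apply (quadratic_ode_unique T n A B y yt z zt); [easy| | |].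
      - intros i Hi; rewrite Hz0 by easy; unfold y, z0, co, pair_inner.
        now rewrite (proj2 Hpv), (proj2 Hpw) by now apply Hm.
      - intros i t Hi Ht.
        destruct (Hv' t Ht) as [S1 [S3 _]]; destruct (Hw' t Ht) as [S2 [S4 _]].
        split.
        + apply is_derive_on_plus; [easy| |].
          * apply (is_C1_map_inner T _ vh' vht' (e i) t (fs_cont _ FL) Hv'); [now apply Cei|easy].
          * apply (is_C1_map_inner T _ wh' wht' (f i) t (fs_cont _ FR) Hw'); [now apply Cfi|easy].
        + destruct (Heq t Ht) as [Q1 Q2]; specialize (Q1 (e i) (proj1 (Hm i Hi))).
          specialize (Q2 (f i) (proj2 (Hm i Hi))).
          assert (X1 := fs_cont _ FL _ S1); assert (X2 := fs_cont _ FR _ S2).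
          assert (X3 := fs_cont _ FL _ S3); assert (X4 := fs_cont _ FR _ S4).
          assert (X5 := Cei i Hi); assert (X6 := Cfi i Hi).
          assert (X7 := proj2 (HC1 _ (proj1 S1))); assert (X8 := proj2 (HC1 _ (proj1 S2))).
          assert (X9 := Cconv (u0 + delta0) _ _ (proj1 S1) (proj1 S2)).
          assert (X10 := Cconv (u0 - delta0) _ _ (proj1 S2) (proj1 S1)).
          rewrite galerkin_conv, inner_plus_l in Q1 by assumption.
          rewrite galerkin_conv, inner_plus_l in Q2 by assumption.
          assert (E2 := lin_bil_conv n (u0 + delta0) (u0 - delta0) e f e' f' (fun i => y i t)
            (vh' t) (wh' t) i He Hf (Hrep' _ _ S1 S2) Hi); fold A B in E2.
          unfold yt, co, pair_inner; lra.
      - intros i t Hi Ht; now apply (Hz t Ht). }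
    intros t s Ht Hs; destruct (Hv' t Ht) as [S1 _]; destruct (Hw' t Ht) as [S2 _].
    destruct (Hrep' _ _ S1 S2 s Hs) as [-> ->].
    split; apply vsum_ext; intros i Hi; now rewrite <- (Hy i t Hi Ht).
  - intros t Ht; split; [apply HcombL|split; [apply HcombR|]].
    apply Rle_trans with (2 := proj2 (Hz t Ht)).
    rewrite <- Hnorm; right; f_equal; apply inner_ext; intros s Hs;
      destruct (HZrep t Ht s Hs) as [E1 E2]; rewrite ?E1, ?E2; unfold vh, wh, comb;
      rewrite <- vsum_minus; apply vsum_ext; intros; ring.
Qed.

(** * Convergence *)

(** The exact equation is subtracted, and each difference is bounded by [eta]. The factors 2 before
    [M] and [M0] are the sum [3/2 + 1/2] of the transport coefficients. *)
Lemma residual_bound (g v w v' vt V W V' Vt eta M M0 : R) :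
  vt + (g + (3 * v + w) / 2) * v' = 0 ->
  Rabs (vt - Vt) <= eta -> Rabs (v - V) <= eta -> Rabs (w - W) <= eta -> Rabs (v' - V') <= eta ->
  Rabs V' <= M -> Rabs v <= M0 -> Rabs w <= M0 ->
  Rabs (Vt + (g * V' + (3 / 2 * V + 1 / 2 * W) * V')) <= eta * (1 + Rabs g + 2 * M + 2 * M0).
Proof.
  intros E H1 H2 H3 H4 HV Hv Hw.
  replace (Vt + (g * V' + (3 / 2 * V + 1 / 2 * W) * V'))
    with (- (vt - Vt) + (- g * (v' - V') + (- (3 / 2 * (v - V) + 1 / 2 * (w - W)) * V'
      + - (3 / 2 * v + 1 / 2 * w) * (v' - V'))) + (vt + (g + (3 * v + w) / 2) * v')) by field.
  rewrite E, Rplus_0_r.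
  assert (B1 : Rabs (- g * (v' - V')) <= Rabs g * eta).
  { rewrite Rabs_mult, Rabs_Ropp; apply Rmult_le_compat_l; [apply Rabs_pos|easy]. }
  assert (B2 : Rabs (- (3 / 2 * (v - V) + 1 / 2 * (w - W)) * V') <= 2 * eta * M).
  { rewrite Rabs_mult, Rabs_Ropp; apply Rmult_le_compat; try apply Rabs_pos; [|easy].
    apply Rabs_le_between in H2, H3; apply Rabs_le; lra. }
  assert (B3 : Rabs (- (3 / 2 * v + 1 / 2 * w) * (v' - V')) <= 2 * M0 * eta).
  { rewrite Rabs_mult, Rabs_Ropp; apply Rmult_le_compat; try apply Rabs_pos; [|easy].
    apply Rabs_le_between in Hv, Hw; apply Rabs_le; lra. }
  rewrite <- Rabs_Ropp in H1.
  apply Rle_trans with (1 := Rabs_triang _ _).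
  assert (B4 := Rabs_triang (- g * (v' - V')) (- (3 / 2 * (v - V) + 1 / 2 * (w - W)) * V'
      + - (3 / 2 * v + 1 / 2 * w) * (v' - V'))).
  assert (B5 := Rabs_triang (- (3 / 2 * (v - V) + 1 / 2 * (w - W)) * V')
      (- (3 / 2 * v + 1 / 2 * w) * (v' - V'))).
  lra.
Qed.

Lemma Cm_rect_le (T : R) (m k : nat) (f : R -> R -> R) : (k <= m)%nat -> Cm_rect T m f -> Cm_rect T k f.
Proof.
  intros Hk [D [H0 [H1 H2]]]; exists D; split; [easy|split].
  - intros i j x t Hij; apply H1; lia.
  - intros i j Hij; apply H2; lia.
Qed.

Lemma partition_mesh_pos (N : nat) (x : nat -> R) : is_partition N x -> 0 < mesh_max N x.
Proof.
  intros HP; assert (HN := partition_N_pos N x HP).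
  assert (H := mesh_bounds N x 1 ltac:(lia)); assert (H' := proj2 (proj2 HP) 1%nat ltac:(lia)); lra.
Qed.

(* The truncation radius is [rho = sqrt (c1 h^3)]: the inverse inequalities turn it into
   bounds on the maximum norm and on the derivative, and [r >= 3] makes the error
   [O(h^(r-1))] eventually smaller than [rho]. *)
Lemma diag_convergence (r : nat) (T delta0 u0 c0 M0 kappa : R) (vi wi : R -> R)
    (v w : R -> R -> R) (av bv aw bw : R -> nat -> R -> R) :
  (3 <= r)%nat -> 0 < T -> 0 < c0 -> 0 <= M0 -> 1 <= kappa ->
  diag_solution T delta0 u0 vi wi v w ->
  (forall x t, av t 0%nat x = v x t /\ aw t 0%nat x = w x t) ->
  (forall t, Icc 0 T t -> tower r (av t) /\ tower r (bv t) /\ tower r (aw t) /\ tower r (bw t)) ->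
  (forall i p, (i <= r)%nat -> Icc 0 1 p ->
     continuous_on (Icc 0 T) (fun t => bv t i p) /\ continuous_on (Icc 0 T) (fun t => bw t i p) /\
     forall t, Icc 0 T t ->
       is_derive_on 0 T (fun t => av t i p) t (bv t i p) /\
       is_derive_on 0 T (fun t => aw t i p) t (bw t i p) /\
       Rabs (av t i p) <= M0 /\ Rabs (bv t i p) <= M0 /\
       Rabs (aw t i p) <= M0 /\ Rabs (bw t i p) <= M0) ->
  (forall t, Icc 0 T t -> c0 <= u0 + delta0 + (3 * v 1 t + w 1 t) / 2 /\
     u0 - delta0 + (v 0 t + 3 * w 0 t) / 2 <= - c0) ->
  exists h0 C S, 0 < h0 /\ 0 <= C /\ 0 <= S /\
  forall (N : nat) (x : nat -> R), is_partition N x ->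
    mesh_max N x <= h0 -> mesh_max N x <= kappa * mesh_min N x ->
    exists vh wh : R -> R -> R,
      semidiscrete_solution r N x T delta0 u0 vi wi vh wh /\
      (forall vh' wh' : R -> R -> R, semidiscrete_solution r N x T delta0 u0 vi wi vh' wh' ->
         forall t y, Icc 0 T t -> Icc 0 1 y -> vh' t y = vh t y /\ wh' t y = wh t y) /\
      forall t, Icc 0 T t -> cont01 (vh t) /\ cont01 (wh t) /\
        L2norm (fun y => v y t - vh t y) + L2norm (fun y => w y t - wh t y)
          <= C * mesh_max N x ^ (r - 1) /\
        forall y, Icc 0 1 y -> Rabs (v y t - vh t y) <= S /\ Rabs (w y t - wh t y) <= S.
Proof.
  intros Hr HT Hc0 HM0 Hkap [Hdv Hdw Hinit Hbdry] Hval Htow Hjet Hspeed.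
  destruct (spline_approx r Hr) as [Ca [HCa Happ]].
  destruct (spline_inverse r Hr) as [Ki [HKi Hinv]].
  assert (H01 : 0 < 1) by lra.
  assert (I0 : Icc 0 1 0) by (unfold Icc; lra); assert (I1 : Icc 0 1 1) by (unfold Icc; lra).
  assert (IT : Icc 0 T 0) by (unfold Icc; lra).
  (* The inflow values vanish for all times, hence so do their time derivatives; therefore [v_t] and
     [w_t] too are approximated with full accuracy by splines vanishing there. *)
  assert (Hb0 : forall t, Icc 0 T t -> av t 0%nat 0 = 0 /\ bv t 0%nat 0 = 0 /\
    aw t 0%nat 1 = 0 /\ bw t 0%nat 1 = 0).
  { intros t Ht; rewrite (proj1 (Hval 0 t)), (proj2 (Hval 1 t)).
    destruct (Hbdry t Ht) as [-> ->]; split; [easy|split; [|split; [easy|]]].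
    - apply (is_derive_on_unique 0 T (fun s => av s 0%nat 0) t); [easy|easy|apply Hjet; easy || lia|].
      apply is_derive_on_eq with (fun _ => 0) 0; [easy| |easy|now apply is_derive_on_const].
      intros s Hs; rewrite (proj1 (Hval 0 s)); symmetry; now apply Hbdry.
    - apply (is_derive_on_unique 0 T (fun s => aw s 0%nat 1) t); [easy|easy|apply Hjet; easy || lia|].
      apply is_derive_on_eq with (fun _ => 0) 0; [easy| |easy|now apply is_derive_on_const].
      intros s Hs; rewrite (proj2 (Hval 1 s)); symmetry; now apply Hbdry. }
  assert (Hpde : forall t y, Icc 0 T t -> Icc 0 1 y ->
    bv t 0%nat y + (u0 + delta0 + (3 * v y t + w y t) / 2) * av t 1%nat y = 0 /\
    bw t 0%nat y + (u0 - delta0 + (3 * w y t + v y t) / 2) * aw t 1%nat y = 0).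
  { intros t y Ht Hy.
    destruct (Htow t Ht) as [T1 [_ [T3 _]]].
    destruct (Hjet 0%nat y ltac:(lia) Hy) as [_ [_ J]]; destruct (J t Ht) as [J1 [J2 _]].
    assert (E1 := Hdv y t Hy Ht); assert (E2 := Hdw y t Hy Ht); unfold Defs.Dx, Defs.Dt in E1, E2.
    rewrite (Derive_on_eq 0 T (fun s => v y s) t (bv t 0%nat y)) in E1; [|easy|easy|].
    2: { apply is_derive_on_eq with (fun s => av s 0%nat y) (bv t 0%nat y);
         [easy|intros; apply Hval|easy|easy]. }
    rewrite (Derive_on_eq 0 1 (fun z => v z t) y (av t 1%nat y)) in E1; [|easy|easy|].
    2: { apply is_derive_on_eq with (av t 0%nat) (av t 1%nat y);
         [easy|intros; apply Hval|easy|apply T1; easy || lia]. }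
    rewrite (Derive_on_eq 0 T (fun s => w y s) t (bw t 0%nat y)) in E2; [|easy|easy|].
    2: { apply is_derive_on_eq with (fun s => aw s 0%nat y) (bw t 0%nat y);
         [easy|intros; apply Hval|easy|easy]. }
    rewrite (Derive_on_eq 0 1 (fun z => w z t) y (aw t 1%nat y)) in E2; [|easy|easy|].
    2: { apply is_derive_on_eq with (aw t 0%nat) (aw t 1%nat y);
         [easy|intros; apply Hval|easy|apply T3; easy || lia]. }
    split; [easy|]; rewrite <- E2; field. }
  assert (Cav : forall t, Icc 0 T t -> cont01 (av t 0%nat) /\ cont01 (aw t 0%nat)).
  { intros t Ht; destruct (Htow t Ht) as [T1 [_ [T3 _]]]; split.
    - apply continuous_on_derive with (av t 1%nat); intros y Hy; apply T1; easy || lia.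
    - apply continuous_on_derive with (aw t 1%nat); intros y Hy; apply T3; easy || lia. }
  assert (Hvi : forall y, Icc 0 1 y -> vi y = av 0 0%nat y /\ wi y = aw 0 0%nat y).
  { intros y Hy; destruct (Hinit y Hy) as [<- <-]; split; symmetry; apply Hval. }
  set (E0 := Ca * M0).
  assert (HE0 : 0 <= E0) by now apply Rmult_le_pos.
  set (M := M0 + E0).
  (* The constant of [residual_bound], with both absolute values added so that it serves the two
     equations; being at least [E0], it covers the initial error as well. *)
  set (Ce := E0 * (1 + (Rabs (u0 + delta0) + Rabs (u0 - delta0)) + 2 * M + 2 * M0)).
  assert (Hg1 := Rabs_pos (u0 + delta0)); assert (Hg2 := Rabs_pos (u0 - delta0)).
  assert (HECe : E0 <= Ce) by (unfold Ce, M; rewrite <- (Rmult_1_r E0) at 1;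
    apply Rmult_le_compat_l; lra).
  (* Chosen so that [Ki kappa^3 c1] is at most 1 and at most [(c0 / 8)^2]. The cube of [kappa] comes
     from [h / kappa] as lower bound of the cells, and [+ 1] excludes a zero denominator. *)
  set (c1 := Rmin 1 ((c0 / 8) ^ 2) / (Ki * kappa ^ 3 + 1)).
  assert (Hk3 : 1 <= kappa ^ 3) by (apply pow_R1_Rle; lra).
  assert (HKk : 0 <= Ki * kappa ^ 3) by (apply Rmult_le_pos; lra).
  assert (Hc8 : 0 < (c0 / 8) ^ 2) by (apply pow_lt; lra).
  assert (Hc1 : 0 < c1).
  { apply Rdiv_lt_0_compat; [apply Rmin_pos|]; lra. }
  assert (Hc1' : Ki * kappa ^ 3 * c1 <= 1 /\ Ki * kappa ^ 3 * c1 <= (c0 / 8) ^ 2).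
  { assert (H : Ki * kappa ^ 3 * c1 <= Rmin 1 ((c0 / 8) ^ 2)).
    { assert (E : (Ki * kappa ^ 3 + 1) * c1 = Rmin 1 ((c0 / 8) ^ 2)) by (unfold c1; field; lra).
      rewrite <- E; nra. }
    split; apply Rle_trans with (1 := H); [apply Rmin_l|apply Rmin_r]. }
  set (Cl := exp (2 * (2 * (1 + 3 * M)) * T) * (1 + 2 * T) * (2 * Ce ^ 2)).
  assert (HCl : 0 <= Cl).
  { unfold Cl; apply Rmult_le_pos; [apply Rmult_le_pos; [left; apply exp_pos|lra]|].
    generalize (pow2_ge_0 Ce); lra. }
  (* The second bound on [h] keeps the speeds of the approximations beyond [c0 / 2] at the outflow
     ends, the third makes the Gronwall bound fit into the ball. [E0 + c0 / 8] adds the spline error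
     and the size of ball elements in the maximum norm. *)
  exists (Rmin 1 (Rmin (c0 / (4 * (E0 + 1))) (c1 / (Cl + 1)))), (2 * (E0 + sqrt Cl)), (E0 + c0 / 8).
  split; [|split; [|split]].
  { repeat apply Rmin_pos; try lra; apply Rdiv_lt_0_compat; lra. }
  { generalize (sqrt_pos Cl); lra. }
  { lra. }
  intros N x HP Hh0 Hhk; set (h := mesh_max N x) in *.
  assert (Hh : 0 < h) by now apply partition_mesh_pos.
  assert (Hh1 : h <= 1) by (apply Rle_trans with (1 := Hh0), Rmin_l).
  assert (Hh2 : 2 * E0 * h <= c0 / 2).
  { assert (H : h <= c0 / (4 * (E0 + 1))).
    { apply Rle_trans with (1 := Hh0); eapply Rle_trans; [apply Rmin_r|apply Rmin_l]. }
    apply Rle_trans with (2 * (E0 + 1) * (c0 / (4 * (E0 + 1)))); [|right; field; lra].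
    apply Rmult_le_compat; lra. }
  assert (Hh3 : Cl * h <= c1).
  { assert (H : h <= c1 / (Cl + 1)).
    { apply Rle_trans with (1 := Hh0); eapply Rle_trans; [apply Rmin_r|apply Rmin_r]. }
    apply Rle_trans with ((Cl + 1) * (c1 / (Cl + 1))); [|right; field; lra].
    apply Rmult_le_compat; lra. }
  assert (Hhp : forall k, 0 < h ^ k) by (intros; now apply pow_lt).
  assert (Hhr : h ^ (r - 1) <= h).
  { replace (r - 1)%nat with (S (r - 2)) by lia; simpl.
    assert (h ^ (r - 2) <= 1) by (rewrite <- (pow1 (r - 2)); apply pow_incr; lra).
    generalize (Hhp (r - 2)%nat); intros; nra. }
  set (eta := E0 * h ^ (r - 1)).
  assert (Heta : 0 <= eta) by (apply Rmult_le_pos; [easy|left; apply Hhp]).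
  assert (HetaE : eta <= E0 * h) by now apply Rmult_le_compat_l.
  assert (HetaE' : eta <= E0) by nra.
  destruct (Happ N x HP) as [QL [QR [PL [PR [SL [SR Herr]]]]]]; fold h in Herr.
  assert (Hspc : forall f, spline r N x f -> cont01 f) by (intros; now apply spline_cont with r N x).
  assert (EL : forall t y, Icc 0 T t -> Icc 0 1 y ->
    Rabs (av t 1%nat y - Derive_on 0 1 (QL (av t)) y) <= eta /\
    Rabs (v y t - QL (av t) y) <= eta /\ Rabs (bv t 0%nat y - QL (bv t) y) <= eta).
  { intros t y Ht Hy; destruct (Htow t Ht) as [T1 [T2 _]]; destruct (Hb0 t Ht) as [Z1 [Z2 _]].
    assert (B : forall z, Icc 0 1 z -> Rabs (av t r z) <= M0 /\ Rabs (bv t r z) <= M0)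
      by (intros z Hz; split; apply Hjet; easy || lia).
    destruct (Herr (av t) M0 y T1 (fun z Hz => proj1 (B z Hz)) Hy) as [R1 [_ [R2 _]]].
    destruct (Herr (bv t) M0 y T2 (fun z Hz => proj2 (B z Hz)) Hy) as [_ [_ [R3 _]]].
    rewrite <- (proj1 (Hval y t)); split; [easy|split; [now apply R2|now apply R3]]. }
  assert (ER : forall t y, Icc 0 T t -> Icc 0 1 y ->
    Rabs (aw t 1%nat y - Derive_on 0 1 (QR (aw t)) y) <= eta /\
    Rabs (w y t - QR (aw t) y) <= eta /\ Rabs (bw t 0%nat y - QR (bw t) y) <= eta).
  { intros t y Ht Hy; destruct (Htow t Ht) as [_ [_ [T1 T2]]]; destruct (Hb0 t Ht) as [_ [_ [Z1 Z2]]].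
    assert (B : forall z, Icc 0 1 z -> Rabs (aw t r z) <= M0 /\ Rabs (bw t r z) <= M0)
      by (intros z Hz; split; apply Hjet; easy || lia).
    destruct (Herr (aw t) M0 y T1 (fun z Hz => proj1 (B z Hz)) Hy) as [_ [R1 [_ R2]]].
    destruct (Herr (bw t) M0 y T2 (fun z Hz => proj2 (B z Hz)) Hy) as [_ [_ [_ R3]]].
    rewrite <- (proj2 (Hval y t)); split; [easy|split; [now apply R2|now apply R3]]. }
  assert (Hsup : forall t y, Icc 0 T t -> Icc 0 1 y ->
    Rabs (v y t) <= M0 /\ Rabs (w y t) <= M0 /\ Rabs (av t 1%nat y) <= M0 /\ Rabs (aw t 1%nat y) <= M0).
  { intros t y Ht Hy; rewrite <- (proj1 (Hval y t)), <- (proj2 (Hval y t)).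
    split; [|split; [|split]]; apply Hjet; easy || lia. }
  assert (HM : forall t y, Icc 0 T t -> Icc 0 1 y ->
    Rabs (Derive_on 0 1 (QL (av t)) y) <= M /\ Rabs (Derive_on 0 1 (QR (aw t)) y) <= M).
  { intros t y Ht Hy; destruct (EL t y Ht Hy) as [R1 _]; destruct (ER t y Ht Hy) as [R2 _].
    destruct (Hsup t y Ht Hy) as [_ [_ [B1 B2]]]; apply Rabs_le_between in R1, R2, B1, B2.
    unfold M; split; apply Rabs_le; lra. }
  set (rho := sqrt (c1 * h ^ 3)).
  assert (Hrho2 : rho ^ 2 = c1 * h ^ 3).
  { apply pow2_sqrt.
    apply Rmult_le_pos; [lra|left; apply Hhp]. }
  assert (HL : exp (2 * (2 * (1 + 3 * M)) * T) * (1 + 2 * T) * (2 * (Ce * h ^ (r - 1)) ^ 2)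
    = Cl * (h ^ (r - 1)) ^ 2) by (unfold Cl; ring).
  assert (HK2 : Ki / (h / kappa) ^ 3 * rho ^ 2 = Ki * kappa ^ 3 * c1).
  { rewrite Hrho2; field; lra. }
  assert (HK1 : Ki / (h / kappa) * rho ^ 2 <= (c0 / 8) ^ 2).
  { apply Rle_trans with (2 := proj2 Hc1').
    replace (Ki / (h / kappa) * rho ^ 2) with (Ki * c1 * (kappa * h ^ 2)) by (rewrite Hrho2; field; lra).
    replace (Ki * kappa ^ 3 * c1) with (Ki * c1 * (kappa * kappa ^ 2)) by ring.
    apply Rmult_le_compat_l; [apply Rmult_le_pos; lra|].
    apply Rmult_le_compat_l; [lra|apply pow_incr; lra]. }
  assert (HLr : Cl * (h ^ (r - 1)) ^ 2 <= rho ^ 2).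
  { rewrite Hrho2.
    (* As [r - 1 >= 2], the squared error is [O(h^4)]; the power of [h] to spare over
       [rho^2 = c1 h^3] absorbs the constant [Cl]. *)
    assert (Hh4 : (h ^ (r - 1)) ^ 2 <= h * h ^ 3).
    { replace (h * h ^ 3) with ((h ^ 2) ^ 2) by ring; apply pow_incr; split; [left; apply Hhp|].
      replace (r - 1)%nat with (2 + (r - 3))%nat by lia; rewrite pow_add.
      rewrite <- (Rmult_1_r (h ^ 2)) at 2; apply Rmult_le_compat_l; [left; apply Hhp|].
      rewrite <- (pow1 (r - 3)); apply pow_incr; lra. }
    apply Rle_trans with (Cl * (h * h ^ 3)); [now apply Rmult_le_compat_l|].
    rewrite <- Rmult_assoc; apply Rmult_le_compat_r; [left; apply Hhp|easy]. }
  assert (Hhm : 0 < h / kappa) by (apply Rdiv_lt_0_compat; lra).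
  assert (Hlen : forall j, (1 <= j <= N)%nat -> h / kappa <= x (j + 1)%nat - x j).
  { intros j Hj; apply Rle_trans with (2 := proj1 (mesh_bounds N x j Hj)).
    apply Rmult_le_reg_r with kappa; [lra|].
    unfold Rdiv; rewrite Rmult_assoc, Rinv_l, Rmult_1_r by lra; lra. }
  assert (HK10 : 0 <= Ki / (h / kappa)).
  { apply Rmult_le_pos; [easy|left; now apply Rinv_0_lt_compat]. }
  assert (HK20 : 0 <= Ki / (h / kappa) ^ 3).
  { apply Rmult_le_pos; [easy|left; apply Rinv_0_lt_compat; now apply pow_lt]. }
  destruct (galerkin_mesh r N x T delta0 u0 (Ki / (h / kappa)) (Ki / (h / kappa) ^ 3) M (c0 / 2)
    (Ce * h ^ (r - 1)) rho vi wi (fun t => QL (av t)) (fun t => QR (aw t))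
    (fun t => QL (bv t)) (fun t => QR (bw t))) as [vh [wh [Hsol [Huniq Hest]]]].
  { easy. } { easy. } { easy. }
  { intros f y Hf Hy; now apply (Hinv N x (h / kappa) f y). }
  { easy. } { lra. }
  { apply Rmult_le_pos; [lra|left; apply Hhp]. }
  { apply sqrt_lt_R0, Rmult_lt_0_compat; [easy|apply Hhp]. }
  { replace (c0 / 2 / 4) with (c0 / 8) by field; easy. }
  { rewrite HK2; apply Hc1'. }
  { apply continuous_on_eq with (av 0 0%nat); [intros; symmetry; now apply Hvi|now apply Cav]. }
  { apply continuous_on_eq with (aw 0 0%nat); [intros; symmetry; now apply Hvi|now apply Cav]. }
  { intros t _; split; [apply SL|split; [apply SL|split; apply SR]]. }
  { intros p t Hp Ht; split.
    - apply (point_op_time (spline r N x) r QL T av bv p t); [easy|easy|easy|easy|].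
      intros i q Hi Hq; now apply Hjet.
    - apply (point_op_time (spline r N x) r QR T aw bw p t); [easy|easy|easy|easy|].
      intros i q Hi Hq; now apply Hjet. }
  { intros p Hp; split.
    - apply (point_op_time_cont (spline r N x) r QL T bv p); [easy|easy|easy|].
      intros i q Hi Hq; now apply Hjet.
    - apply (point_op_time_cont (spline r N x) r QR T bw p); [easy|easy|easy|].
      intros i q Hi Hq; now apply Hjet. }
  { assert (He : eta <= Ce * h ^ (r - 1)).
    { apply Rmult_le_compat_r; [left; apply Hhp|easy]. }
    intros y Hy; destruct (Hvi y Hy) as [-> ->]; rewrite (proj1 (Hval y 0)), (proj2 (Hval y 0)).
    rewrite (Rabs_minus_sym (QL _ y)), (Rabs_minus_sym (QR _ y)).
    split; apply Rle_trans with (2 := He); [now apply EL|now apply ER]. }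
  { exact HM. }
  { intros t y Ht Hy; destruct (Hpde t y Ht Hy) as [P1 P2].
    destruct (EL t y Ht Hy) as [A1 [A2 A3]]; destruct (ER t y Ht Hy) as [B1 [B2 B3]].
    destruct (Hsup t y Ht Hy) as [U1 [U2 _]]; destruct (HM t y Ht Hy) as [D1 D2].
    unfold conv; split.
    - apply Rle_trans with (1 := residual_bound _ _ _ _ _ _ _ _ _ eta M M0 P1 A3 A2 B2 A1 D1 U1 U2).
      unfold eta, Ce; replace (E0 * (1 + (Rabs (u0 + delta0) + Rabs (u0 - delta0)) + 2 * M + 2 * M0) * h ^ (r - 1))
        with (eta * (1 + (Rabs (u0 + delta0) + Rabs (u0 - delta0)) + 2 * M + 2 * M0)) by (unfold eta; ring).
      apply Rmult_le_compat_l; [easy|lra].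
    - apply Rle_trans with (1 := residual_bound _ _ _ _ _ _ _ _ _ eta M M0 P2 B3 B2 A2 B1 D2 U2 U1).
      unfold eta, Ce; replace (E0 * (1 + (Rabs (u0 + delta0) + Rabs (u0 - delta0)) + 2 * M + 2 * M0) * h ^ (r - 1))
        with (eta * (1 + (Rabs (u0 + delta0) + Rabs (u0 - delta0)) + 2 * M + 2 * M0)) by (unfold eta; ring).
      apply Rmult_le_compat_l; [easy|lra]. }
  { intros t Ht; destruct (Hspeed t Ht) as [S1 S2].
    destruct (EL t 1 Ht I1) as [_ [A1 _]]; destruct (ER t 1 Ht I1) as [_ [B1 _]].
    destruct (EL t 0 Ht I0) as [_ [A0 _]]; destruct (ER t 0 Ht I0) as [_ [B0 _]].
    apply Rabs_le_between in A1, B1, A0, B0; split; lra. }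
  { rewrite HL; easy. }
  cbv zeta in Hest; rewrite HL in Hest.
  exists vh, wh; split; [easy|split; [easy|]].
  intros t Ht; destruct (Hest t Ht) as [S1 [S2 Hsum]].
  assert (Cvh := Hspc _ (proj1 S1)); assert (Cwh := Hspc _ (proj1 S2)).
  split; [easy|split; [easy|]].
  (* Besides the norm estimate, the inverse inequality gives a bound in the maximum norm, which the
     quadratic expression of [eta_h] in [v_h - w_h] will need. *)
  assert (Hone : forall (a : R -> R) (V vv : R -> R), spline r N x V -> spline r N x vv -> cont01 a ->
    (forall y, Icc 0 1 y -> Rabs (a y - V y) <= eta) ->
    inner (fun y => V y - vv y) (fun y => V y - vv y) <= Cl * (h ^ (r - 1)) ^ 2 ->
    L2norm (fun y => a y - vv y) <= (E0 + sqrt Cl) * h ^ (r - 1) /\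
    forall y, Icc 0 1 y -> Rabs (a y - vv y) <= E0 + c0 / 8).
  { intros a V vv SV Svv Ca' Hav Hin.
    assert (CV := Hspc _ SV); assert (Cvv := Hspc _ Svv).
    assert (D1 : cont01 (fun y => a y - V y)) by now apply continuous_on_minus.
    assert (D2 : cont01 (fun y => V y - vv y)) by now apply continuous_on_minus.
    split.
    - rewrite (L2norm_ext _ (fun y => (a y - V y) + (V y - vv y))) by (intros; ring).
      apply Rle_trans with (1 := L2norm_triang _ _ D1 D2).
      rewrite Rmult_plus_distr_r; apply Rplus_le_compat.
      + now apply L2norm_le_sup.
      + apply L2norm_le_sqr; [apply Rmult_le_pos; [apply sqrt_pos|left; apply Hhp]|].
        rewrite Rpow_mult_distr; apply Rle_trans with (1 := Hin); right; f_equal.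
        symmetry; now apply pow2_sqrt.
    - intros y Hy.
      assert (Hs : spline r N x (fun y => V y + (-1) * vv y)).
      { apply spline_plus; [easy|now apply spline_scal]. }
      destruct (Hinv N x (h / kappa) _ y HP Hhm Hlen Hs Hy) as [Hi _]; cbv beta in Hi.
      rewrite (inner_ext _ _ (fun y => V y - vv y) (fun y => V y - vv y)) in Hi by (intros; ring).
      assert (Hd : (V y + -1 * vv y) ^ 2 <= (c0 / 8) ^ 2).
      { apply Rle_trans with (1 := Hi), Rle_trans with (2 := HK1).
        apply Rmult_le_compat_l; [easy|]; now apply Rle_trans with (1 := Hin). }
      assert (Hd' : Rabs (V y + -1 * vv y) <= c0 / 8).
      { rewrite <- (Rabs_pos_eq (c0 / 8)) by lra; apply Rsqr_le_abs_0; unfold Rsqr; lra. }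
      replace (a y - vv y) with ((a y - V y) + (V y + -1 * vv y)) by ring.
      apply Rle_trans with (1 := Rabs_triang _ _).
      apply Rplus_le_compat; [|easy]; apply Rle_trans with (2 := HetaE'); now apply Hav. }
  assert (Cd1 : cont01 (fun y => QL (av t) y - vh t y))
    by (apply continuous_on_minus; [apply Hspc, SL|easy]).
  assert (Cd2 : cont01 (fun y => QR (aw t) y - wh t y))
    by (apply continuous_on_minus; [apply Hspc, SR|easy]).
  assert (P1 := inner_nonneg _ Cd1); assert (P2 := inner_nonneg _ Cd2).
  assert (Cv : cont01 (fun y => v y t)).
  { apply continuous_on_eq with (av t 0%nat); [intros; apply Hval|now apply Cav]. }
  assert (Cw : cont01 (fun y => w y t)).
  { apply continuous_on_eq with (aw t 0%nat); [intros; apply Hval|now apply Cav]. }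
  destruct (Hone (fun y => v y t) (QL (av t)) (vh t) (proj1 (SL _)) (proj1 S1) Cv
    (fun y Hy => proj1 (proj2 (EL t y Ht Hy))) ltac:(lra)) as [F1 F2].
  destruct (Hone (fun y => w y t) (QR (aw t)) (wh t) (proj1 (SR _)) (proj1 S2) Cw
    (fun y Hy => proj1 (proj2 (ER t y Ht Hy))) ltac:(lra)) as [F3 F4].
  split; [lra|]; intros y Hy; split; [now apply F2|now apply F4].
Qed.

Theorem proposition3p1 (r : nat) (Hr : (3 <= r)%nat) :
  exists m : nat,
  forall (T eta0 u0 c0 : R) (etai ui : R -> R) (eta u : R -> R -> R),
    0 < T ->
    0 < 1 + eta0 ->
    u0 ^ 2 < 1 + eta0 ->
    (forall x t, Icc 0 1 x -> Icc 0 T t -> 0 < 1 + eta x t) ->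
    Cm_rect T m eta ->
    Cm_rect T m u ->
    swe_solution T eta0 u0 etai ui eta u ->
    0 < c0 ->
    c0 <= u0 + sqrt (1 + eta0) ->
    u0 - sqrt (1 + eta0) <= - c0 ->
    (forall x t, Icc 0 1 x -> Icc 0 T t ->
       c0 <= u x t + sqrt (1 + eta x t) /\
       u x t - sqrt (1 + eta x t) <= - c0) ->
    let delta0 := sqrt (1 + eta0) in
    let v := fun x t => riemann_v eta0 u0 (eta x t) (u x t) in
    let w := fun x t => riemann_w eta0 u0 (eta x t) (u x t) in
    let vi := fun x => riemann_v eta0 u0 (etai x) (ui x) in
    let wi := fun x => riemann_w eta0 u0 (etai x) (ui x) in
    diag_solution T delta0 u0 vi wi v w /\
    forall kappa : R, 1 <= kappa ->
    exists h0 C : R, 0 < h0 /\ 0 < C /\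
    forall (N : nat) (x : nat -> R),
      is_partition N x ->
      let h := mesh_max N x in
      h <= h0 ->
      h <= kappa * mesh_min N x ->
      exists vh wh : R -> R -> R,
        semidiscrete_solution r N x T delta0 u0 vi wi vh wh /\
        (forall vh' wh' : R -> R -> R,
           semidiscrete_solution r N x T delta0 u0 vi wi vh' wh' ->
           forall t y, Icc 0 T t -> Icc 0 1 y ->
             vh' t y = vh t y /\ wh' t y = wh t y) /\
        (forall t, Icc 0 T t ->
           L2norm (fun y => v y t - vh t y) + L2norm (fun y => w y t - wh t y)
             <= C * h ^ (r - 1)) /\
        let etah := fun t y => (1 / 2 * (vh t y - wh t y) + delta0) ^ 2 - 1 in
        let uh := fun t y => vh t y + wh t y + u0 in
        (forall t, Icc 0 T t ->
           L2norm (fun y => eta y t - etah t y) + L2norm (fun y => u y t - uh t y)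
             <= C * h ^ (r - 1)).
Proof.
  (* The approximation uses [r] derivatives in [x] of [v], [w] and of their time derivatives. *)
  exists (S r); intros T eta0 u0 c0 etai ui eta u HT H0 _ Hpos Heta Hu Hswe Hc0 _ _ Hspeed
    delta0 v w vi wi.
  assert (Hdiag : diag_solution T delta0 u0 vi wi v w).
  { apply swe_diag; try easy; now apply Cm_rect_le with (S r); [lia|]. }
  split; [exact Hdiag|]; intros kappa Hkappa.
  destruct (riemann_xjet T eta0 u0 r eta u Hpos Heta Hu) as [[vd Hv] [wd Hw]].
  destruct (xjet_towers T r _ _ Hv) as [av [bv [Mv [HMv [Ev [Tv Jv]]]]]].
  destruct (xjet_towers T r _ _ Hw) as [aw [bw [Mw [HMw [Ew [Tw Jw]]]]]].
  assert (Hsq : forall x t, Icc 0 1 x -> Icc 0 T t ->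
    0 < sqrt (1 + eta x t) /\ sqrt (1 + eta x t) ^ 2 = 1 + eta x t).
  { intros x t Hx Ht; assert (Hp := Hpos x t Hx Ht); split; [now apply sqrt_lt_R0|].
    apply pow2_sqrt; lra. }
  (* [Hroot] and [Hsum] invert the map to Riemann invariants; [eta_h] and [u_h] are defined by the
     same formulas. *)
  assert (Hroot : forall x t, 1 / 2 * (v x t - w x t) + delta0 = sqrt (1 + eta x t))
    by (intros; unfold v, w, riemann_v, riemann_w, delta0; field).
  assert (Hsum : forall x t, v x t + w x t + u0 = u x t)
    by (intros; unfold v, w, riemann_v, riemann_w; field).
  assert (I0 : Icc 0 1 0) by (unfold Icc; lra); assert (I1 : Icc 0 1 1) by (unfold Icc; lra).
  destruct (diag_convergence r T delta0 u0 c0 (Mv + Mw) kappa vi wi v w av bv aw bw)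
    as [h0 [C [S [Hh0 [HC [HS Hconv]]]]]]; try easy.
  { lra. }
  { intros x t; split; [apply (Ev x t)|apply (Ew x t)]. }
  { intros t Ht; destruct (Tv t Ht) as [T1 T2]; destruct (Tw t Ht) as [T3 T4]; easy. }
  { intros i p Hi Hp; destruct (Jv i p Hi Hp) as [J1 J2]; destruct (Jw i p Hi Hp) as [J3 J4].
    split; [exact J1|split; [exact J3|]]; intros t Ht.
    destruct (J2 t Ht) as [A1 [A2 A3]]; destruct (J4 t Ht) as [B1 [B2 B3]].
    split; [exact A1|split; [exact B1|lra]]. }
  (* By [Hroot] and [Hsum] the characteristic speeds of the diagonal system are [u + sqrt (1 + eta)]
     and [u - sqrt (1 + eta)]. *)
  { intros t Ht; destruct (Hspeed 1 t I1 Ht) as [S1 _]; destruct (Hspeed 0 t I0 Ht) as [_ S2].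
    assert (R1 := Hroot 1 t); assert (R0 := Hroot 0 t); assert (U1 := Hsum 1 t); assert (U0 := Hsum 0 t).
    split; lra. }
  set (Mp := 2 * (Mv + Mw + delta0 + S)).
  assert (Hd0 : 0 <= delta0) by apply sqrt_pos.
  (* The error of [eta] contributes [C Mp], that of [u] contributes [C], and the last 1 makes the
     constant positive. *)
  exists h0, (C * (Mp + 1) + 1); split; [exact Hh0|split].
  { assert (0 <= C * (Mp + 1)) by (apply Rmult_le_pos; unfold Mp; lra); lra. }
  intros N x HP h Hh Hhk; destruct (Hconv N x HP Hh Hhk) as [vh [wh [Hsol [Huniq Herr]]]].
  assert (Hhpos : 0 < h) by now apply partition_mesh_pos.
  assert (Hhr : 0 < h ^ (r - 1)) by now apply pow_lt.
  exists vh, wh; split; [exact Hsol|split; [exact Huniq|]].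
  assert (Hmain : forall t, Icc 0 T t ->
    L2norm (fun y => v y t - vh t y) + L2norm (fun y => w y t - wh t y) <= C * h ^ (r - 1))
    by (intros t Ht; apply (Herr t Ht)).
  assert (HCMp : 0 <= C * Mp * h ^ (r - 1)).
  { apply Rmult_le_pos; [apply Rmult_le_pos; [easy|unfold Mp; lra]|lra]. }
  split.
  { intros t Ht; apply Rle_trans with (1 := Hmain t Ht); lra. }
  intros etah uh t Ht; destruct (Herr t Ht) as [Cvh [Cwh [_ Hsup]]]; specialize (Hmain t Ht).
  assert (Cv := cont2_space T v t Ht (xjet_cont2 T r v vd Hv)).
  assert (Cw := cont2_space T w t Ht (xjet_cont2 T r w wd Hw)).
  set (a := fun y => v y t - vh t y) in *; set (b := fun y => w y t - wh t y) in *.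
  assert (Ca : cont01 a) by now apply continuous_on_minus.
  assert (Cb : cont01 b) by now apply continuous_on_minus.
  assert (Hu' : L2norm (fun y => u y t - uh t y) <= L2norm a + L2norm b).
  { rewrite (L2norm_ext _ (fun y => a y + b y)); [now apply L2norm_triang|].
    intros y _; rewrite <- Hsum; unfold a, b, uh; ring. }
  (* The error of [eta] as a difference of squares [p^2 - q^2 = (p - q) (2 p - (p - q))] with
     [p - q = (a - b) / 2]; the second factor is bounded thanks to the maximum norm bound [S]. *)
  set (g := fun y => (1 / 2 * (a y - b y)) * (v y t - w y t + 2 * delta0 - 1 / 2 * (a y - b y))).
  unfold cont01 in *.
  assert (Cab : cont01 (fun y => a y + (-1) * b y)) by (unfold cont01; cont_on).
  assert (Cg : cont01 g) by (unfold cont01, g; cont_on).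
  assert (Hab : L2norm (fun y => a y + (-1) * b y) <= L2norm a + L2norm b).
  { apply Rle_trans with (1 := L2norm_triang a (fun y => (-1) * b y) Ca
      (continuous_on_mult 0 1 _ _ (continuous_on_const 0 1 (-1)) Cb)).
    rewrite L2norm_scal, (Rabs_left (-1)) by (easy || lra); lra. }
  assert (He' : L2norm (fun y => eta y t - etah t y) <= Mp * (L2norm a + L2norm b)).
  { rewrite (L2norm_ext _ g).
    2: { intros y Hy; destruct (Hsq y t Hy Ht) as [_ E]; rewrite <- Hroot in E.
         replace (eta y t) with ((1 / 2 * (v y t - w y t) + delta0) ^ 2 - 1) by lra.
         unfold g, a, b, etah; field. }
    assert (HMp : 0 <= Mp) by (unfold Mp; lra).
    apply Rle_trans with (Mp * L2norm (fun y => a y + (-1) * b y)); [|now apply Rmult_le_compat_l].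
    apply L2norm_le_sqr; [apply Rmult_le_pos; [easy|apply L2norm_nonneg]|].
    rewrite Rpow_mult_distr, L2norm_sqr by easy; apply inner_self_mult_le; [easy|easy|].
    intros y Hy; destruct (Hsup y Hy) as [S1 S2].
    destruct (Jv 0%nat y (Nat.le_0_l r) Hy) as [_ J2]; destruct (J2 t Ht) as [_ [A2 _]].
    destruct (Jw 0%nat y (Nat.le_0_l r) Hy) as [_ J4]; destruct (J4 t Ht) as [_ [B2 _]].
    rewrite (proj1 (Ev y t)) in A2; rewrite (proj1 (Ew y t)) in B2.
    fold (v y t) in A2; fold (w y t) in B2; fold (a y) in S1; fold (b y) in S2.
    apply Rabs_le_between in A2, B2, S1, S2.
    unfold g; replace (1 / 2 * (a y - b y) * (v y t - w y t + 2 * delta0 - 1 / 2 * (a y - b y)))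
      with ((1 / 2 * (v y t - w y t + 2 * delta0 - 1 / 2 * (a y - b y))) * (a y + -1 * b y)) by field.
    rewrite Rabs_mult; apply Rmult_le_compat_r; [apply Rabs_pos|].
    unfold Mp; apply Rabs_le; lra. }
  assert (HMp : Mp * (L2norm a + L2norm b) <= Mp * (C * h ^ (r - 1)))
    by (apply Rmult_le_compat_l; [unfold Mp; lra|easy]).
  lra.
Qed.
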